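(* Let $u,v:\mathrm{SPD}(n)\to\mathrm{SPD}(n)$ be two univariate diffeomorphisms. Then $(\mathrm{SPD}(n),g^{\mathrm{ME}(u,v)},u^*\nabla^{\mathrm{E}},v^*\nabla^{\mathrm{E}})$ is a dually-flat manifold and its canonical divergence is the $(u,v)$-divergence. In particular, for all $\alpha,\beta\in\mathbb{R}$, the manifold $(\mathrm{SPD}(n),g^{\mathrm{MPE}(\alpha,\beta)},\nabla^{\mathrm{PE}(\alpha)},\nabla^{\mathrm{PE}(\beta)})$ is dually-flat and its canonical divergence is the $(\alpha,\beta)$-divergence $D^{\alpha,\beta}$. The $(\alpha,\beta)$-divergences and the corresponding potentials $\psi^{\alpha,\beta}$ (up to an additive constant) are as follows, for $\Sigma,\Sigma'\in\mathrm{SPD}(n)$. (i) If $\alpha=\beta=0$: $D^{0,0}(\Sigma|\Sigma')=\frac12\|\log\Sigma-\log\Sigma'\|_{\mathrm{Frob}}^2$ and $\psi^{0,0}(\Sigma)=\frac12\mathrm{tr}(\log(\Sigma)^2)$. (ii) If $\alpha=\beta\neq0$: $D^{\alpha,\alpha}(\Sigma|\Sigma')=\frac{1}{2\alpha^2}\|\Sigma^\alpha-\Sigma'^\alpha\|_{\mathrm{Frob}}^2$ and $\psi^{\alpha,\alpha}(\Sigma)=\frac{1}{2\alpha^2}\mathrm{tr}(\Sigma^{2\alpha})$. (iii) If $\alpha=-\beta\neq0$: $D^{\alpha,-\alpha}(\Sigma|\Sigma')=-\frac{1}{\alpha^2}\mathrm{tr}\left[(I_n+\alpha\log\Sigma)-\alpha\log\Sigma'-\Sigma^\alpha\Sigma'^{-\alpha}\right]$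 and $\psi^{\alpha,-\alpha}(\Sigma)=-\frac1\alpha\mathrm{tr}(\log\Sigma)=-\frac1\alpha\log(\det\Sigma)$. (iv) If $\alpha\neq\beta=0$: $D^{\alpha,0}(\Sigma|\Sigma')=\frac1\alpha\mathrm{tr}\left[\left(\Sigma^\alpha\log\Sigma-\frac1\alpha\Sigma^\alpha\right)+\frac1\alpha\Sigma'^\alpha-\Sigma^\alpha\log\Sigma'\right]$ and $\psi^{\alpha,0}(\Sigma)=\frac1\alpha\mathrm{tr}\left(\Sigma^\alpha\log\Sigma-\frac1\alpha\Sigma^\alpha\right)$. (v) If $\alpha,\beta,\alpha+\beta,\alpha-\beta\neq0$: $D^{\alpha,\beta}(\Sigma|\Sigma')=\frac{1}{\alpha\beta}\mathrm{tr}\left[\frac{\alpha}{\alpha+\beta}\Sigma^{\alpha+\beta}+\frac{\beta}{\alpha+\beta}\Sigma'^{\alpha+\beta}-\Sigma^\alpha\Sigma'^\beta\right]$ and $\psi^{\alpha,\beta}(\Sigma)=\frac{1}{\beta(\alpha+\beta)}\mathrm{tr}(\Sigma^{\alpha+\beta})$.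
   Context: $\mathrm{Sym}(n)$: real symmetric $n\times n$ matrices; $\mathrm{SPD}(n)$: the manifold of symmetric positive definite matrices; $\log$: symmetric matrix logarithm; $\|\cdot\|_{\mathrm{Frob}}$: Frobenius norm. A univariate map $f:\mathrm{SPD}(n)\to\mathrm{Sym}(n)$ is one induced by a function $f:(0,\infty)\to\mathbb{R}$ through $f(PDP^\top)=P\,\mathrm{Diag}(f(d_1),\dots,f(d_n))P^\top$ ($P$ orthogonal, $D=\mathrm{Diag}(d_1,\dots,d_n)$, $d_i>0$); univariate maps are assumed smooth. A univariate diffeomorphism is one that is a diffeomorphism onto its image. The first divided difference is $f^{[1]}(x,y)=\frac{f(x)-f(y)}{x-y}$ if $x\neq y$, $f^{[1]}(x,x)=f'(x)$. Mixed-Euclidean metric: $g^{\mathrm{ME}(u,v)}_\Sigma(X,X)=\frac{1}{u'(1)v'(1)}\sum_{i,j}u^{[1]}(d_i,d_j)v^{[1]}(d_i,d_j)(X'_{ij})^2$ where $\Sigma=PDP^\top$, $X=PX'P^\top$, $P$ orthogonal, $D=\mathrm{Diag}(d_1,\dots,d_n)$. Mixed-Power-Euclidean metric: $g^{\mathrm{MPE}(\alpha,\beta)}=g^{\mathrm{ME}(F_\alpha,F_\beta)}$, where $F_\alpha(\Sigma)=\Sigma^\alpha$ if $\alpha\neq0$ and $F_0=\log$. $\nabla^{\mathrm{E}}$ is the canonical flat connection on $\mathrm{Sym}(n)$; $u^*\nabla^{\mathrm{E}}$ is its pullback by $u$; $\nabla^{\mathrm{PE}(\alpha)}=F_\alpha^*\nabla^{\mathrm{E}}$.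 Two affine connections $\nabla,\nabla^*$ on a Riemannian manifold $(\mathcal{M},g)$ are dual if $Z\,g(X,Y)=g(\nabla_ZX,Y)+g(X,\nabla^*_ZY)$ for all vector fields $X,Y,Z$. A connection is flat if there is a global chart onto an open set of a vector space which is an affine map for the canonical connection there. $(\mathcal{M},g,\nabla,\nabla^* )$ is dually-flat if $\nabla,\nabla^*$ are dual with respect to $g$ and both flat. Canonical divergence of a simply connected dually-flat manifold $(\mathcal{M},g,\nabla,\nabla^* )$ of dimension $N$: let $U,V:\mathcal{M}\to\mathbb{R}^N$ be global coordinate systems with $U$ $\nabla$-affine, $V$ $\nabla^*$-affine and $g(\frac{\partial}{\partial U^i},\frac{\partial}{\partial V^j})=\delta_{ij}$. Then $D(x,y)=\psi(x)+\varphi(y)-\langle U(x)|V(y)\rangle$, where the potentials $\psi,\varphi:\mathcal{M}\to\mathbb{R}$ satisfy $d_x\psi(X)=\langle V(x)|d_xU(X)\rangle$, $d_x\varphi(X)=\langle U(x)|d_xV(X)\rangle$ and $\psi(x)+\varphi(x)=\langle U(x)|V(x)\rangle$; they are unique up to an additive constant in $\psi$ compensated in $\varphi$. Here $\mathrm{Sym}(n)$ with the Frobenius inner product is identified with $\mathbb{R}^N$, $N=n(n+1)/2$. For $\mathrm{MPE}(\alpha,\beta)$ the potentials $\psi^{\alpha,\beta}$ are those relative to the coordinates $U=\frac1\alpha\Sigma^\alpha$ (or $U=\log\Sigma$ if $\alpha=0$) and $V=\frac1\beta\Sigma^\beta$ (or $V=\log\Sigma$ if $\beta=0$). The $(u,v)$-divergence,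 with the normalization matching $g^{\mathrm{ME}(u,v)}$, is $D^{u,v}(\Sigma|\Sigma')=\frac{1}{u'(1)v'(1)}\mathrm{tr}\left[\Psi(\Sigma)+\Phi(\Sigma')-u(\Sigma)v(\Sigma')\right]$, where $\Psi,\Phi$ are the univariate maps induced by $\Psi(x)=\int_1^xv(s)u'(s)\,ds$ and $\Phi(x)=u(1)v(1)+\int_1^xu(s)v'(s)\,ds$. The $(\alpha,\beta)$-divergence is the case $u=F_\alpha$, $v=F_\beta$. *)

(* Defs.v *)
From HB Require Import structures.
From mathcomp Require Import all_boot all_order all_algebra.
From mathcomp Require Import all_classical all_reals all_analysis.
From mathcomp Require Import ring.

Set Implicit Arguments.
Unset Strict Implicit.
Unset Printing Implicit Defensive.
Import Order.TTheory GRing.Theory Num.Theory.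
Import numFieldNormedType.Exports.
Local Open Scope classical_set_scope.
Local Open Scope ring_scope.

(** * Differential geometry on an open subset [A] of a normed space [V]

    Functions, vector fields, metrics and connections on [A] are total
    functions of which only the behaviour on [A] matters.  The tangent space
    at every point of [A] is [V]. *)

Section SmoothMaps.
Context {R : realType}.

(* In finite dimension, continuity of x |-> 'd f x v for every v is continuity
   of x |-> 'd f x, so this is the usual class C^k. *)
Fixpoint Ck (k : nat) (V W : normedModType R) (A : set V) (f : V -> W) : Prop :=
  if k is k'.+1 then
    (forall x, A x -> differentiable f x) /\
    (forall v : V, Ck k' A (fun x => 'd f x v))
  else forall x, A x -> {for x, continuous f}.

Definition smooth_on (V W : normedModType R) (A : set V) (f : V -> W) : Prop :=
  forall k, Ck k A f.

Definition inv_on (V W : normedModType R) (A : set V) (f : V -> W) : W -> V :=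
  'pinv_(fun=> 0) A f.

Definition diffeo_onto_image (V W : normedModType R) (A : set V) (f : V -> W)
    : Prop :=
  [/\ {in A &, injective f}, open (f @` A), smooth_on A f
    & smooth_on (f @` A) (inv_on A f)].

End SmoothMaps.

Section Connections.
Context {R : realType}.

Definition vfield (V : normedModType R) : Type := V -> V.

Definition connection (V : normedModType R) : Type :=
  vfield V -> vfield V -> vfield V.

(* The first clause says that [nabla] operates on vector fields on [A],
   independently of their extensions outside [A]. *)
Definition affine_connection (V : normedModType R) (A : set V)
    (nabla : connection V) : Prop :=
  [/\ forall X X' Y Y' : vfield V,
        smooth_on A X -> smooth_on A X' -> smooth_on A Y -> smooth_on A Y' ->
        {in A, X =1 X'} -> {in A, Y =1 Y'} ->
        {in A, nabla X Y =1 nabla X' Y'},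
      forall X Y : vfield V,
        smooth_on A X -> smooth_on A Y -> smooth_on A (nabla X Y),
      forall (f : V -> R^o) (X X' Y : vfield V), smooth_on A f ->
        smooth_on A X -> smooth_on A X' -> smooth_on A Y ->
        forall x, A x -> nabla (fun y => f y *: X y + X' y) Y x =
                         f x *: nabla X Y x + nabla X' Y x,
      forall X Y Y' : vfield V,
        smooth_on A X -> smooth_on A Y -> smooth_on A Y' ->
        forall x, A x -> nabla X (fun y => Y y + Y' y) x =
                         nabla X Y x + nabla X Y' x
    & forall (f : V -> R^o) (X Y : vfield V), smooth_on A f ->
        smooth_on A X -> smooth_on A Y ->
        forall x, A x -> nabla X (fun y => f y *: Y y) x =
                         'd f x (X x) *: Y x + f x *: nabla X Y x].

Definition flat_connection (V : normedModType R) : connection V :=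
  fun X Y x => 'd Y x (X x).

Definition pushforward (V W : normedModType R) (A : set V) (f : V -> W)
    (X : vfield V) : vfield W :=
  fun z => 'd f (inv_on A f z) (X (inv_on A f z)).

(* [f] is meant to be a diffeomorphism from [A] onto its image, and [nabla] a
   connection on that image. *)
Definition pullback_connection (V W : normedModType R) (A : set V) (f : V -> W)
    (nabla : connection W) : connection V :=
  fun X Y x =>
    'd (inv_on A f) (f x) (nabla (pushforward A f X) (pushforward A f Y) (f x)).

Definition affine_chart (V W : normedModType R) (A : set V)
    (nabla : connection V) (f : V -> W) : Prop :=
  diffeo_onto_image A f /\
  forall X Y : vfield V, smooth_on A X -> smooth_on A Y ->
  forall x, A x ->
    'd f x (nabla X Y x) =
    flat_connection (pushforward A f X) (pushforward A f Y) (f x).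

Definition flat (V : normedModType R) (A : set V) (nabla : connection V)
    : Prop :=
  exists (W : normedModType R) (f : V -> W), affine_chart A nabla f.

Definition riemannian_metric (V : normedModType R) (A : set V)
    (g : V -> V -> V -> R) : Prop :=
  [/\ forall x, A x -> forall (a : R) (X X' Y : V),
        g x (a *: X + X') Y = a * g x X Y + g x X' Y,
      forall x, A x -> forall X Y : V, g x X Y = g x Y X,
      forall x, A x -> forall X : V, X != 0 -> 0 < g x X X
    & forall X Y : V, smooth_on A (fun x => g x X Y : R^o)].

Definition dual_connections (V : normedModType R) (A : set V)
    (g : V -> V -> V -> R) (nabla nabla' : connection V) : Prop :=
  forall X Y Z : vfield V,
    smooth_on A X -> smooth_on A Y -> smooth_on A Z ->
    forall x, A x ->
      'd (fun y => g y (X y) (Y y) : R^o) x (Z x) =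
      g x (nabla Z X x) (Y x) + g x (X x) (nabla' Z Y x).

Definition dually_flat (V : normedModType R) (A : set V)
    (g : V -> V -> V -> R) (nabla nabla' : connection V) : Prop :=
  [/\ [/\ open A, riemannian_metric A g, affine_connection A nabla
        & affine_connection A nabla'],
      dual_connections A g nabla nabla', flat A nabla & flat A nabla'].

End Connections.

Section CanonicalDivergence.
Context {R : realType}.

(* [E] is the common target of the coordinates [U] and [V], with inner product
   [ip]. *)
Definition are_potentials (M E : normedModType R) (ip : E -> E -> R)
    (A : set M) (U V : M -> E) (psi phi : M -> R) : Prop :=
  forall x, A x ->
    [/\ differentiable (psi : M -> R^o) x, differentiable (phi : M -> R^o) x,
        forall X : M, 'd (psi : M -> R^o) x X = ip (V x) ('d U x X),
        forall X : M, 'd (phi : M -> R^o) x X = ip (U x) ('d V x X)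
      & psi x + phi x = ip (U x) (V x)].

Definition dotmx (N : nat) (x y : 'rV[R]_N) : R := \sum_i x 0 i * y 0 i.

(* The coordinate vector field d/dU^i at x, for a chart U : A -> R^N. *)
Definition coord_field (M : normedModType R) (N : nat) (A : set M)
    (U : M -> 'rV[R]_N) (i : 'I_N) : vfield M :=
  fun x => 'd (inv_on A U) (U x) (delta_mx 0 i).

Definition canonical_divergence (M : normedModType R) (N : nat) (A : set M)
    (g : M -> M -> M -> R) (nabla nabla' : connection M) (D : M -> M -> R)
    : Prop :=
  exists (U V : M -> 'rV[R]_N) (psi phi : M -> R),
    [/\ affine_chart A nabla U, affine_chart A nabla' V,
        forall x, A x -> forall i j : 'I_N,
          g x (coord_field A U i x) (coord_field A V j x) = (i == j)%:R,
        are_potentials (@dotmx N) A U V psi phi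
      & forall x y, A x -> A y -> D x y = psi x + phi y - dotmx (U x) (V y)].

End CanonicalDivergence.

(** * Symmetric matrices *)

Section SymDef.
Context {R : realType} {n : nat}.

Definition symm_pred : {pred 'M[R]_n} := fun A => A^T == A.

Fact symm_submod_closed : submod_closed symm_pred.
Proof.
split=> [|a u v /eqP su /eqP sv]; first by apply/eqP; rewrite trmx0.
by apply/eqP; rewrite linearP /= su sv.
Qed.

HB.instance Definition _ :=
  GRing.isSubmodClosed.Build R 'M[R]_n symm_pred symm_submod_closed.

Record Sym : Type := MkSym { symval :> 'M[R]_n; _ : symval \in symm_pred }.

HB.instance Definition _ := [isSub for symval].
HB.instance Definition _ := [Choice of Sym by <:].
HB.instance Definition _ := [SubChoice_isSubLmodule of Sym by <:].

Lemma symP (X : Sym) : (X : 'M[R]_n)^T = X.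
Proof. by case: X => X /= /eqP. Qed.

Lemma symvalD (X Y : Sym) : symval (X + Y) = symval X + symval Y.
Proof. by []. Qed.

Lemma symvalZ (a : R) (X : Sym) : symval (a *: X) = a *: symval X.
Proof. by []. Qed.

Definition frobdot (X Y : Sym) : R := \sum_i \sum_j X i j * Y i j.
Definition frobnorm (X : Sym) : R := Num.sqrt (frobdot X X).

Lemma frobdotC X Y : frobdot X Y = frobdot Y X.
Proof. by apply: eq_bigr => i _; apply: eq_bigr => j _; rewrite mulrC. Qed.

Lemma frobdotDl X Y Z : frobdot (X + Y) Z = frobdot X Z + frobdot Y Z.
Proof.
rewrite -big_split; apply: eq_bigr => i _; rewrite -big_split.
by apply: eq_bigr => j _; rewrite symvalD mxE mulrDl.
Qed.

Lemma frobdotZl a X Y : frobdot (a *: X) Y = a * frobdot X Y.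
Proof.
rewrite mulr_sumr; apply: eq_bigr => i _; rewrite mulr_sumr.
by apply: eq_bigr => j _; rewrite symvalZ mxE mulrA.
Qed.

Lemma frobdot_ge0 X : 0 <= frobdot X X.
Proof. by apply: sumr_ge0 => i _; apply: sumr_ge0 => j _; exact: sqr_ge0. Qed.

Lemma frobdot_eq0 X : frobdot X X = 0 -> X = 0.
Proof.
move=> X0; apply/val_inj/matrixP => i j; rewrite raddf0 mxE.
have Pi k : k \in index_enum 'I_n -> true -> 0 <= \sum_l X k l * X k l.
  by move=> _ _; apply: sumr_ge0 => l _; exact: sqr_ge0.
have /psumr_eq0P := X0.
move=> /(_ (fun k _ => Pi k (mem_index_enum k) isT) i isT) /psumr_eq0P.
move=> /(_ (fun l _ => sqr_ge0 (X i l)) j isT) /eqP.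
by rewrite mulf_eq0 orbb => /eqP.
Qed.

Lemma frobdot_CS X Y : frobdot X Y ^+ 2 <= frobdot X X * frobdot Y Y.
Proof.
have [Y0|Yn0] := eqVneq (frobdot Y Y) 0.
  by rewrite (frobdot_eq0 Y0) frobdotC -(scale0r 0) !frobdotZl !mul0r mulr0
             expr0n.
have Yp : 0 < frobdot Y Y by rewrite lt_def Yn0 frobdot_ge0.
set p := frobdot X Y; set q := frobdot Y Y in Yn0 Yp *.
have := frobdot_ge0 (q *: X + (- p) *: Y).
rewrite !(frobdotDl, frobdotZl, frobdotC _ (_ + _)).
rewrite -/q -/p (frobdotC Y X) -/p.
have -> : q * (q * frobdot X X + - p * p) + - p * (q * p + - p * q) =
  q * (frobdot X X * q - p ^+ 2) by ring.
by rewrite pmulr_rge0// subr_ge0.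
Qed.

Fact frobnormD X Y : frobnorm (X + Y) <= frobnorm X + frobnorm Y.
Proof.
have le0 Z : 0 <= frobnorm Z by exact: sqrtr_ge0.
rewrite -(ler_pXn2r (ltn0Sn 1)) ?nnegrE ?addr_ge0//.
rewrite sqrrD !sqr_sqrtr ?frobdot_ge0//.
rewrite !(frobdotDl, frobdotC _ (_ + _)) (frobdotC Y X).
have : frobdot X Y <= frobnorm X * frobnorm Y.
  rewrite (le_trans (ler_norm _))// -sqrtr_sqr -sqrtrM ?frobdot_ge0//.
  by rewrite ler_wsqrtr// frobdot_CS.
set a := frobdot X Y; set b := _ * _ => ab.
rewrite -addrA (addrA a) -mulr2n addrA.
by rewrite lerD2r lerD2l lerMn2r ab.
Qed.

Fact frobnormZ (a : R) X : frobnorm (a *: X) = `|a| * frobnorm X.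
Proof.
rewrite /frobnorm frobdotZl frobdotC frobdotZl mulrA -expr2.
by rewrite sqrtrM ?sqr_ge0// sqrtr_sqr.
Qed.

Fact frobnorm_eq0 X : frobnorm X = 0 -> X = 0.
Proof.
move=> /eqP; rewrite sqrtr_eq0 => X0; apply: frobdot_eq0; apply/eqP.
by rewrite eq_le X0 frobdot_ge0.
Qed.

HB.instance Definition _ :=
  Lmodule_isNormed.Build R Sym frobnormD frobnormZ frobnorm_eq0.

Lemma Sym_normE (X : Sym) : `|X| = frobnorm X.
Proof. by []. Qed.

End SymDef.
Arguments Sym : clear implicits.

Definition SPD (R : realType) (n : nat) : set (Sym R n) :=
  [set S | forall x : 'cV[R]_n, x != 0 -> 0 < (x^T *m S *m x) 0 0].
Arguments SPD : clear implicits.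

(** * Univariate maps *)

Section Univariate.
Context {R : realType} {n : nat}.

Definition orthogonal_mx (P : 'M[R]_n) : Prop := P^T *m P = 1%:M.

Definition eigen_decomposition (S : Sym R n) (Pd : 'M[R]_n * 'rV[R]_n) : Prop :=
  orthogonal_mx Pd.1 /\
  symval S = Pd.1 *m diag_mx Pd.2 *m Pd.1^T.

(* A chosen eigendecomposition; [umapE] and [metric_MEE] show that the choice
   is immaterial. *)
Definition eigen (S : Sym R n) : 'M[R]_n * 'rV[R]_n :=
  xget (1%:M, 0) [set Pd | eigen_decomposition S Pd].

Fact conj_diag_symm (P : 'M[R]_n) (d : 'rV[R]_n) :
  P *m diag_mx d *m P^T \in symm_pred.
Proof. by apply/eqP; rewrite !trmx_mul trmxK tr_diag_mx mulmxA. Qed.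

Definition umap (f : R -> R) (S : Sym R n) : Sym R n :=
  let: (P, d) := eigen S in MkSym (conj_diag_symm P (map_mx f d)).

Definition univariate_diffeo (f : R -> R) : Prop :=
  diffeo_onto_image (SPD R n) (umap f).

Definition div_diff (f : R -> R) (x y : R) : R :=
  if x == y then derive1 f x else (f x - f y) / (x - y).

(* The symmetric bilinear form polarizing the quadratic form of the
   Mixed-Euclidean metric. *)
Definition metric_ME (u v : R -> R) (S X Y : Sym R n) : R :=
  let: (P, d) := eigen S in
  let X' := P^T *m X *m P in
  let Y' := P^T *m Y *m P in
  (derive1 u 1 * derive1 v 1)^-1 *
  \sum_i \sum_j div_diff u (d 0 i) (d 0 j) * div_diff v (d 0 i) (d 0 j) *
                (X' i j * Y' i j).

Definition pullback_flat (u : R -> R) : connection (Sym R n) :=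
  pullback_connection (SPD R n) (umap u) (@flat_connection R (Sym R n)).

Lemma eigenP (S : Sym R n) Pd :
  eigen_decomposition S Pd -> eigen_decomposition S (eigen S).
Proof. by move=> SPd; rewrite /eigen; case: xgetP => [//|/(_ Pd)]. Qed.

Lemma orthogonal_mxV (P : 'M[R]_n) : orthogonal_mx P -> P *m P^T = 1%:M.
Proof. exact: mulmx1C. Qed.

(* Two eigendecompositions differ by an orthogonal matrix relating only equal
   eigenvalues. *)
Lemma eigen_transition (S : Sym R n) P d Q e :
  eigen_decomposition S (P, d) -> eigen_decomposition S (Q, e) ->
  forall i j, (Q^T *m P) i j != 0 -> e 0 i = d 0 j.
Proof.
move=> [/= oP SP] [/= oQ SQ] i j O0; have PQ := etrans (esym SP) SQ.
have E : Q^T *m P *m diag_mx d = diag_mx e *m (Q^T *m P).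
  have := congr1 (fun M => Q^T *m M *m P) PQ.
  by rewrite !mulmxA oQ mul1mx -!mulmxA oP mulmx1 !mulmxA.
have /matrixP/(_ i j) := E.
rewrite mul_mx_diag mul_diag_mx !mxE mulrC => /(mulIf _) -> //.
by move: O0; rewrite mxE.
Qed.

Lemma umapE (f : R -> R) (S : Sym R n) (P : 'M[R]_n) (d : 'rV[R]_n) :
  orthogonal_mx P -> symval S = P *m diag_mx d *m P^T ->
  symval (umap f S) = P *m diag_mx (map_mx f d) *m P^T.
Proof.
move=> oP SP; have SPd : eigen_decomposition S (P, d) by [].
have := eigenP SPd; rewrite /umap; case: (eigen S) => Q e SQe /=.
have tr := eigen_transition SPd SQe.
have E : Q^T *m P *m diag_mx (map_mx f d) = diag_mx (map_mx f e) *m (Q^T *m P).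
  move: (Q^T *m P) tr => O tr; apply/matrixP => i j.
  rewrite mul_mx_diag mul_diag_mx !mxE.
  have [->|/tr ed] := eqVneq (O i j) 0; first by rewrite mul0r mulr0.
  by rewrite ed mulrC.
have [/= oQ _] := SQe.
have /(congr1 (fun M => Q *m M *m P^T)) := E.
rewrite !mulmxA (orthogonal_mxV oQ) mul1mx => ->.
by rewrite -!mulmxA (orthogonal_mxV oP) mulmx1.
Qed.

Lemma metric_MEE (u v : R -> R) (S X Y : Sym R n) P d :
  orthogonal_mx P -> symval S = P *m diag_mx d *m P^T ->
  metric_ME u v S X Y = (derive1 u 1 * derive1 v 1)^-1 *
  \sum_i \sum_j div_diff u (d 0 i) (d 0 j) * div_diff v (d 0 i) (d 0 j) *
                ((P^T *m X *m P) i j * (P^T *m Y *m P) i j).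
Proof.
move=> oP SP; have SPd : eigen_decomposition S (P, d) by [].
have := eigenP SPd; rewrite /metric_ME; case: (eigen S) => Q e SQe.
have tr := eigen_transition SPd SQe; have [/= oQ _] := SQe.
congr (_ * _); pose h x y := div_diff u x y * div_diff v x y.
have frobE (A B : 'M[R]_n) : \sum_i \sum_j A i j * B i j = \tr (A *m B^T).
  by apply: eq_bigr => i _; rewrite mxE; apply: eq_bigr => j _; rewrite !mxE.
pose H (c : 'rV[R]_n) (Z : 'M[R]_n) := \matrix_(i, j) (h (c 0 i) (c 0 j) * Z i j).
have sumE (c : 'rV[R]_n) (A B : 'M[R]_n) :
    \sum_i \sum_j h (c 0 i) (c 0 j) * (A i j * B i j) = \tr (H c A *m B^T).
  by rewrite -frobE; apply: eq_bigr => i _; apply: eq_bigr => j _;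
     rewrite mxE mulrA.
have HO (O Z : 'M[R]_n) : (forall i j, O i j != 0 -> e 0 i = d 0 j) ->
    H e (O *m Z *m O^T) = O *m H d Z *m O^T.
  move=> {}tr; apply/matrixP => i j.
  rewrite !mxE mulr_sumr; apply: eq_bigr => l _.
  rewrite !mxE mulrA mulr_sumr !mulr_suml; apply: eq_bigr => k _.
  rewrite mxE.
  have [->|/tr ->] := eqVneq (O i k) 0; first by rewrite !(mul0r, mulr0).
  have [->|/tr ->] := eqVneq (O j l) 0; first by rewrite !mulr0.
  ring.
pose O := Q^T *m P; rewrite -/O in tr.
have conjO Z : Q^T *m Z *m Q = O *m (P^T *m Z *m P) *m O^T.
  rewrite /O trmx_mul trmxK !mulmxA -(mulmxA Q^T P) (orthogonal_mxV oP) mulmx1.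
  by rewrite -!mulmxA (mulmxA P P^T) (orthogonal_mxV oP) mul1mx.
have OO : O^T *m O = 1%:M.
  rewrite /O trmx_mul trmxK -!mulmxA (mulmxA Q) (orthogonal_mxV oQ) mul1mx.
  exact: oP.
rewrite !sumE !conjO (HO _ _ tr); clearbody O.
move: (P^T *m X *m P) (P^T *m Y *m P) => A B.
rewrite !trmx_mul trmxK !mulmxA -(mulmxA _ O^T O) OO mulmx1.
by rewrite -2!mulmxA mxtrace_mulC -!mulmxA OO mulmx1.
Qed.

End Univariate.
Arguments univariate_diffeo {R} n f.

(** * The divergences *)

Section Divergences.
Context {R : realType} {n : nat}.

(* The integral from a to b, signed according to the order of a and b. *)
Definition oriented_integral (a b : R) (f : R -> R) : R :=
  if a <= b then Rintegral lebesgue_measure `[a, b] f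
  else - Rintegral lebesgue_measure `[b, a] f.

Definition Psi (u v : R -> R) (x : R) : R :=
  oriented_integral 1 x (fun s => v s * derive1 u s).

Definition Phi (u v : R -> R) (x : R) : R :=
  u 1 * v 1 + oriented_integral 1 x (fun s => u s * derive1 v s).

Definition uv_divergence (u v : R -> R) (S S' : Sym R n) : R :=
  (derive1 u 1 * derive1 v 1)^-1 *
  \tr (symval (umap (Psi u v) S) + symval (umap (Phi u v) S')
       - umap u S *m umap v S').

Definition Falpha (a : R) : R -> R :=
  if a == 0 then @ln R else fun x => x `^ a.

Definition metric_MPE (a b : R) : Sym R n -> Sym R n -> Sym R n -> R :=
  metric_ME (Falpha a) (Falpha b).

Definition connection_PE (a : R) : connection (Sym R n) :=
  pullback_flat (Falpha a).

Definition ab_divergence (a b : R) : Sym R n -> Sym R n -> R :=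
  uv_divergence (Falpha a) (Falpha b).

Definition logm (S : Sym R n) : Sym R n := umap (@ln R) S.
Definition powm (a : R) (S : Sym R n) : Sym R n := umap (fun x => x `^ a) S.

Definition coord_PE (a : R) (S : Sym R n) : Sym R n :=
  if a == 0 then logm S else a^-1 *: powm a S.

(* [psi] is a potential psi^(a,b), one of the functions that the definition of
   potentials determines up to an additive constant. *)
Definition is_potential_MPE (a b : R) (psi : Sym R n -> R) : Prop :=
  exists phi : Sym R n -> R,
    are_potentials frobdot (SPD R n) (coord_PE a) (coord_PE b) psi phi.

(* [psi0] is the potential psi^(a,b), up to an additive constant. *)
Definition potential_MPE_is (a b : R) (psi0 : Sym R n -> R) : Prop :=
  forall psi : Sym R n -> R, is_potential_MPE a b psi <->
    exists c : R, forall S, SPD R n S -> psi S = psi0 S + c.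

End Divergences.

(* Main.v *)
From HB Require Import structures.
Require Import Defs.
From mathcomp Require Import all_boot all_order all_algebra.
From mathcomp Require Import all_classical all_reals all_analysis.
From mathcomp Require Import ring lra.
From mathcomp Require Import complex.
Set Implicit Arguments.
Unset Strict Implicit.
Unset Printing Implicit Defensive.
Import Order.TTheory GRing.Theory Num.Theory.
Import numFieldNormedType.Exports.
Local Open Scope classical_set_scope.
Local Open Scope ring_scope.

(** The metric is a Frobenius product seen through two charts. By the theorem of
    Daleckii and Krein ([umap_is_diff]), the differential of a univariate map u at
    a matrix with eigenvalues d_i multiplies the entries in an eigenbasis by the
    divided differences u[1](d_i, d_j). Therefore

      g(X, Y) = (u'(1) v'(1))^-1 <du X | dv Y>        ([metric_ME_frobdot]).

    In the chart u, the connection pulled back by u differentiates the expression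
    du X of the field X ([diff_pullback_flat]), so that duality of the two connections
    is the Leibniz rule for the Frobenius product. The metric is positive because u
    and v are strictly monotone: their derivatives are continuous and, as is seen on
    scalar matrices, do not vanish ([div_diff_sign]).

    For the divergence, the differential of tr h(S) is <h'(S) | dS>, and
    <v(S) | du X> = <(v u')(S) | X>. Hence tr Psi and tr Phi, normalized, are
    potentials for the coordinates u and v as soon as Psi' = v u' and Phi' = u v', and
    the constant in Phi is chosen so that Psi + Phi = u v
    ([ME_canonical_divergence]).

    To apply this to powers and to the logarithm one must know that these are
    diffeomorphisms. The exponential of a block triangular matrix with diagonal
    blocks X, X and corner v has the differential of the exponential at X, applied to
    v, as its own corner. So the derivative of the exponential is an exponential of
    larger size, and smoothness follows by induction on the order of differentiation,
    simultaneously for all sizes ([expmx_is_diff],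
    [expmx_smooth]). The logarithm is the inverse of the exponential: it is
    differentiable by Daleckii and Krein, and then smooth by Cramer's rule
    ([smooth_inverse]). Powers are exp (a log S).

    The closed forms only require antiderivatives of v u' and u v' on the positive
    half-line ([ab_divergenceE]). Potentials are unique up to a constant because
    the positive definite matrices form a convex set ([potential_MPE_tr]). *)

Ltac nneg := repeat first [exact: normr_ge0 | exact: ltW | exact: ler01
  | apply: mulr_ge0 | apply: addr_ge0 | apply: exprn_ge0 ].

(** * Differentials *)

Section Diff.
Context {R : realType}.
Implicit Types V W X : normedModType R.

(** A predicate on bare functions and not a structure, because the maps it is
    applied to are mostly given by abstractions. *)
Definition bounded_linear V W (L : V -> W) : Prop :=
  linear L /\ exists2 K, 0 < K & forall v, `|L v| <= K * `|v|.

Lemma bounded_linear_cont V W (L : {linear V -> W}) :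
  bounded_linear L -> continuous L.
Proof.
case=> _ [K K0 LK]; apply: bounded_linear_continuous.
apply/linear_boundedP.
have : \forall r \near +oo, K <= r by apply: nbhs_pinfty_ge; rewrite num_real.
apply: filterS => r Kr v; apply: (le_trans (LK v)).
by apply: ler_wpM2r.
Qed.

(** The epsilon-delta form in which the estimates below produce and use
    differentials; the linear map is part of the statement, so that the
    uniqueness of differentials need not be argued each time. *)
Lemma is_diffP V W (f : V -> W) (L : V -> W) x :
  is_diff x f L <->
  bounded_linear L /\
  forall e, 0 < e -> exists2 d, 0 < d &
    forall h, `|h| < d -> `|f (x + h) - f x - L h| <= e * `|h|.
Proof.
split.
  move=> D; have df := @ex_diff _ _ _ _ _ _ _ D.
  have dL := @diff_val _ _ _ _ _ _ _ D.
  split.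
    rewrite -dL; split; first exact: linearP.
    have /linear_lipschitz[k k0 kb] := diff_continuous df.
    by exists k.
  move=> e e0.
  have [_ H] := (diff_locallyP x f).1 df.
  move: H => /eqaddoP/(_ e e0).
  move=> /nbhs_ballP[d /= d0 dH]; exists d => // h hd.
  have := dH h; rewrite -ball_normE /= sub0r normrN => /(_ hd).
  by rewrite /= /cst -[X in `|X| <= _]/(f (h + x) - (f x + 'd f x h)) dL (addrC h)
    opprD addrA.
move=> [Lb Le]; have [Llin _] := Lb.
pose LM := GRing.isLinear.Build _ _ _ _ _ Llin.
pose L' : {linear V -> W} := HB.pack L LM.
have Lc : continuous L' by exact: bounded_linear_cont.
have E : f \o shift x = cst (f x) + L' +o_ 0 id.
  apply/eqaddoP => e e0; have [d d0 H] := Le e e0.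
  apply/nbhs_ballP; exists d => //= h; rewrite -ball_normE /= sub0r normrN => hd.
  rewrite -[X in `|X| <= _]/(f (h + x) - (f x + L' h)).
  by rewrite opprD addrA [h + x]addrC; exact: H.
have dfL := diff_unique Lc E.
apply: DiffDef => //; apply/diff_locallyP; rewrite dfL.
by split.
Qed.

Lemma is_diff_val V W (f : V -> W) L x : is_diff x f L -> 'd f x = L :> (V -> W).
Proof. by move=> D; exact: (@diff_val _ _ _ _ _ _ _ D). Qed.

Lemma is_diff_ex V W (f : V -> W) L x : is_diff x f L -> differentiable f x.
Proof. by move=> D; exact: (@ex_diff _ _ _ _ _ _ _ D). Qed.

Lemma diff_bounded V W (f : V -> W) x :
  differentiable f x -> bounded_linear ('d f x).
Proof. by move=> /differentiableP/is_diffP[]. Qed.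

Lemma is_diff_blin V W (L : V -> W) x : bounded_linear L -> is_diff x L L.
Proof.
move=> Lb; apply/is_diffP; split=> // e e0; exists 1 => // h _.
have [Ll _] := Lb; have := Ll 1 x h; rewrite !scale1r => ->.
by rewrite (addrC (L x)) addrK subrr normr0; nneg.
Qed.

(** Differentials are local, so an identity that holds on an open set only can be
    differentiated there. *)
Lemma is_diff_ext V W (A : set V) (f g : V -> W) L x :
  open A -> A x -> (forall y, A y -> f y = g y) -> is_diff x f L ->
  is_diff x g L.
Proof.
move=> oA Ax fg /is_diffP[Lb H]; apply/is_diffP; split=> // e e0.
have [d d0 Hd] := H e e0.
have /nbhs_ballP[r /= r0 rA] := open_nbhs_nbhs (conj oA Ax).
exists (Num.min d r); first by rewrite lt_min d0 r0.
move=> h; rewrite lt_min => /andP[hd hr].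
rewrite -!fg //; first exact: Hd.
by apply: rA; rewrite -ball_normE /= opprD addNKr normrN.
Qed.

Lemma is_diff_lip V W (f : V -> W) L x : is_diff x f L ->
  exists2 K, 0 < K & exists2 d, 0 < d &
    forall h, `|h| < d -> `|f (x + h) - f x| <= K * `|h|.
Proof.
move=> /is_diffP[[_ [K K0 LK]] /(_ 1 ltr01)[d d0 H]].
exists (K + 1); first by rewrite addr_gt0.
exists d => // h /H; rewrite mul1r => Hh.
rewrite -[_ - _](subrK (L h)) (le_trans (ler_normD _ _))//.
by rewrite mulrDl mul1r addrC lerD.
Qed.

(** The increment of a bilinear map: a and b are its values at the two ends, c and d
    the two partial differentials, p and q the two mixed values. *)
Fact zmod_split (W : zmodType) (a b c d p q : W) :
  a - b - (c + d) = (p - b - c) + (q - b - d) + (a - q - (p - b)).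
Proof.
move: (p - b) => s; rewrite [RHS]addrC [RHS]addrA (addrA _ s) subrK !addrA.
by rewrite [a - q - c]addrAC subrK opprD addrA [a - c - b]addrAC.
Qed.

Definition bounded_bilinear V1 V2 W (B : V1 -> V2 -> W) : Prop :=
  [/\ forall b, linear (B^~ b), forall a, linear (B a) &
      exists2 K, 0 < K & forall a b, `|B a b| <= K * (`|a| * `|b|)].

(** The remainder of B f g consists of the remainders of f and of g, and of B
    applied to the two increments, which is quadratic in h by [is_diff_lip]. *)
Lemma is_diff_bilin V V1 V2 W (B : V1 -> V2 -> W) f df g dg (x : V) :
  bounded_bilinear B -> is_diff x f df -> is_diff x g dg ->
  is_diff x (fun y => B (f y) (g y))
    (fun v => B (f x) (dg v) + B (df v) (g x)).
Proof.
move=> [Bl Br [K K0 BK]] Df Dg.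
have [Kf Kf0 [d1 d10 Lf]] := is_diff_lip Df.
have [Kg Kg0 [d2 d20 Lg]] := is_diff_lip Dg.
have /is_diffP[[dfl [kf kf0 kfb]] Ef] := Df.
have /is_diffP[[dgl [kg kg0 kgb]] Eg] := Dg.
have BDl a a' b : B (a + a') b = B a b + B a' b.
  by have := Bl b 1 a a'; rewrite !scale1r.
have BDr a b b' : B a (b + b') = B a b + B a b'.
  by have := Br a 1 b b'; rewrite !scale1r.
have B0l b : B 0 b = 0 by have := BDl 0 0 b; rewrite addr0 -[LHS]addr0 => /addrI.
have B0r b : B b 0 = 0 by have := BDr b 0 0; rewrite addr0 -[LHS]addr0 => /addrI.
have BNl a b : B (- a) b = - B a b.
  by apply/eqP; rewrite -addr_eq0 -BDl addNr B0l.
have BNr a b : B a (- b) = - B a b.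
  by apply/eqP; rewrite -addr_eq0 -BDr addNr B0r.
apply/is_diffP; split.
  split.
    move=> a u v; rewrite dgl dfl Br Bl scalerDr; 
    by rewrite -!addrA; congr (_ + _); rewrite addrCA.
  exists (K * (`|f x| * kg + kf * `|g x|) + 1).
    by rewrite ltr_wpDl//; nneg.
  move=> v; rewrite (le_trans (ler_normD _ _))// mulrDl mul1r.
  rewrite ler_wpDr// mulrDr mulrDl lerD//.
    rewrite (le_trans (BK _ _))// -mulrA ler_wpM2l ?(ltW K0)// -mulrA.
    by rewrite ler_wpM2l// kgb.
  rewrite (le_trans (BK _ _))// -mulrA ler_wpM2l ?(ltW K0)// mulrAC.
  by rewrite ler_wpM2r// kfb.
move=> e e0.
(* Each of the three terms of the remainder is at most (e / C) |h| times K times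
   one of the summands in the parenthesis. *)
pose C := K * (`|f x| + `|g x| + Kf * Kg) + 1.
have C0 : 0 < C by rewrite ltr_wpDl//; nneg.
have eC0 : 0 < e / C by rewrite divr_gt0.
have [d3 d30 E1] := Ef _ eC0; have [d4 d40 E2] := Eg _ eC0.
exists (Num.min (Num.min d1 d2) (Num.min (Num.min d3 d4) (e / C))).
  by rewrite !lt_min d10 d20 d30 d40 eC0.
move=> h; rewrite !lt_min.
move=> /andP[/andP[h1 h2] /andP[/andP[h3 h4] h5]].
have -> : B (f (x + h)) (g (x + h)) - B (f x) (g x) -
    (B (f x) (dg h) + B (df h) (g x)) =
   B (f x) (g (x + h) - g x - dg h) + B (f (x + h) - f x - df h) (g x) +
   B (f (x + h) - f x) (g (x + h) - g x).
  rewrite !(BDl, BDr, BNl, BNr).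
  move: (B (f (x + h)) (g (x + h))) (B (f x) (g x)) (B (f x) (dg h))
    (B (df h) (g x)) (B (f x) (g (x + h))) (B (f (x + h)) (g x)) => a b c d p q.
  by rewrite (zmod_split _ _ _ _ p q) opprD.
have P1 : `|B (f x) (g (x + h) - g x - dg h)| <= K * `|f x| * (e / C * `|h|).
  by rewrite (le_trans (BK _ _))// -mulrA ler_wpM2l ?(ltW K0)// ler_wpM2l// E2.
have P2 : `|B (f (x + h) - f x - df h) (g x)| <= K * `|g x| * (e / C * `|h|).
  rewrite (le_trans (BK _ _))// -mulrA ler_wpM2l ?(ltW K0)// mulrC.
  by rewrite ler_wpM2l// E1.
have P3 : `|B (f (x + h) - f x) (g (x + h) - g x)| <=
     K * (Kf * Kg) * (e / C * `|h|).
  rewrite (le_trans (BK _ _))// -mulrA ler_wpM2l ?(ltW K0)//.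
  rewrite (@le_trans _ _ ((Kf * `|h|) * (Kg * `|h|)))//.
    by rewrite ler_pM// ?Lf ?Lg.
  rewrite mulrACA ler_wpM2l//; first by nneg.
  by rewrite ler_wpM2r// ltW.
rewrite (le_trans (ler_normD _ _))// (le_trans (lerD (ler_normD _ _) (lexx _)))//.
rewrite (le_trans (lerD (lerD P1 P2) P3))// -!mulrDl -!mulrDr.
rewrite mulrA ler_wpM2r// mulrCA ger_pMr// ler_pdivrMr// mul1r /C.
by rewrite lerDl.
Qed.

End Diff.

(** * Maps of class C^k *)

Section CkTheory.
Context {R : realType}.
Implicit Types V W X : normedModType R.

Lemma diff_ext V W (A : set V) (f g : V -> W) x :
  open A -> A x -> (forall y, A y -> f y = g y) -> differentiable f x ->
  'd g x = 'd f x :> (V -> W).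
Proof.
move=> oA Ax fg /differentiableP df.
by rewrite (is_diff_val (is_diff_ext oA Ax fg df)).
Qed.

Lemma Ck_ext k V W (A : set V) (f g : V -> W) :
  open A -> (forall x, A x -> f x = g x) -> Ck k A f -> Ck k A g.
Proof.
elim: k W f g => [|k IH] W f g oA fg.
  move=> Cf x Ax; have := Cf x Ax.
  rewrite /prop_for /continuous_at fg//; apply: cvg_trans.
  apply: near_eq_cvg; have := open_nbhs_nbhs (conj oA Ax).
  by apply: filterS => y /fg.
move=> [df Cf]; split.
  move=> x Ax; have /differentiableP D := df x Ax.
  exact: is_diff_ex (is_diff_ext oA Ax fg D).
move=> v; apply: IH (Cf v) => // x Ax.
by rewrite (diff_ext oA Ax fg)//; exact: df.
Qed.

Lemma CkS k V W (A : set V) (f : V -> W) : Ck k.+1 A f -> Ck k A f.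
Proof.
elim: k W f => [|k IH] W f [df Cf].
  by move=> x Ax; apply: differentiable_continuous; exact: df.
by split => // v; apply: IH; exact: Cf.
Qed.

(** How regularity is raised throughout: the differential is exhibited by a formula,
    and the formula is shown to be of class C^k. *)
Lemma CkS_is_diff k V W (A : set V) (f : V -> W) (df : V -> V -> W) :
  open A -> (forall x, A x -> is_diff x f (df x)) ->
  (forall v, Ck k A (fun x => df x v)) -> Ck k.+1 A f.
Proof.
move=> oA fd Cd; split; first by move=> x /fd /is_diff_ex.
by move=> v; apply: Ck_ext (Cd v) => // x /fd /is_diff_val ->.
Qed.

Lemma smooth_on_is_diff V W (A : set V) (f : V -> W) x :
  smooth_on A f -> A x -> is_diff x f ('d f x).
Proof. by move=> /(_ 1%N)[+ _] Ax => /(_ x Ax) /differentiableP. Qed.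

Lemma is_diff_cstf V W (w : W) (x : V) : is_diff x (fun=> w) (fun=> 0).
Proof. exact: is_diff_cst. Qed.

Lemma Ck_cst k V W (A : set V) (w : W) : open A -> Ck k A (fun=> w).
Proof.
move=> oA; elim: k W w => [|k IH] W w; first by move=> x _; exact: cvg_cst.
by apply: (CkS_is_diff (df := fun=> fun=> 0)) => // x _; exact: is_diff_cst.
Qed.

Lemma is_diffDf V W (f g df dg : V -> W) x : is_diff x f df -> is_diff x g dg ->
  is_diff x (fun y => f y + g y) (fun v => df v + dg v).
Proof. by move=> Df Dg; exact: is_diffD. Qed.

Lemma Ck_add k V W (A : set V) (f g : V -> W) : open A ->
  Ck k A f -> Ck k A g -> Ck k A (fun x => f x + g x).
Proof.
move=> oA; elim: k W f g => [|k IH] W f g.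
  by move=> Cf Cg x Ax; apply: continuousD; [exact: Cf|exact: Cg].
move=> [df Cf] [dg Cg].
apply: (CkS_is_diff (df := fun x v => 'd f x v + 'd g x v)) => //.
  by move=> x Ax; apply: is_diffDf; apply: differentiableP; auto.
by move=> v; apply: IH; [exact: Cf|exact: Cg].
Qed.

Lemma is_diff_compf V W X (f : V -> W) df (g : W -> X) dg x :
  is_diff x f df -> is_diff (f x) g dg ->
  is_diff x (fun y => g (f y)) (fun v => dg (df v)).
Proof. by move=> Df Dg; exact: is_diff_comp. Qed.

Lemma is_diff_linl V W X (f : V -> W) df (L : W -> X) x :
  bounded_linear L -> is_diff x f df ->
  is_diff x (fun y => L (f y)) (fun v => L (df v)).
Proof.
by move=> bL Df; apply: is_diff_compf => //; exact: is_diff_blin.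
Qed.

Lemma blin_cont V W (L : V -> W) : bounded_linear L -> continuous L.
Proof. 
by move=> bL x; apply: differentiable_continuous; apply: is_diff_ex (is_diff_blin x bL).
Qed.

Lemma Ck_linl k V W X (A : set V) (f : V -> W) (L : W -> X) : open A ->
  bounded_linear L -> Ck k A f -> Ck k A (fun x => L (f x)).
Proof.
move=> oA bL; elim: k f => [|k IH] f.
  move=> Cf x Ax; apply: continuous_comp; first exact: Cf.
  exact: blin_cont.
move=> [df Cf].
apply: (CkS_is_diff (df := fun x v => L ('d f x v))) => //.
  by move=> x Ax; apply: is_diff_linl => //; apply: differentiableP; auto.
by move=> v; apply: IH; exact: Cf.
Qed.

Lemma blinB V W (L : V -> W) : bounded_linear L -> forall u v, L (u - v) = L u - L v.
Proof.
by move=> [Ll _] u v; rewrite addrC -scaleN1r Ll scaleN1r addrC.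
Qed.
Lemma blinD V W (L : V -> W) : bounded_linear L -> forall u v, L (u + v) = L u + L v.
Proof. by move=> [Ll _] u v; have := Ll 1 u v; rewrite !scale1r. Qed.
Lemma blin0 V W (L : V -> W) : bounded_linear L -> L 0 = 0.
Proof. by move=> bL; rewrite -(subrr 0) blinB// subrr. Qed.
Lemma blinZ V W (L : V -> W) : bounded_linear L -> forall a v, L (a *: v) = a *: L v.
Proof. by move=> bL a v; have [Ll _] := bL; have := Ll a v 0; rewrite (blin0 bL)
  !addr0. Qed.
Lemma blin_sum V W (L : V -> W) : bounded_linear L ->
  forall I (r : seq I) F, L (\sum_(i <- r) F i) = \sum_(i <- r) L (F i).
Proof.
by move=> bL I r F; apply: (big_morph L); [exact: blinD|exact: blin0].
Qed.

Lemma blin_id V : bounded_linear (@id V).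
Proof. by split=> //; exists 1 => // v; rewrite mul1r. Qed.

Lemma blin_comp V W X (f : V -> W) (g : W -> X) :
  bounded_linear f -> bounded_linear g -> bounded_linear (g \o f).
Proof.
move=> [fl [K K0 fK]] [gl [K' K'0 gK]]; split.
  by move=> a u v /=; rewrite fl gl.
exists (K' * K); first exact: mulr_gt0.
by move=> v /=; rewrite (le_trans (gK _))// -mulrA ler_wpM2l// ltW.
Qed.

(** The inner map has a constant differential L, so that the derivative in the
    direction v is of the same form, with the derivative of f in the direction L v. *)
Lemma Ck_affr k V W X (A : set V) (B : set W) (L : V -> W) (w : W) (f : W -> X) :
  open A -> bounded_linear L -> (forall x, A x -> B (w + L x)) ->
  Ck k B f -> Ck k A (fun x => f (w + L x)).
Proof.
move=> oA bL AB; have Da x : is_diff x (fun x => w + L x) L.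
  apply: is_diff_eq (is_diffDf (is_diff_cstf w x) (is_diff_blin x bL)) _.
  by apply/funext => v; rewrite add0r.
elim: k X f => [|k IH] X f.
  move=> Cf x Ax.
  apply: (continuous_comp (g := f)); last by apply: Cf; exact: AB.
  by apply: differentiable_continuous; apply: is_diff_ex (Da x).
move=> [df Cf].
apply: (CkS_is_diff (df := fun x v => 'd f (w + L x) (L v))) => //.
  by move=> x Ax; apply: is_diff_compf => //; apply: differentiableP; auto.
by move=> v; apply: (IH _ (fun y => 'd f y (L v))); exact: Cf.
Qed.

Lemma Ck_linr k V W X (A : set V) (B : set W) (L : V -> W) (f : W -> X) :
  open A -> bounded_linear L -> (forall x, A x -> B (L x)) ->
  Ck k B f -> Ck k A (fun x => f (L x)).
Proof.
move=> oA bL AB Cf.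
have : Ck k A (fun x => f (0 + L x)).
  by apply: (Ck_affr (B := B)) => // x /AB; rewrite add0r.
by apply: Ck_ext => // x _; rewrite add0r.
Qed.

Lemma is_diff_id V (x : V) : is_diff x id id.
Proof. exact: is_diff_id. Qed.

(** Products, scalings and Frobenius products are all instances. The derivative
    given by [is_diff_bilin] is a sum of two terms of the same shape, which closes
    the induction. *)
Lemma Ck_bilin k V V1 V2 W (A : set V) (B : V1 -> V2 -> W) (f : V -> V1)
    (g : V -> V2) : open A -> bounded_bilinear B ->
  Ck k A f -> Ck k A g -> Ck k A (fun x => B (f x) (g x)).
Proof.
move=> oA bB; elim: k f g => [|k IH] f g.
  move=> Cf Cg x Ax.
  have [Bl Br [K K0 BK]] := bB.
  have bl b : bounded_linear (B ^~ b).
    split=> //; exists (K * `|b| + 1).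
      by rewrite ltr_wpDl//; nneg.
    move=> v; rewrite (le_trans (BK _ _))// mulrDl mul1r ler_wpDr//.
    by rewrite -mulrA (mulrC `|b|).
  have br a : bounded_linear (B a).
    split=> //; exists (K * `|a| + 1).
      by rewrite ltr_wpDl//; nneg.
    by move=> v; rewrite (le_trans (BK _ _))// mulrDl mul1r ler_wpDr// mulrA.
  have fx := Cf x Ax; have gx := Cg x Ax.
  (* B (f y - f x) (g y - g x) tends to 0, and the other terms are linear in f y or
     in g y. *)
  have -> : (fun x => B (f x) (g x)) =
    (fun y => B (f y - f x) (g y - g x) + (B (f x) (g y) + (B (f y) (g x) - B (f x)
      (g x)))).
    apply/funext => y; rewrite (blinB (bl _)) !(blinB (br _)).
    by rewrite [X in _ + X]addrCA [X in _ + X]addrC addrA subrK subrK.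
  have Z : (fun y => B (f y - f x) (g y - g x)) @ x --> (0 : W).
    apply/cvgr0Pnorm_lt => e e0.
    have e1 : 0 < Num.min 1 (e / (K + 1)).
      by rewrite lt_min ltr01 divr_gt0// addr_gt0.
    have /cvgrPdist_lt/(_ _ e1) Nf := fx.
    have /cvgrPdist_lt/(_ _ e1) Ng := gx.
    near=> y.
    have h1 : `|f y - f x| < Num.min 1 (e / (K + 1)).
      by rewrite distrC; near: y.
    have h2 : `|g y - g x| < Num.min 1 (e / (K + 1)).
      by rewrite distrC; near: y.
    rewrite (le_lt_trans (BK _ _))//.
    move: h1 h2; rewrite !lt_min => /andP[h1 _] /andP[_ h2].
    rewrite (@le_lt_trans _ _ (K * (e / (K + 1))))//.
      rewrite ler_wpM2l//; first exact: ltW.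
      by rewrite -[leRHS]mul1r ler_pM// ltW.
    by rewrite mulrCA gtr_pMr// ltr_pdivrMr ?addr_gt0// mul1r ltrDl.
  have E : B (f x) (g x) = 0 + (B (f x) (g x) + (B (f x) (g x) - B (f x) (g x))).
    by rewrite subrr addr0 add0r.
  rewrite /prop_for /continuous_at !subrr (blin0 (bl _)) add0r addr0.
  rewrite [X in _ --> X]E; apply: cvgD; first exact: Z.
  apply: cvgD.
    by apply: (continuous_comp (g := B (f x))) => //; exact: blin_cont.
  apply: cvgB; last exact: cvg_cst.
  by apply: (continuous_comp (g := B ^~ (g x))) => //; exact: (blin_cont (bl _)).
move=> Cf' Cg'; have Cf := CkS Cf'; have Cg := CkS Cg'.
move: Cf' Cg' => [df Df] [dg Dg].
apply: (CkS_is_diff (df := fun x v => B (f x) ('d g x v) + B ('d f x v) (g x))) => //.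
  by move=> x Ax; apply: is_diff_bilin => //; apply: differentiableP; auto.
by move=> v; apply: Ck_add => //; [exact: IH Cf (Dg v)|exact: IH (Df v) Cg].
Unshelve. all: by end_near. Qed.

End CkTheory.

(** * Composition and inversion in finite dimension *)

Section Frames.
Context {R : realType}.
Implicit Types V W X : normedModType R.

(** Boundedness of the coordinates is what makes it possible to pass from the maps
    x |-> 'd f x v with v fixed, of which [Ck] speaks, to x |-> 'd f x (X x). *)
Record normed_basis V N := NormedBasis {
  nb_vec : 'I_N -> V;
  nb_coord : 'I_N -> V -> R^o;
  nb_blin : forall i, bounded_linear (nb_coord i);
  nb_sum : forall v, v = \sum_i nb_coord i v *: nb_vec i;
  nb_dual : forall i j, nb_coord i (nb_vec j) = (i == j)%:R }.

Lemma nb_linear_blin V N (b : normed_basis V N) W (L : V -> W) :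
  linear L -> bounded_linear L.
Proof.
move=> Ll; pose LM := GRing.isLinear.Build _ _ _ _ _ Ll.
pose L' : {linear V -> W} := HB.pack L LM.
split=> //.
have H i : exists K : R, 0 < K /\ forall v, `|nb_coord b i v| <= K * `|v|.
  by have [_ [K K0 HK]] := nb_blin b i; exists K.
have [K HK'] := choice H.
have K0 i : 0 < K i by case: (HK' i).
have HK i : forall v, `|nb_coord b i v| <= K i * `|v| by case: (HK' i).
exists (\sum_i K i * `|L (nb_vec b i)| + 1).
  by rewrite ltr_wpDl// sumr_ge0// => i _; nneg.
move=> v.
have -> : L v = \sum_i nb_coord b i v *: L (nb_vec b i).
  rewrite -[LHS]/(L' v) {1}(nb_sum b v) linear_sum.
  by apply: eq_bigr => i _; rewrite linearZ.
rewrite (le_trans (ler_norm_sum _ _ _))//.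
rewrite mulrDl mul1r ler_wpDr// mulr_suml ler_sum// => i _.
by rewrite normrZ mulrAC ler_wpM2r.
Qed.

Lemma blin_scaler V W (w : W) (L : V -> R^o) :
  bounded_linear L -> bounded_linear (fun v => L v *: w).
Proof.
move=> [Ll [K K0 LK]]; split; first by move=> a u v; rewrite Ll scalerDl scalerA.
exists (K * `|w| + 1); first by rewrite ltr_wpDl//; nneg.
by move=> v; rewrite normrZ mulrDl mul1r ler_wpDr// mulrAC ler_wpM2r.
Qed.

Lemma blin_scale V (a : R) : bounded_linear (fun X : V => a *: X).
Proof.
split=> [b X Y|]; first by rewrite scalerDr !scalerA mulrC.
exists (`|a| + 1); first by rewrite ltr_wpDl.
by move=> X; rewrite normrZ ler_wpM2r// lerDl.
Qed.

Lemma bbilin_scale V : bounded_bilinear (fun (a : R^o) (v : V) => a *: v).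
Proof.
split=> [v a u w|a b u v|]; first by rewrite scalerDl scalerA.
  by rewrite scalerDr !scalerA mulrC.
by exists 1 => // a v; rewrite normrZ mul1r.
Qed.

Lemma bbilin_mul : bounded_bilinear (fun (a b : R^o) => a * b : R^o).
Proof. exact: (bbilin_scale R^o). Qed.

Lemma Ck_scale k V W (A : set V) (h : V -> R^o) (f : V -> W) : open A ->
  Ck k A h -> Ck k A f -> Ck k A (fun x => h x *: f x).
Proof. by move=> oA; apply: Ck_bilin => //; exact: bbilin_scale. Qed.

Lemma Ck_mul k V (A : set V) (f g : V -> R^o) : open A ->
  Ck k A f -> Ck k A g -> Ck k A (fun x => f x * g x : R^o).
Proof. by move=> oA; apply: Ck_bilin => //; exact: bbilin_mul. Qed.

Lemma Ck_sum k V W (A : set V) I (r : seq I) (P : pred I) (f : I -> V -> W) :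
  open A -> (forall i, P i -> Ck k A (f i)) ->
  Ck k A (fun x => \sum_(i <- r | P i) f i x).
Proof.
move=> oA Cf; elim: r => [|i r IH].
  by apply: Ck_ext (Ck_cst k 0 oA) => // x _; rewrite big_nil.
apply: (@Ck_ext _ _ _ _ _
   (fun x => (if P i then f i x else 0) + \sum_(i <- r | P i) f i x)) => //.
  by move=> x _; rewrite big_cons; case: ifP => //; rewrite add0r.
apply: Ck_add => //; case: (boolP (P i)) => [/Cf //|_].
exact: Ck_cst.
Qed.

Lemma Ck_prod k V (A : set V) I (r : seq I) (f : I -> V -> R^o) :
  open A -> (forall i, Ck k A (f i)) ->
  Ck k A (fun x => \prod_(i <- r) f i x : R^o).
Proof.
move=> oA Cf; elim: r => [|i r IH].
  by apply: Ck_ext (Ck_cst k (1 : R^o) oA) => // x _; rewrite big_nil.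
apply: (@Ck_ext _ _ _ _ _ (fun x => f i x * \prod_(i <- r) f i x)) => //.
  by move=> x _; rewrite big_cons.
by apply: Ck_mul.
Qed.

Lemma Ck_opp k V W (A : set V) (f : V -> W) : open A ->
  Ck k A f -> Ck k A (fun x => - f x).
Proof.
move=> oA; apply: Ck_linl => //; split=> [a u v|]; first by rewrite opprD scalerN.
by exists 1 => // v; rewrite normrN mul1r.
Qed.

Lemma Ck_inv k V (A : set V) (f : V -> R^o) : open A ->
  (forall x, A x -> f x != 0) -> Ck k A f -> Ck k A (fun x => (f x)^-1 : R^o).
Proof.
move=> oA f0; elim: k f f0 => [|k IH] f f0.
  by move=> Cf x Ax; apply: cvgV; [exact: f0|exact: Cf].
move=> Cf'; have Cf := CkS Cf'; move: Cf' => [df Df].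
apply: (CkS_is_diff (df := fun x v => - ((f x)^-1 * (f x)^-1) *: 'd f x v)) => //.
  move=> x Ax; have dfx := df x Ax; have fx0 := f0 x Ax.
  apply: DiffDef; first exact: (differentiableV (f := f)).
  rewrite (diffV (f := f))//; apply/funext => v.
  by rewrite expr2 invfM.
move=> v; apply: (Ck_scale (h := fun x => - ((f x)^-1 * (f x)^-1 : R^o))) => //.
  apply: Ck_opp => //.
  by apply: Ck_mul => //; exact: IH.
exact: Df.
Qed.

(** The chain rule applies 'd g (f x) to the vector 'd f x v, which moves with x.
    The basis of the intermediate space writes this as a combination of the
    'd g (f x) e_i, to which the induction hypothesis applies. *)
Lemma Ck_comp k V W X N (b : normed_basis W N) (A : set V) (B : set W)
    (f : V -> W) (g : W -> X) : open A -> open B -> (forall x, A x -> B (f x)) ->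
  Ck k A f -> Ck k B g -> Ck k A (fun x => g (f x)).
Proof.
move=> oA oB AB; elim: k X g => [|k IH] X g Cf'.
  by move=> Cg x Ax; apply: continuous_comp; [exact: Cf'|apply: Cg; exact: AB].
have Cf := CkS Cf'; move: Cf' => [df Df] [dg Dg].
apply: (CkS_is_diff (df := fun x v =>
   \sum_i nb_coord b i ('d f x v) *: 'd g (f x) (nb_vec b i))) => //.
  move=> x Ax; have dfx := df x Ax; have dgx := dg _ (AB _ Ax).
  apply: is_diff_eq (is_diff_compf (differentiableP dfx) (differentiableP dgx)) _.
  apply/funext => v; rewrite {1}(nb_sum b ('d f x v)) linear_sum.
  by apply: eq_bigr => i _; rewrite linearZ.
move=> v; apply: Ck_sum => // i _; apply: Ck_scale => //.
  by apply: Ck_linl; [exact: oA|exact: nb_blin|exact: Df].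
by apply: (IH _ (fun y => 'd g y (nb_vec b i))) => //; exact: Dg.
Qed.

Lemma Ck_det k V n (A : set V) (M : V -> 'M[R]_n) : open A ->
  (forall i j, Ck k A (fun x => M x i j : R^o)) ->
  Ck k A (fun x => \det (M x) : R^o).
Proof.
move=> oA CM; apply: Ck_sum => // s _.
apply: Ck_mul => //; first exact: Ck_cst.
by apply: Ck_prod.
Qed.

Lemma Ck_adj k V n (A : set V) (M : V -> 'M[R]_n) : open A ->
  (forall i j, Ck k A (fun x => M x i j : R^o)) ->
  forall i j, Ck k A (fun x => \adj (M x) i j : R^o).
Proof.
move=> oA CM i j.
apply: (@Ck_ext _ _ _ _ _ (fun x => cofactor (M x) j i : R^o)) => //.
  by move=> x _; rewrite mxE.
apply: Ck_mul => //; first exact: Ck_cst.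
apply: Ck_det => // p q.
by apply: Ck_ext (CM (lift j p) (lift i q)) => // x _; rewrite !mxE.
Qed.

(** If g is of class C^k, so are the entries of the matrix of 'd f (g y); the matrix
    of 'd g y is its inverse, hence of class C^k by Cramer's rule, and g is of class
    C^(k+1). *)
Lemma smooth_inverse V W N (b : normed_basis V N) (c : normed_basis W N)
    (A : set V) (B : set W) (f : V -> W) (g : W -> V) :
  open A -> open B -> smooth_on A f -> (forall y, B y -> A (g y)) ->
  (forall y, B y -> f (g y) = y) -> (forall y, B y -> differentiable g y) ->
  smooth_on B g.
Proof.
move=> oA oB sf BA fg dg; rewrite /smooth_on; elim=> [|k IH].
  by move=> y By; apply: differentiable_continuous; exact: dg.
pose a (y : W) : 'M[R]_N := \matrix_(i, j) nb_coord c j ('d f (g y) (nb_vec b i)).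
pose g' (y : W) : 'M[R]_N := \matrix_(i, j) nb_coord b j ('d g y (nb_vec c i)).
have Ca i j : Ck k B (fun y => a y i j : R^o).
  apply: (@Ck_ext _ _ _ _ _ (fun y => nb_coord c j ('d f (g y) (nb_vec b i)))) => //.
    by move=> y _; rewrite mxE.
  apply: Ck_linl => //; first exact: nb_blin.
  apply: (Ck_comp b (g := fun x => 'd f x (nb_vec b i)) oB oA BA IH).
  by have [_] := sf k.+1; apply.
(* The chain rule for f (g y) = y. *)
have ga y : B y -> g' y *m a y = 1%:M.
  move=> By; apply/matrixP => i j; rewrite !mxE.
  have D := is_diff_compf (differentiableP (dg y By)) (smooth_on_is_diff sf (BA _ By)).
  have D1 := is_diff_ext oB By fg D.
  have E : 'd f (g y) ('d g y (nb_vec c i)) = nb_vec c i.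
    by have /(congr1 (fun L => L (nb_vec c i))) := 
      etrans (esym (is_diff_val D1)) (is_diff_val (is_diff_id y)).
  rewrite eq_sym -[in RHS](nb_dual c).
  rewrite -[in RHS]E {1}(nb_sum b ('d g y (nb_vec c i))).
  have bl := blin_comp (diff_bounded (is_diff_ex (smooth_on_is_diff sf (BA _ By))))
    (nb_blin c j).
  rewrite -[RHS]/((nb_coord c j \o 'd f (g y)) _) (blin_sum bl).
  by apply: eq_bigr => l _; rewrite (blinZ bl) !mxE.
have det0 y : B y -> \det (a y) != 0.
  by move=> /ga ga1; have /(congr1 determinant) := ga1; rewrite det_mulmx det1 => /eqP;
   apply: contraL => /eqP ->; rewrite mulr0 eq_sym oner_eq0.
have g'E y : B y -> g' y = (\det (a y))^-1 *: \adj (a y).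
  move=> By; have /(congr1 (fun M => M *m \adj (a y))) := ga _ By.
  rewrite -mulmxA mul_mx_adj mul1mx => <-.
  by rewrite mul_mx_scalar scalerA mulVf ?scale1r// det0.
apply: (CkS_is_diff (df := fun y w => \sum_i nb_coord c i w *:
    \sum_j ((\det (a y))^-1 * \adj (a y) i j) *: nb_vec b j)) => //.
  move=> y By; apply: is_diff_eq (differentiableP (dg _ By)) _.
  apply/funext => w; rewrite {1}(nb_sum c w) linear_sum.
  apply: eq_bigr => i _; rewrite linearZ; congr (_ *: _).
  rewrite {1}(nb_sum b ('d g y (nb_vec c i))); apply: eq_bigr => j _.
  by have /matrixP/(_ i j) := g'E _ By; rewrite [LHS]mxE [RHS]mxE => ->.
move=> w; apply: Ck_sum => // i _; apply: Ck_scale => //; first exact: Ck_cst.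
apply: Ck_sum => // j _; apply: Ck_scale => //; last exact: Ck_cst.
apply: Ck_mul => //; last exact: Ck_adj.
by apply: Ck_inv => //; exact: Ck_det.
Qed.

End Frames.

(** * The real spectral theorem *)

Section Spectral.
Context {R : realType}.

Lemma mulmx_tr_ge0 n (v : 'rV[R]_n) : 0 <= (v *m v^T) 0 0.
Proof. by rewrite mxE; apply: sumr_ge0 => i _; rewrite mxE -expr2 sqr_ge0. Qed.

Lemma mulmx_tr_eq0 n (v : 'rV[R]_n) : (v *m v^T) 0 0 = 0 -> v = 0.
Proof.
rewrite mxE => /psumr_eq0P v0; apply/rowP => i; rewrite mxE.
have : v 0 i * v^T i 0 = 0.
  by apply: v0 => // j _; rewrite mxE -expr2 sqr_ge0.
by rewrite mxE => /eqP; rewrite mulf_eq0 orbb => /eqP.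
Qed.

Lemma mulmx_tr_gt0 n (v : 'rV[R]_n) : v != 0 -> 0 < (v *m v^T) 0 0.
Proof.
move=> v0; rewrite lt_def mulmx_tr_ge0 andbT.
by apply: contra_neq v0; exact: mulmx_tr_eq0.
Qed.

(** A complex eigenvector x + iy for a + ib satisfies x A = a x - b y and
    y A = b x + a y. Symmetry of A gives b (|x|^2 + |y|^2) = 0, so b = 0, and one of
    x and y is a real eigenvector. *)
Lemma symm_eigenvector n (A : 'M[R]_n.+1) : A^T = A ->
  exists (a : R) (v : 'rV[R]_n.+1), v != 0 /\ v *m A = a *: v.
Proof.
move=> sA; pose C := (complex R : closedFieldType).
pose AC : 'M[C]_n.+1 := map_mx (real_complex R) A.
have [z] : exists z, root (char_poly AC) z.
  by apply/closed_rootP; rewrite size_char_poly.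
rewrite -eigenvalue_root_char => /eigenvalueP[v vA v0].
pose x : 'rV[R]_n.+1 := map_mx (@complex.Re R) v.
pose y : 'rV[R]_n.+1 := map_mx (@complex.Im R) v.
pose a := complex.Re z; pose b := complex.Im z.
have xA : x *m A = a *: x - b *: y.
  apply/rowP => j; have /rowP/(_ j) := vA; rewrite !mxE.
  move=> /(congr1 (@complex.Re R)); rewrite raddf_sum /=.
  rewrite (_ : complex.Re (z * v 0 j) = a * complex.Re (v 0 j) - b * complex.Im (v
    0 j));
    last by rewrite /a /b; case: (z) (v 0 j) => [? ?] [? ?].
  move=> <-; apply: eq_bigr => i _; rewrite !mxE.
  by case: (v 0 i) => p q /=; rewrite mulr0 subr0.
have yA : y *m A = b *: x + a *: y.
  apply/rowP => j; have /rowP/(_ j) := vA; rewrite !mxE.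
  move=> /(congr1 (@complex.Im R)); rewrite raddf_sum /=.
  rewrite (_ : complex.Im (z * v 0 j) = b * complex.Re (v 0 j) + a * complex.Im (v
    0 j));
    last by rewrite /a /b; case: (z) (v 0 j) => [? ?] [? ?] /=; rewrite addrC.
  move=> <-; apply: eq_bigr => i _; rewrite !mxE.
  by case: (v 0 i) => p q /=; rewrite mulr0 add0r.
have b0 : b = 0.
  have E : (x *m A *m y^T) 0 0 = (y *m A *m x^T) 0 0.
    rewrite -[LHS]/((x *m A *m y^T) 0 0) -[in LHS](trmxK (x *m A *m y^T)) mxE.
    by rewrite !trmx_mul trmxK sA mulmxA.
  move: E; rewrite xA yA mulmxBl mulmxDl -!scalemxAl !mxE.
  have -> : \sum_j y 0 j * x^T j 0 = \sum_j x 0 j * y^T j 0.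
    by apply: eq_bigr => j _; rewrite !mxE mulrC.
  move=> E; have E2 : b * ((x *m x^T) 0 0 + (y *m y^T) 0 0) = 0.
    by rewrite !mxE; lra.
  move/eqP: E2; rewrite mulf_eq0 => /orP[/eqP //|].
  rewrite paddr_eq0 ?mulmx_tr_ge0// => /andP[/eqP/mulmx_tr_eq0 x0 /eqP/mulmx_tr_eq0 y0].
  case/negP: v0; apply/eqP/rowP => j; apply/eqP; rewrite mxE eq_complex /=.
  have /rowP/(_ j) := x0; have /rowP/(_ j) := y0; rewrite !mxE => -> ->.
  by rewrite eqxx.
have [x0|x0] := eqVneq x 0; last first.
  by exists a, x; split => //; rewrite xA b0 scale0r subr0.
exists a, y; split; last by rewrite yA b0 scale0r add0r.
apply: contra_neq v0 => y0; apply/rowP => j; apply/eqP; rewrite mxE eq_complex /=.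
have /rowP/(_ j) := x0; have /rowP/(_ j) := y0; rewrite !mxE => -> ->.
by rewrite eqxx.
Qed.

(** The Householder reflection along v - e. *)
Lemma reflection n (e v : 'rV[R]_n) : e *m e^T = 1%:M -> v *m v^T = 1%:M ->
  exists H : 'M[R]_n, [/\ H^T = H, H *m H = 1%:M & e *m H = v].
Proof.
move=> e1 v1; have [->|ev] := eqVneq e v.
  by exists 1%:M; rewrite trmx1 !mulmx1.
pose w := v - e; have w0 : w != 0 by rewrite subr_eq0 eq_sym.
pose q := (w *m w^T) 0 0.
have q0 : q != 0 by rewrite gt_eqF// mulmx_tr_gt0.
pose c := 2 / q.
(* As e and v are unit vectors, w w^T = 2 - 2 e v^T, hence e w^T = - q / 2. *)
have wq : w *m w^T = q%:M by exact: mx11_scalar.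
have ew : e *m w^T = (- (q / 2))%:M.
  have E : e *m v^T = v *m e^T.
    by rewrite [LHS]mx11_scalar -tr_scalar_mx -mx11_scalar trmx_mul trmxK.
  have : w *m w^T = - (e *m w^T) - (e *m w^T).
    rewrite /w linearB /= !mulmxBl !mulmxBr v1 e1 E.
    by rewrite !opprB.
  rewrite wq (mx11_scalar (e *m w^T)) => /matrixP/(_ 0 0).
  rewrite !mxE eqxx !mulr1n => qE; congr (_%:M); lra.
have wE : w = v - e by [].
clearbody q => {w0}; clearbody w.
exists (1%:M - c *: (w^T *m w)); split.
- by rewrite linearB /= linearZ /= trmx_mul trmxK trmx1.
- rewrite mulmxBl mul1mx mulmxBr mulmx1 -scalemxAl -scalemxAr scalerA.
  rewrite -mulmxA (mulmxA w) wq mul_scalar_mx -scalemxAr scalerA.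
  have -> : c * c * q = c + c by rewrite /c; field.
  by rewrite scalerDl opprB addrK subrK.
rewrite mulmxBr mulmx1 -scalemxAr mulmxA ew mul_scalar_mx scalerA.
have -> : c * - (q / 2) = -1 by rewrite /c; field.
by rewrite scaleN1r opprK wE addrC subrK.
Qed.

(** A reflection takes a unit eigenvector to the first basis vector; what remains is
    a symmetric matrix of smaller size. *)
Lemma symm_diagonalization n (A : 'M[R]_n) : A^T = A ->
  exists (P : 'M[R]_n) (d : 'rV[R]_n), orthogonal_mx P /\ A = P *m diag_mx d *m P^T.
Proof.
elim: n A => [|n IH] A sA.
  exists 1%:M, 0; split; first by rewrite /orthogonal_mx trmx1 mulmx1.
  by apply/matrixP => [[]].
have [a [v [v0 vA]]] := symm_eigenvector sA.
pose s := Num.sqrt ((v *m v^T) 0 0).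
have s2 : s ^+ 2 = (v *m v^T) 0 0 by rewrite sqr_sqrtr// mulmx_tr_ge0.
have s0 : s != 0 by rewrite gt_eqF// sqrtr_gt0 mulmx_tr_gt0.
pose u := s^-1 *: v.
have uu : u *m u^T = 1%:M.
  rewrite /u linearZ /= -scalemxAl -scalemxAr scalerA [v *m v^T]mx11_scalar -s2.
  by rewrite -scalemx1 scalerA -invfM -expr2 mulVf ?scale1r// expf_neq0.
have uA : u *m A = a *: u by rewrite -scalemxAl vA !scalerA mulrC.
pose e : 'rV[R]_(1 + n) := row_mx 1%:M 0.
have ee : e *m e^T = 1%:M.
  by rewrite /e tr_row_mx mul_row_col trmx1 mulmx1 trmx0 mulmx0 addr0.
have [H [sH HH eH]] := reflection ee uu.
pose B : 'M[R]_(1 + n) := H *m A *m H.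
have sB : B^T = B by rewrite /B !trmx_mul sH sA mulmxA.
have eB : e *m B = a *: e.
  by rewrite /B !mulmxA eH uA -scalemxAl -eH -mulmxA HH mulmx1.
pose B' := drsubmx B.
have BE : B = block_mx a%:M 0 0 B'.
  have BB := submxK B; rewrite -[LHS]submxK.
  have : row_mx (ulsubmx B) (ursubmx B) = a *: e.
    by rewrite -eB -[in RHS]BB /e mul_row_block !mul1mx !mul0mx !addr0.
  rewrite /e scale_row_mx scaler0 scalemx1 => /eq_row_mx[-> ur0].
  rewrite ur0; congr block_mx.
  by rewrite -[dlsubmx B]trmxK trmx_dlsub sB ur0 trmx0.
have sB' : B'^T = B' by rewrite /B' trmx_drsub sB.
have [P' [d' [oP' B'E]]] := IH _ sB'.
pose Q : 'M[R]_(1 + n) := block_mx 1%:M 0 0 P'.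
have oQ : Q^T *m Q = 1%:M.
  rewrite /Q tr_block_mx mulmx_block !trmx0 !mul0mx !mulmx0 trmx1 mulmx1 !addr0 add0r.
  by rewrite oP' -scalar_mx_block.
have QE : block_mx a%:M 0 0 (P' *m diag_mx d' *m P'^T) =
    Q *m diag_mx (row_mx a%:M d' : 'rV_(1 + n)) *m Q^T.
  rewrite diag_mx_row /Q tr_block_mx !mulmx_block !trmx0 trmx1.
  rewrite !(mul0mx, mulmx0, mul1mx, mulmx1, addr0, add0r).
  by congr block_mx; apply/matrixP => i j; rewrite !ord1 !mxE eqxx !mulr1n.
exists (H *m Q), (row_mx a%:M d'); split.
  by rewrite /orthogonal_mx trmx_mul sH -mulmxA (mulmxA H) HH mul1mx.
have -> : A = H *m B *m H.
  by rewrite /B !mulmxA HH mul1mx -mulmxA HH mulmx1.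
by rewrite trmx_mul sH BE B'E [in LHS]QE !mulmxA.
Qed.

End Spectral.

(** * Symmetric matrices as a Euclidean space *)

Section SymBasis.
Context {R : realType} {n : nat}.
Local Notation S := (Sym R n).
Local Notation N := (n * n.+1)./2.

Lemma symE (X : S) i j : X i j = X j i.
Proof. by have /matrixP/(_ j i) := symP X; rewrite mxE. Qed.

Lemma frobdotZr a (X Y : S) : frobdot X (a *: Y) = a * frobdot X Y.
Proof. by rewrite frobdotC frobdotZl frobdotC. Qed.

Lemma frobdotDr (X Y Z : S) : frobdot X (Y + Z) = frobdot X Y + frobdot X Z.
Proof. by rewrite frobdotC frobdotDl !(frobdotC X). Qed.

Lemma frobnorm2 (X : S) : `|X| ^+ 2 = frobdot X X.
Proof. by rewrite Sym_normE sqr_sqrtr// frobdot_ge0. Qed.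

Lemma frobdot_le (X Y : S) : `|frobdot X Y| <= `|X| * `|Y|.
Proof.
rewrite -(ler_pXn2r (ltn0Sn 1)) ?nnegrE ?mulr_ge0//.
by rewrite exprMn !frobnorm2 real_normK ?num_real// frobdot_CS.
Qed.

Lemma frobdot_bbilin : bounded_bilinear (fun X Y : S => frobdot X Y : R^o).
Proof.
split=> [Y a X X'|X a Y Y'|].
- by rewrite frobdotDl frobdotZl.
- by rewrite frobdotDr frobdotZr.
- by exists 1 => // X Y; rewrite mul1r frobdot_le.
Qed.

Lemma frobdot_blin (Y : S) : bounded_linear (fun X : S => frobdot X Y : R^o).
Proof.
split=> [a X X'|]; first by rewrite frobdotDl frobdotZl.
exists (`|Y| + 1); first by rewrite ltr_wpDl.
move=> X; rewrite (le_trans (frobdot_le _ _))// mulrC ler_wpM2r//.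
by rewrite lerDl.
Qed.

Lemma card_pairs : #|[pred ij : 'I_n * 'I_n | (ij.1 <= ij.2)%N]| = N.
Proof.
rewrite -sum1_card (eq_bigl (fun p : 'I_n * 'I_n => true && (p.1 <= p.2)%N))//.
rewrite -(pair_big_dep xpredT (fun i j : 'I_n => (i <= j)%N) (fun _ _ => 1%N)) /=.
rewrite (exchange_big_dep xpredT)//=.
under eq_bigr => j _.
  rewrite sum1_card.
  have -> : #|[pred i : 'I_n | (i <= j)%N]| = j.+1.
    have wi : injective (widen_ord (ltn_ord j)) by move=> x y /(congr1 val) /= /val_inj.
    rewrite -[RHS]card_ord -[RHS](card_codom wi).
    apply: eq_card => i; rewrite !inE; apply/idP/codomP => [ij|[k ->]].
      by exists (Ordinal (ij : (i < j.+1)%N)); exact: val_inj.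
    by rewrite /= -ltnS.
  over.
rewrite -(big_mkord xpredT (fun j => j.+1)).
have := bin2_sum n.+1; rewrite big_nat_recl// add0n => ->.
by rewrite bin2 mulnC.
Qed.

Lemma pair_enum_ex : exists f : 'I_N -> 'I_n * 'I_n,
  [/\ injective f, forall k, ((f k).1 <= (f k).2)%N &
      forall i j : 'I_n, (i <= j)%N -> exists k, f k = (i, j)].
Proof.
pose A := [pred ij : 'I_n * 'I_n | (ij.1 <= ij.2)%N].
exists (fun k => enum_val (A := A) (cast_ord (esym card_pairs) k)); split.
- by move=> k l /enum_val_inj /cast_ord_inj.
- by move=> k; have := enum_valP (A := A) (cast_ord (esym card_pairs) k).
- move=> i j ij; have Aij : (i, j) \in A by rewrite inE.
  exists (cast_ord card_pairs (enum_rank_in Aij (i, j))).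
  by rewrite cast_ord_comp cast_ord_id enum_rankK_in.
Qed.

Definition pair_enum := sval (cid pair_enum_ex).

(** Off-diagonal entries are counted twice by the Frobenius product; this weight
    makes the matrices [sym_delta] orthonormal. *)
Definition sqrt_weight (ij : 'I_n * 'I_n) : R :=
  if ij.1 == ij.2 then 1 else Num.sqrt 2.

Fact sym_delta_subproof (ij : 'I_n * 'I_n) :
  (sqrt_weight ij / 2) *: (delta_mx ij.1 ij.2 + delta_mx ij.2 ij.1) \in
    @symm_pred R n.
Proof. by apply/eqP; rewrite linearZ linearD /= !trmx_delta addrC. Qed.

Definition sym_delta ij : S := MkSym (sym_delta_subproof ij).

Lemma frobdot_sym_delta (X : S) ij :
  frobdot X (sym_delta ij) = sqrt_weight ij * X ij.1 ij.2.
Proof.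
have E (p q : 'I_n) : \sum_i \sum_j X i j * (delta_mx p q : 'M[R]_n) i j = X p q.
  rewrite (bigD1 p)//= (bigD1 q)//= big1 ?addr0.
    rewrite big1 ?addr0 ?mxE ?eqxx ?mulr1// => i ip.
    by rewrite big1// => j _; rewrite mxE (negbTE ip) mulr0.
  by move=> j jq; rewrite mxE (negbTE jq) andbF mulr0.
transitivity (sqrt_weight ij / 2 *
   (\sum_i \sum_j X i j * (delta_mx ij.1 ij.2 : 'M[R]_n) i j +
    \sum_i \sum_j X i j * (delta_mx ij.2 ij.1 : 'M[R]_n) i j)).
  rewrite -big_split mulr_sumr; apply: eq_bigr => i _ /=.
  rewrite -big_split mulr_sumr; apply: eq_bigr => j _ /=.
  by rewrite !mxE; ring.
by rewrite !E (symE X ij.2); field.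
Qed.

Definition sym_coord (k : 'I_N) (X : S) : R^o := frobdot X (sym_delta (pair_enum k)).

Lemma sym_delta_dual k l : sym_coord k (sym_delta (pair_enum l)) = (k == l)%:R.
Proof.
rewrite /sym_coord frobdot_sym_delta /pair_enum; case: cid => f /= [finj fle _].
rewrite !mxE; have [<-|kl] := eqVneq k l.
  rewrite !eqxx /= /sqrt_weight; have [_|_] /= := eqVneq (f k).1 (f k).2.
    by field.
  rewrite addr0 mulr1 mulrA -expr2 sqr_sqrtr//.
  by rewrite divff.
have fkl : (f k == f l) = false by apply/negbTE; apply: contra kl => /eqP/finj ->.
have := fkl; rewrite -pair_eqE /pair_eq => ->.
have [k2|k2] := eqVneq (f k).1 (f l).2; last by rewrite /= addr0 !mulr0.
have [k1|k1] := eqVneq (f k).2 (f l).1; last by rewrite /= addr0 !mulr0.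
have := fle k; have := fle l; rewrite k1 k2 => h1 h2.
have E : (f l).1 = (f l).2 by apply: val_inj; apply/eqP; rewrite eqn_leq h1 h2.
by move: fkl; rewrite -pair_eqE /pair_eq k1 k2 E !eqxx.
Qed.

Lemma sym_coord_blin k : bounded_linear (sym_coord k).
Proof. exact: frobdot_blin. Qed.

Lemma sym_coord_inj (X : S) : (forall k, sym_coord k X = 0) -> X = 0.
Proof.
move=> X0; apply/val_inj/matrixP => i j; rewrite raddf0 mxE /=.
wlog ij : i j / (i <= j)%N.
  by move=> H; have [/H //|/ltnW/H] := leqP i j; rewrite symE.
have : exists k, pair_enum k = (i, j).
  by rewrite /pair_enum; case: cid => f [_ _] /= /(_ _ _ ij).
move=> [k fk]; have /eqP := X0 k.
rewrite /sym_coord frobdot_sym_delta fk mulf_eq0 => /orP[|/eqP //].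
rewrite /sqrt_weight; case: ifP => _; first by rewrite oner_eq0.
by rewrite gt_eqF// sqrtr_gt0.
Qed.

Lemma sym_coord_sum (X : S) : X = \sum_k sym_coord k X *: sym_delta (pair_enum k).
Proof.
apply/subr0_eq/sym_coord_inj => k.
rewrite (blinB (sym_coord_blin k)) (blin_sum (sym_coord_blin k)).
rewrite (bigD1 k)//= big1 ?addr0.
  by rewrite (blinZ (sym_coord_blin k)) sym_delta_dual eqxx [_ *: _]mulr1 subrr.
by move=> l lk; rewrite (blinZ (sym_coord_blin k)) sym_delta_dual eq_sym (negbTE
  lk) scaler0.
Qed.

Definition sym_basis : normed_basis S N :=
  NormedBasis sym_coord_blin sym_coord_sum sym_delta_dual.

(** Orthonormal coordinates: they turn the Frobenius product into the dot product. *)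
Definition sym_row (X : S) : 'rV[R]_N := \row_k sym_coord k X.
Definition row_sym (v : 'rV[R]_N) : S := \sum_k v 0 k *: sym_delta (pair_enum k).

Lemma sym_rowK : cancel sym_row row_sym.
Proof.
by move=> X; rewrite [RHS]sym_coord_sum; apply: eq_bigr => k _; rewrite mxE.
Qed.

Lemma row_symK : cancel row_sym sym_row.
Proof.
move=> v; apply/rowP => k; rewrite mxE (blin_sum (sym_coord_blin k)).
rewrite (bigD1 k)//= big1 ?addr0.
  by rewrite (blinZ (sym_coord_blin k)) sym_delta_dual eqxx [_ *: _]mulr1.
by move=> l lk; rewrite (blinZ (sym_coord_blin k)) sym_delta_dual eq_sym (negbTE
  lk) scaler0.
Qed.

Lemma dotmx_sym_row (X Y : S) : Defs.dotmx (sym_row X) (sym_row Y) = frobdot X Y.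
Proof.
rewrite {2}(sym_coord_sum X).
have -> : frobdot (\sum_k sym_coord k X *: sym_delta (pair_enum k)) Y =
  \sum_k frobdot (sym_coord k X *: sym_delta (pair_enum k)) Y.
  exact: (blin_sum (frobdot_blin Y)).
by apply: eq_bigr => k _; rewrite !mxE frobdotZl (frobdotC _ Y).
Qed.

Lemma sym_row_linear : linear sym_row.
Proof.
move=> a X Y; apply/rowP => k; rewrite !mxE.
by have [-> _] := sym_coord_blin k.
Qed.

Lemma sym_row_blin : bounded_linear sym_row.
Proof. exact: (nb_linear_blin sym_basis sym_row_linear). Qed.

Lemma row_sym_linear : linear row_sym.
Proof.
move=> a u v; rewrite /row_sym scaler_sumr -big_split; apply: eq_bigr => k _ /=.
by rewrite !mxE scalerDl scalerA.
Qed.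

Lemma mx_coord_le m p (M : 'M[R]_(m, p)) i j : `|M i j| <= `|M|.
Proof.
by rewrite [leRHS]/Num.norm /= mx_normrE; apply: (@le_bigmax _ _ _ _ (fun ij => `|M
  ij.1 ij.2|) (i, j)).
Qed.

Lemma row_sym_blin : bounded_linear row_sym.
Proof.
split; first exact: row_sym_linear.
exists (\sum_k `|sym_delta (pair_enum k)| + 1); first by rewrite ltr_wpDl// sumr_ge0.
move=> v; rewrite (le_trans (ler_norm_sum _ _ _))// mulrDl mul1r ler_wpDr//.
rewrite mulr_suml ler_sum// => k _.
by rewrite normrZ mulrC ler_wpM2l// mx_coord_le.
Qed.

End SymBasis.

(** * Divided differences *)

Section DividedDifferences.
Context {R : realType}.

(** Stands for the minimum over a finite family of radii, for conditions that persist
    when the radius shrinks. *)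
Lemma common_radius (I : finType) (P : I -> R -> Prop) :
  (forall i r s, s <= r -> P i r -> P i s) ->
  (forall i, exists2 r, 0 < r & P i r) -> exists2 r, 0 < r & forall i, P i r.
Proof.
move=> dP exP.
suff [r r0 Pr] : exists2 r, 0 < r & forall i, i \in enum I -> P i r.
  by exists r => // i; apply: Pr; rewrite mem_enum.
elim: (enum I) => [|i s [r r0 Pr]]; first by exists 1.
have [r' r'0 Pr'] := exP i; exists (Num.min r r'); first by rewrite lt_min r0 r'0.
move=> j; rewrite in_cons => /orP[/eqP -> |/Pr].
  by apply: dP Pr'; rewrite ge_min lexx orbT.
by apply: dP; rewrite ge_min lexx.
Qed.

Lemma derivable_is_diff (f : R -> R) x : derivable f x 1 ->
  is_diff x (f : R^o -> R^o) (fun v : R^o => v * derive1 f x : R^o).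
Proof.
move=> fx; apply: DiffDef; first exact/derivable1_diffP.
exact: (deriv1E fx).
Qed.

Lemma is_diff_derive (f : R -> R) x (L : R^o -> R^o) :
  is_diff x (f : R^o -> R^o) L -> derivable f x 1 /\ derive1 f x = L 1.
Proof.
move=> D; have df := is_diff_ex D; split; first exact/derivable1_diffP.
by rewrite derive1E' // (is_diff_val D).
Qed.

Lemma div_diffC (f : R -> R) x y : div_diff f x y = div_diff f y x.
Proof.
rewrite /div_diff eq_sym; case: eqP => [-> //|_].
by rewrite -[f y - _]opprB -[y - x]opprB invrN mulrNN.
Qed.

(** When x = y the claim is the differentiability of f at y, divided by z - y. *)
Lemma div_diff_cont (f : R -> R) x y e : derivable f x 1 -> derivable f y 1 ->
  0 < e -> exists2 r, 0 < r &
    forall z, `|z - y| < r -> `|div_diff f x z - div_diff f x y| <= e.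
Proof.
move=> fx fy e0; have [->|xy] := eqVneq x y.
  have /derivable_is_diff/is_diffP[_ /(_ _ e0)[r r0 H]] := fy.
  exists r => // z zr; rewrite {2}/div_diff eqxx /div_diff.
  case: eqP => [_|/eqP yz]; first by rewrite subrr normr0 ltW.
  have zy0 : z - y != 0 by rewrite subr_eq0 eq_sym.
  have := H _ zr; rewrite subrKC -ler_pdivrMr ?normr_gt0// -normf_div.
  congr (`|_| <= e); move: (derive1 f y) => a.
  have yz0 : y - z != 0 by rewrite subr_eq0.
  by field; rewrite zy0 yz0.
have Hc : {for y, continuous (fun z : R => (f x - f z) / (x - z))}.
  have xy0 : x - y != 0 by rewrite subr_eq0.
  have fc : {for y, continuous f} by apply: differentiable_continuous;
    exact/derivable1_diffP.
  apply: cvgM; first by apply: cvgB; [exact: cvg_cst|exact: fc].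
  by apply: cvgV => //; apply: cvgB; [exact: cvg_cst|exact: cvg_id].
have /cvgrPdist_le/(_ _ e0) := Hc.
move=> /nbhs_ballP[r /= r0 H].
exists (Num.min r `|x - y|); first by rewrite lt_min r0 normr_gt0 subr_eq0.
move=> z; rewrite lt_min => /andP[zr zx].
have xz : x != z by apply: contraTneq zx => ->; rewrite -leNgt.
rewrite /div_diff (negbTE xy) (negbTE xz) distrC; apply: H.
by rewrite -ball_normE /= distrC.
Qed.

End DividedDifferences.

(** * The open convex set of positive definite matrices *)

Section SymMatrices.
Context {R : realType} {n : nat}.
Local Notation S := (Sym R n).

Lemma sym_eigen (X : S) :
  exists (P : 'M[R]_n) (d : 'rV[R]_n), orthogonal_mx P /\ symval X = P *m diag_mx d
    *m P^T.
Proof. by apply: symm_diagonalization; exact: symP. Qed.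

Lemma orth1 : orthogonal_mx (1%:M : 'M[R]_n).
Proof. by rewrite /orthogonal_mx trmx1 mulmx1. Qed.

Definition frob2 (M : 'M[R]_n) : R := \tr (M *m M^T).

Lemma frob2E (M : 'M[R]_n) : frob2 M = \sum_i \sum_j M i j ^+ 2.
Proof.
apply: eq_bigr => i _; rewrite mxE; apply: eq_bigr => j _.
by rewrite mxE expr2.
Qed.

Lemma frob2_sym (X : S) : `|X| ^+ 2 = frob2 X.
Proof.
rewrite frobnorm2 frob2E; apply: eq_bigr => i _; apply: eq_bigr => j _.
by rewrite expr2.
Qed.

Lemma frob2_orth P Q M : orthogonal_mx P -> orthogonal_mx Q ->
  frob2 (P^T *m M *m Q) = frob2 M.
Proof.
move=> oP oQ; rewrite /frob2 !trmx_mul trmxK !mulmxA.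
rewrite -(mulmxA _ Q) (orthogonal_mxV oQ) mulmx1 mxtrace_mulC !mulmxA.
by rewrite (orthogonal_mxV oP) mul1mx.
Qed.

Lemma frob2_entry (M : 'M[R]_n) i j : M i j ^+ 2 <= frob2 M.
Proof.
rewrite frob2E (bigD1 i)//= (bigD1 j)//= -addrA lerDl addr_ge0// ?sumr_ge0//.
  by move=> k _; rewrite sqr_ge0.
by move=> k _; apply: sumr_ge0 => l _; rewrite sqr_ge0.
Qed.

(** Entries are bounded by the Frobenius norm, and multiplication by orthogonal
    matrices on either side preserves that norm. *)
Lemma orth_entry P Q (X : S) i j : orthogonal_mx P -> orthogonal_mx Q ->
  `|(P^T *m X *m Q) i j| <= `|X|.
Proof.
move=> oP oQ; rewrite -(ler_pXn2r (ltn0Sn 1)) ?nnegrE//.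
by rewrite frob2_sym -(frob2_orth _ oP oQ) real_normK ?num_real// frob2_entry.
Qed.

Lemma sym_entry (X : S) i j : `|X i j| <= `|X|.
Proof.
by have := orth_entry X i j orth1 orth1; rewrite trmx1 mul1mx mulmx1.
Qed.

Lemma sym_norm_le (X : S) (P M : 'M[R]_n) : orthogonal_mx P -> symval X = P *m M *m
  P^T ->
  `|X| <= \sum_i \sum_j `|M i j|.
Proof.
move=> oP XM; have M0 : 0 <= \sum_i \sum_j `|M i j|.
  by apply: sumr_ge0 => i _; apply: sumr_ge0.
rewrite -(ler_pXn2r (ltn0Sn 1)) ?nnegrE// frob2_sym.
rewrite -(frob2_orth _ oP oP) XM !mulmxA oP mul1mx -mulmxA oP mulmx1 frob2E.
rewrite [leRHS]expr2 mulr_suml ler_sum// => i _.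
rewrite mulr_suml ler_sum// => j _.
rewrite -[_ ^+ 2]real_normK ?num_real// expr2 ler_wpM2l//.
rewrite (bigD1 i)//= (bigD1 j)//= -addrA lerDl addr_ge0// ?sumr_ge0//.
by move=> k _; apply: sumr_ge0.
Qed.

Lemma quad_diag (P : 'M[R]_n) (d : 'rV[R]_n) (x : 'cV[R]_n) :
  (x^T *m (P *m diag_mx d *m P^T) *m x) 0 0 =
  \sum_i d 0 i * (P^T *m x) i 0 ^+ 2.
Proof.
rewrite !mulmxA -(mulmxA _ P^T x); set y := P^T *m x.
have -> : x^T *m P = y^T by rewrite /y trmx_mul trmxK.
rewrite mul_mx_diag mxE; apply: eq_bigr => i _; rewrite !mxE; ring.
Qed.

Lemma quad_orth (P : 'M[R]_n) (x : 'cV[R]_n) : orthogonal_mx P ->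
  (x^T *m x) 0 0 = \sum_i (P^T *m x) i 0 ^+ 2.
Proof.
move=> oP; have := quad_diag P (const_mx 1) x.
rewrite diag_const_mx mulmx1 (orthogonal_mxV oP) mulmx1 => ->.
by apply: eq_bigr => i _; rewrite mxE mul1r.
Qed.

Lemma SPD_eig (X : S) P d : orthogonal_mx P -> symval X = P *m diag_mx d *m P^T ->
  SPD R n X <-> forall i, 0 < d 0 i.
Proof.
move=> oP XE; split=> [pX i|d0 x x0].
  have := pX (col i P); rewrite XE quad_diag.
  have -> : P^T *m col i P = col i 1%:M by rewrite -oP !colE mulmxA.
  rewrite (bigD1 i)//= big1 ?addr0; last first.
    by move=> j /negbTE ji; rewrite !mxE ji expr0n mulr0.
  rewrite !mxE eqxx expr1n mulr1; apply.
  apply/eqP => /(congr1 (mulmx P^T)); rewrite mulmx0 colE mulmxA oP mul1mx.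
  by move=> /matrixP/(_ i 0); rewrite !mxE !eqxx => /eqP; rewrite oner_eq0.
rewrite XE quad_diag lt_def sumr_ge0 ?andbT; last first.
  by move=> i _; rewrite mulr_ge0 ?sqr_ge0// ltW.
apply: contra x0 => /eqP/psumr_eq0P H.
have y0 : P^T *m x = 0.
  apply/matrixP => i j; rewrite ord1 [RHS]mxE.
  have /eqP : d 0 i * (P^T *m x) i 0 ^+ 2 = 0.
    by apply: H => // k _; rewrite mulr_ge0 ?sqr_ge0// ltW.
  by rewrite mulf_eq0 (gt_eqF (d0 i)) sqrf_eq0 => /eqP.
by rewrite -[x]mul1mx -(orthogonal_mxV oP) -mulmxA y0 mulmx0.
Qed.

(** In an eigenbasis the claim is that the norm of X bounds its eigenvalues. *)
Lemma quad_le (X : S) (x : 'cV[R]_n) :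
  `|(x^T *m X *m x) 0 0| <= `|X| * (x^T *m x) 0 0.
Proof.
have [P [d [oP XE]]] := sym_eigen X; rewrite XE quad_diag.
rewrite (quad_orth x oP).
rewrite mulr_sumr (le_trans (ler_norm_sum _ _ _))// ler_sum// => i _.
rewrite normrM (ger0_norm (sqr_ge0 _)) ler_wpM2r ?sqr_ge0//.
have := orth_entry X i i oP oP; rewrite XE !mulmxA oP mul1mx -mulmxA oP mulmx1.
by rewrite mxE eqxx mulr1n.
Qed.

(** A perturbation smaller than the least eigenvalue leaves the quadratic form
    positive. *)
Lemma open_SPD : open (SPD R n).
Proof.
rewrite openE => X pX; have [P [d [oP XE]]] := sym_eigen X.
have d0 := (SPD_eig oP XE).1 pX.
have [m m0 md] : exists2 m, 0 < m & forall i, m <= d 0 i.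
  apply: (@common_radius _ _ (fun i m => m <= d 0 i)) => [i r s sr /(le_trans sr)//|i].
  by exists (d 0 i).
apply/nbhs_ballP; exists m => //= Y; rewrite -ball_normE /= => XY.
move=> x x0; have -> : Y = X + (Y - X) by rewrite addrC subrK.
rewrite symvalD mulmxDr mulmxDl mxE.
have x2 : 0 < (x^T *m x) 0 0.
  by have := @mulmx_tr_gt0 _ _ x^T; rewrite trmxK; apply; rewrite -trmx0 (inj_eq
    trmx_inj).
have h1 : m * (x^T *m x) 0 0 <= (x^T *m X *m x) 0 0.
  rewrite XE quad_diag.
  rewrite (quad_orth x oP) mulr_sumr ler_sum// => i _.
  by rewrite ler_wpM2r ?sqr_ge0.
have := quad_le (Y - X) x; rewrite ler_norml => /andP[h2 _].
rewrite (@lt_le_trans _ _ ((m - `|Y - X|) * (x^T *m x) 0 0))//.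
  by rewrite mulr_gt0// subr_gt0 distrC.
by rewrite mulrBl lerD// -mulNr.
Qed.

Lemma SPD_segment (X Y : S) t : SPD R n X -> SPD R n Y -> 0 <= t <= 1 ->
  SPD R n (X + t *: (Y - X)).
Proof.
move=> pX pY /andP[t0 t1] x x0.
have -> : symval (X + t *: (Y - X)) = (1 - t) *: symval X + t *: symval Y.
  by rewrite -!symvalZ -symvalD scalerBr scalerBl scale1r addrA addrAC.
rewrite mulmxDr mulmxDl -!scalemxAr -!scalemxAl !mxE.
have := pX x x0; have := pY x x0; rewrite !mxE => p q.
have [->|tn0] := eqVneq t 0; first by rewrite subr0 mul0r addr0 mul1r.
rewrite ltr_wpDl// ?mulr_ge0 ?subr_ge0 ?(ltW q)// mulr_gt0//.
by rewrite lt_def tn0.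
Qed.

End SymMatrices.

(** * The differential of a univariate map *)

Section Loewner.
Context {R : realType} {n : nat}.
Local Notation S := (Sym R n).
Implicit Types (f : R -> R) (P : 'M[R]_n) (d : 'rV[R]_n) (X : S).

Definition loewner_mx f P d X : 'M[R]_n :=
  \matrix_(i, j) (div_diff f (d 0 i) (d 0 j) * (P^T *m X *m P) i j).

Fact loewner_subproof f P d X : P *m loewner_mx f P d X *m P^T \in @symm_pred R n.
Proof.
apply/eqP; rewrite !trmx_mul trmxK mulmxA; congr (_ *m _ *m _).
apply/matrixP => i j; rewrite [LHS]mxE [LHS]mxE [RHS]mxE div_diffC; congr (_ * _).
have E : P^T *m X *m P = (P^T *m X *m P)^T.
  by rewrite !trmx_mul trmxK symP mulmxA.
by rewrite [in LHS]E mxE.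
Qed.

(** The differential of [umap f] at P diag(d) P^T according to the theorem of
    Daleckii and Krein. *)
Definition loewner f P d X : S := MkSym (loewner_subproof f P d X).

Lemma loewner_linear f P d : linear (loewner f P d).
Proof.
move=> a X Y; apply: val_inj.
rewrite -[RHS]/(a *: symval (loewner f P d X) + symval (loewner f P d Y)) /=.
rewrite scalemxAl scalemxAr -mulmxDl -mulmxDr; congr (_ *m _ *m _).
rewrite /loewner_mx symvalD symvalZ mulmxDr mulmxDl -scalemxAr -scalemxAl.
move: (P^T *m X *m P) (P^T *m Y *m P) => A B.
by apply/matrixP => i j; rewrite !mxE; ring.
Qed.

(** The theorem of Daleckii and Krein. Let X + h = Q diag(g) Q^T, O = P^T Q and
    Y = P^T h Q. The increment of [umap f] is exactly the matrix whose entries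
    between the bases P and Q are f[1](d_i, g_j) Y_ij, with divided differences
    between an old and a new eigenvalue. The differential has f[1](d_i, d_k)
    instead, and one passes from one to the other because
    Y_kj = O_kj (g_j - d_k): either g_j is close to d_k, or O_kj is small. This works
    without any assumption on multiplicities, and f is only differentiated at the
    eigenvalues of X. *)
Lemma umap_is_diff f X P d :
  orthogonal_mx P -> symval X = P *m diag_mx d *m P^T ->
  (forall i, derivable f (d 0 i) 1) ->
  is_diff X (umap f) (loewner f P d).
Proof.
move=> oP XE fd; apply/is_diffP; split.
  by apply: (nb_linear_blin sym_basis); exact: loewner_linear.
move=> e e0; pose phi := div_diff f.
pose N : R := n%:R; have N0 : 0 <= N by exact: ler0n.
pose D := N * N * N + 1; have D0 : 0 < D by rewrite ltr_wpDl//; nneg.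
pose e' := e / (2 * D); have e'0 : 0 < e' by rewrite divr_gt0// mulr_gt0.
have [r r0 Hr] : exists2 r, 0 < r & forall p : 'I_n * 'I_n,
    forall z, `|z - d 0 p.2| < r ->
    `|phi (d 0 p.1) z - phi (d 0 p.1) (d 0 p.2)| <= e'.
  apply: (@common_radius _ _ (fun p r => forall z, `|z - d 0 p.2| < r ->
    `|phi (d 0 p.1) z - phi (d 0 p.1) (d 0 p.2)| <= e')).
    by move=> p s t ts H z zt; apply: H; exact: lt_le_trans zt ts.
  by move=> p; apply: div_diff_cont.
(* Slopes of phi between old eigenvalues; equal eigenvalues give equal values of
   phi, and the slope 0 is correct for them. *)
pose c i l k := if d 0 l == d 0 k then 0 else
  (phi (d 0 i) (d 0 l) - phi (d 0 i) (d 0 k)) / (d 0 l - d 0 k).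
pose C := \sum_i \sum_l \sum_k `|c i l k|.
have cC i l k : `|c i l k| <= C.
  rewrite /C (bigD1 i)//= (bigD1 l)//= (bigD1 k)//= -!addrA lerDl !addr_ge0//.
  - by apply: sumr_ge0.
  - by apply: sumr_ge0 => ? _; apply: sumr_ge0.
  - by apply: sumr_ge0 => ? _; apply: sumr_ge0 => ? _; apply: sumr_ge0.
have C0 : 0 <= C.
  by apply: sumr_ge0 => ? _; apply: sumr_ge0 => ? _; apply: sumr_ge0.
pose C' := C * (N + 1) + 1.
have C'0 : 0 < C' by rewrite ltr_wpDl//; nneg.
have N10 : 0 < N + 1 by rewrite ltr_wpDl.
exists (Num.min (r / (N + 1)) (e' / C')).
  by rewrite lt_min; apply/andP; split; apply: divr_gt0.
move=> h; rewrite lt_min => /andP[hr he].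
have [Q [g [oQ XhE]]] := sym_eigen (X + h).
pose O := P^T *m Q; pose Y := P^T *m h *m Q.
have oO : orthogonal_mx O.
  by rewrite /orthogonal_mx /O trmx_mul trmxK mulmxA -(mulmxA _ P) (orthogonal_mxV
    oP) mulmx1.
have OE : O = P^T *m Q by [].
have YE0 : Y = P^T *m h *m Q by [].
clearbody O Y.
have O1 i j : `|O i j| <= 1.
  have : O i j ^+ 2 <= 1.
    have <- : (O^T *m O) j j = 1 by rewrite oO mxE eqxx.
    rewrite mxE (bigD1 i)//= mxE -expr2 lerDl sumr_ge0// => k _.
    by rewrite mxE -expr2 sqr_ge0.
  by rewrite -[X in _ <= X -> _](expr1n _ 2) -[_ ^+ 2]real_normK ?num_real//
    ler_pXn2r ?nnegrE.
have YE i j : Y i j = O i j * (g 0 j - d 0 i).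
  have : diag_mx d *m O + Y = O *m diag_mx g.
    have -> : diag_mx d *m O = P^T *m X *m Q.
      by rewrite XE !mulmxA oP mul1mx OE mulmxA.
    rewrite YE0 -mulmxDl -mulmxDr -symvalD XhE !mulmxA -mulmxA oQ mulmx1.
    by rewrite OE.
  move=> /matrixP/(_ i j); rewrite mul_diag_mx mul_mx_diag !mxE => E.
  by rewrite mulrBr -E; ring.
have Yh i j : `|Y i j| <= `|h| by rewrite YE0; exact: orth_entry.
(* Column j of O is a unit vector, so one of its entries O l j is at least 1 / n in
   absolute value, and g j - d l = Y l j / O l j. *)
have near_d j : exists l, `|g 0 j - d 0 l| <= N * `|h|.
  have [l Hl] : exists l, 1 <= N * `|O l j|.
    apply/not_existsP => H.
    have : \sum_l N * `|O l j| ^+ 2 < \sum_(l < n) 1.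
      apply: ltr_sum; first by apply/hasP; exists j; rewrite ?mem_index_enum.
      move=> l _; have := H l; move/negP; rewrite -ltNge; apply: le_lt_trans.
      by rewrite ler_wpM2l// expr2 ler_piMr.
    rewrite -mulr_sumr sumr_const card_ord -[X in _ < X]mulr1 ltr_pM2l; last first.
      by rewrite ltr0n; exact: leq_ltn_trans (leq0n j) (ltn_ord j).
    suff -> : \sum_l `|O l j| ^+ 2 = 1 by rewrite ltxx.
    transitivity ((O^T *m O) j j); last by rewrite oO mxE eqxx.
    by rewrite mxE; apply: eq_bigr => l _; rewrite mxE -expr2 real_normK ?num_real.
  exists l; apply: (@le_trans _ _ (N * `|O l j| * `|g 0 j - d 0 l|)).
    by rewrite ler_peMl.
  by rewrite -mulrA -normrM -YE ler_wpM2l.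
pose M := P^T *m (umap f (X + h) - umap f X - loewner f P d h) *m P.
have ME i k : M i k = \sum_j (phi (d 0 i) (g 0 j) - phi (d 0 i) (d 0 k)) * Y i j *
  O k j.
  have -> : M = P^T *m umap f (X + h) *m P - P^T *m umap f X *m P - loewner_mx f P d h.
    rewrite /M -[symval (_ - _)]/(symval _ - symval _) mulmxBr mulmxBl.
    rewrite -[symval (_ - _)]/(symval _ - symval _) mulmxBr mulmxBl.
    congr (_ - _); rewrite /= !mulmxA oP mul1mx -mulmxA oP mulmx1.
    by [].
  rewrite (umapE f oQ XhE) (umapE f oP XE) !mulmxA oP mul1mx -OE.
  rewrite -(mulmxA _ P^T P) oP mulmx1.
  have -> : O *m diag_mx (map_mx f g) *m Q^T *m P = O *m diag_mx (map_mx f g) *m O^T.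
    by rewrite [in O^T]OE trmx_mul trmxK !mulmxA.
  have -> : diag_mx (map_mx f d) = diag_mx (map_mx f d) *m O *m O^T.
    by rewrite -mulmxA (orthogonal_mxV oO) mulmx1.
  rewrite -mulmxBl.
  have -> : O *m diag_mx (map_mx f g) - diag_mx (map_mx f d) *m O =
      \matrix_(i, j) (phi (d 0 i) (g 0 j) * Y i j).
    apply/matrixP => p q; rewrite mul_mx_diag mul_diag_mx !mxE YE /phi /div_diff.
    have [->|dg] := eqVneq; first by ring.
    have dg0 : d 0 p - g 0 q != 0 by rewrite subr_eq0.
    by field.
  have hE : P^T *m h *m P = Y *m O^T.
    by rewrite YE0 OE trmx_mul trmxK !mulmxA -(mulmxA _ Q) (orthogonal_mxV oQ) mulmx1.
  rewrite /loewner_mx hE mxE [X in X + _]mxE [X in _ + X]mxE [X in - X]mxE.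
  rewrite [(Y *m O^T) i k]mxE mulr_sumr -sumrB; apply: eq_bigr => j _.
  by rewrite !mxE /phi; ring.
have cE i l k : phi (d 0 i) (d 0 l) - phi (d 0 i) (d 0 k) = c i l k * (d 0 l - d 0 k).
  rewrite /c; have [->|lk] := eqVneq; first by rewrite !subrr mulr0.
  by rewrite divfK// subr_eq0.
have h0 : 0 <= `|h| by [].
have hr' : N * `|h| < r.
  move: hr; rewrite ltr_pdivlMr// mulrDr mulr1 mulrC; apply: le_lt_trans.
  by rewrite lerDl.
have he' : C * (N + 1) * `|h| <= e'.
  move: he; rewrite ltr_pdivlMr// => /ltW; apply: le_trans.
  by rewrite mulrC ler_wpM2l// lerDl.
(* g j is replaced by the nearby d l, by continuity of phi. Then d l is replaced by
   d k at a cost proportional to (d l - d k) O k j, which is split into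
   (d l - g j) O k j and Y k j. *)
have Mt i k j : `|(phi (d 0 i) (g 0 j) - phi (d 0 i) (d 0 k)) * Y i j * O k j| <=
    2 * e' * `|h|.
  have [l gl] := near_d j.
  rewrite mulrAC normrM; apply: ler_pM => //.
  have -> : (phi (d 0 i) (g 0 j) - phi (d 0 i) (d 0 k)) * O k j =
    (phi (d 0 i) (g 0 j) - phi (d 0 i) (d 0 l)) * O k j +
    c i l k * ((d 0 l - g 0 j) * O k j + Y k j).
    transitivity ((phi (d 0 i) (g 0 j) - phi (d 0 i) (d 0 l)) * O k j +
      (phi (d 0 i) (d 0 l) - phi (d 0 i) (d 0 k)) * O k j); first by ring.
    by rewrite cE YE; ring.
  rewrite (le_trans (ler_normD _ _))// mulr_natl mulr2n; apply: lerD.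
    rewrite normrM -[leRHS]mulr1; apply: ler_pM => //.
    by apply: (Hr (i, l)); exact: le_lt_trans gl hr'.
  rewrite normrM (le_trans _ he')// -mulrA; apply: ler_pM => //.
  rewrite (le_trans (ler_normD _ _))// [leRHS]mulrDl mul1r; apply: lerD => //.
  by rewrite normrM -[leRHS]mulr1; apply: ler_pM => //; rewrite distrC.
have Mb i k : `|M i k| <= N * (2 * e' * `|h|).
  rewrite ME (le_trans (ler_norm_sum _ _ _))//.
  rewrite (le_trans (ler_sum _ (fun j _ => Mt i k j)))//.
  by rewrite sumr_const card_ord -[leLHS]mulr_natl.
have UM : symval (umap f (X + h) - umap f X - loewner f P d h) = P *m M *m P^T.
  by rewrite /M !mulmxA (orthogonal_mxV oP) mul1mx -mulmxA (orthogonal_mxV oP) mulmx1.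
rewrite (le_trans (sym_norm_le oP UM))//.
apply: (@le_trans _ _ (\sum_(i < n) \sum_(k < n) N * (2 * e' * `|h|))).
  by apply: ler_sum => i _; apply: ler_sum => k _.
rewrite !sumr_const !card_ord.
have -> : N * (2 * e' * `|h|) *+ n *+ n = N * N * N * (2 * e') * `|h|.
  by rewrite -[LHS]mulr_natl -[X in _ * X]mulr_natl -/N; ring.
rewrite ler_wpM2r// /e'.
have -> : N * N * N * (2 * (e / (2 * D))) = e * (N * N * N / D).
  by field; rewrite gt_eqF.
by rewrite ler_piMr ?(ltW e0)// ler_pdivrMr// mul1r lerDl.
Qed.

End Loewner.

(** * Smoothness of the matrix exponential *)

Section MatrixExp.
Context {R : realType}.

Lemma mx_norm_le m n (M : 'M[R]_(m, n)) c : 0 <= c ->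
  (forall i j, `|M i j| <= c) -> `|M| <= c.
Proof.
move=> c0 Mc; rewrite [leLHS]/Num.norm /= mx_normrE.
by apply/bigmax_leP; split => // -[i j] _; exact: Mc.
Qed.

Lemma mx_norm_mul m n p (A : 'M[R]_(m, n)) (B : 'M[R]_(n, p)) :
  `|A *m B| <= n%:R * `|A| * `|B|.
Proof.
apply: mx_norm_le => [|i j]; first by rewrite !mulr_ge0.
rewrite mxE (le_trans (ler_norm_sum _ _ _))//.
apply: (@le_trans _ _ (\sum_(k < n) `|A| * `|B|)).
  by apply: ler_sum => k _; rewrite normrM ler_pM// mx_coord_le.
by rewrite sumr_const card_ord -[leLHS]mulr_natl mulrA.
Qed.

Lemma mx_norm_pow n (X : 'M[R]_n) k : `|X ^+ k| <= (n%:R * `|X|) ^+ k.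
Proof.
elim: k => [|k IH].
  rewrite !expr0; apply: mx_norm_le => // i j; rewrite !mxE.
  by case: eqP => _; rewrite ?mulr0n ?normr0// normr1.
rewrite !exprS (le_trans (mx_norm_mul _ _))//.
by rewrite ler_wpM2l// mulr_ge0.
Qed.

Definition exp_partial n (m : nat) (X : 'M[R]_n) : 'M[R]_n :=
  \sum_(0 <= k < m) (k`!%:R^-1) *: X ^+ k.

(** Defined for all square matrices because the proof of smoothness, even at
    symmetric matrices, evaluates it at block triangular ones. *)
Definition expmx n (X : 'M[R]_n) : 'M[R]_n :=
  \matrix_(i, j) limn (fun m => exp_partial m X i j).

Lemma exp_partialE n (X : 'M[R]_n) i j :
  (fun m => exp_partial m X i j) =
  series (fun k => k`!%:R^-1 * (X ^+ k) i j).
Proof.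
apply/funext => m; rewrite /exp_partial /series /= summxE.
by apply: eq_bigr => k _; rewrite mxE.
Qed.

Lemma exp_term_le n (X : 'M[R]_n) i j k :
  `|k`!%:R^-1 * (X ^+ k) i j| <= exp_coeff (n%:R * `|X|) k.
Proof.
rewrite normrM ger0_norm ?invr_ge0// mulrC /exp_coeff ler_wpM2r ?invr_ge0//.
exact: le_trans (mx_coord_le _ _ _) (mx_norm_pow _ _).
Qed.

Lemma expmx_cvg n (X : 'M[R]_n) i j :
  exp_partial m X i j @[m --> \oo] --> expmx X i j.
Proof.
rewrite mxE; rewrite exp_partialE; apply: normed_cvg.
apply: (series_le_cvg (v_ := exp_coeff (n%:R * `|X|))) => [k|k|k|].
- exact: normr_ge0.
- by rewrite exp_coeff_ge0// mulr_ge0.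
- exact: exp_term_le.
- exact: is_cvg_series_exp_coeff.
Qed.

Lemma expmx_norm n (X : 'M[R]_n) : `|expmx X| <= expR (n%:R * `|X|).
Proof.
apply: mx_norm_le => [|i j]; first exact: expR_ge0.
have x0 : 0 <= n%:R * `|X| by rewrite mulr_ge0.
have c : `|exp_partial m X i j| @[m --> \oo] --> `|expmx X i j|.
  by apply: cvg_norm; exact: expmx_cvg.
rewrite -(cvg_lim (@Rhausdorff R) c); apply: limr_le; first exact: cvgP c.
apply: nearW => m.
have -> : exp_partial m X i j = series (fun k => k`!%:R^-1 * (X ^+ k) i j) m.
  by rewrite -exp_partialE.
rewrite (le_trans (ler_norm_sum _ _ _))//.
apply: (@le_trans _ _ (series (exp_coeff (n%:R * `|X|)) m)).
  by apply: ler_sum => k _; exact: exp_term_le.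
apply: nondecreasing_cvgn_le; last exact: is_cvg_series_exp_coeff.
by apply: nondecreasing_series => k _ _; exact: exp_coeff_ge0.
Qed.

(** This holds for powers, hence for the sum of the series. All identities about
    exponentials of block matrices below are instances, A being a row or a column of
    blocks. *)
Lemma expmx_intertwine p q (A : 'M[R]_(p, q)) X Y :
  A *m X = Y *m A -> A *m expmx X = expmx Y *m A.
Proof.
move=> AX; have AXk k : A *m (X ^+ k) = Y ^+ k *m A.
  elim: k => [|k IH]; first by rewrite !expr0 mulmx1 mul1mx.
  have e m (Z : 'M[R]_m) : Z ^+ k.+1 = Z ^+ k *m Z by exact: exprSr.
  by rewrite !e mulmxA IH -mulmxA AX mulmxA.
have AXp m : A *m exp_partial m X = exp_partial m Y *m A.
  rewrite mulmx_sumr mulmx_suml; apply: eq_bigr => k _.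
  by rewrite -scalemxAr -scalemxAl AXk.
apply/matrixP => i j.
have c1 : (A *m exp_partial m X) i j @[m --> \oo] --> (A *m expmx X) i j.
  rewrite mxE; under eq_cvg => m do rewrite mxE.
  apply: cvg_big => [|k _]; [exact: add_continuous|apply: cvgM; first exact: cvg_cst].
  exact: expmx_cvg.
have c2 : (A *m exp_partial m X) i j @[m --> \oo] --> (expmx Y *m A) i j.
  rewrite mxE; under eq_cvg => m do rewrite AXp mxE.
  apply: cvg_big => [|k _]; [exact: add_continuous|apply: cvgM; last exact: cvg_cst].
  exact: expmx_cvg.
exact: (cvg_unique _ c1 c2).
Qed.

Lemma block_mx_norm n (X v w Y : 'M[R]_n) :
  `|block_mx X v w Y| <= `|X| + `|v| + `|w| + `|Y|.
Proof.
have h : 0 <= `|X| + `|v| + `|w| + `|Y| by nneg.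
apply: mx_norm_le => // i j.
have := (normr_ge0 X, normr_ge0 v, normr_ge0 w, normr_ge0 Y) => -[[[X0 v0] w0] Y0].
case: (split_ordP i) => i' ->; case: (split_ordP j) => j' ->;
  rewrite ?block_mxEul ?block_mxEur ?block_mxEdl ?block_mxEdr;
  by apply: (le_trans (mx_coord_le _ _ _)); lra.
Qed.

Lemma ursubmx_norm n (M : 'M[R]_(n + n)) : `|ursubmx M| <= `|M|.
Proof. by apply: mx_norm_le => // i j; rewrite !mxE mx_coord_le. Qed.

(** The divided difference of the exponential between X and Y, applied to v; for
    Y = X it is the differential. *)
Definition exp_corner p q (X : 'M[R]_p) (v : 'M[R]_(p, q)) (Y : 'M[R]_q) :=
  ursubmx (expmx (block_mx X v 0 Y)).

(** The column (1, 0) and the row (0, 1) intertwine the block matrix with its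
    diagonal blocks. *)
Lemma expmx_block p q (X : 'M[R]_p) (v : 'M[R]_(p, q)) (Y : 'M[R]_q) :
  expmx (block_mx X v 0 Y) = block_mx (expmx X) (exp_corner X v Y) 0 (expmx Y).
Proof.
set T := block_mx X v 0 Y; rewrite -[LHS]submxK -/(exp_corner X v Y).
have h1 : col_mx 1%:M 0 *m X = T *m col_mx 1%:M 0.
  by rewrite mul_block_col mul_col_mx !mul1mx !mulmx1 !mul0mx !mulmx0 !addr0.
have h2 : row_mx 0 1%:M *m T = Y *m row_mx 0 1%:M.
  by rewrite mul_row_block mul_mx_row !mul1mx !mulmx1 !mul0mx !mulmx0 !add0r.
have {h1} := expmx_intertwine h1; have {h2} := expmx_intertwine h2.
rewrite -{1}[expmx T]submxK mul_row_block mul_mx_row.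
rewrite !mul1mx !mulmx1 !mul0mx !mulmx0 !add0r => /eq_row_mx[-> ->].
rewrite -{1}[expmx T]submxK mul_block_col mul_col_mx.
rewrite !mul1mx !mulmx1 !mul0mx !mulmx0 !addr0 => /eq_col_mx[-> _].
by [].
Qed.

(** Let Z be the matrix with block rows (X, 0, v), (0, X, w), (0, 0, Y). Combining the
    first two rows with coefficients b and c intertwines Z with the block matrix
    built on b v + c w. *)
Lemma exp_corner_linear p q (X : 'M[R]_p) (Y : 'M[R]_q) :
  linear (fun v : 'M[R]_(p, q) => exp_corner X v Y).
Proof.
move=> a v w.
pose W := exp_corner (block_mx X 0 0 X) (col_mx v w) Y.
pose B (b c : R) : 'M[R]_(p + q, (p + p) + q) := block_mx (row_mx b%:M c%:M) 0 0 1%:M.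
have h b c : exp_corner X (b *: v + c *: w) Y = b *: usubmx W + c *: dsubmx W.
  have H : B b c *m block_mx (block_mx X 0 0 X) (col_mx v w) 0 Y =
           block_mx X (b *: v + c *: w) 0 Y *m B b c.
    rewrite /B !mulmx_block !mul_row_block !mul_row_col !mul_mx_row.
    rewrite !(mulmx0, mul0mx, addr0, add0r, mul1mx, mulmx1, mul_scalar_mx,
      mul_mx_scalar).
    by rewrite row_mx0.
  have := expmx_intertwine H; rewrite !expmx_block -/W /B !mulmx_block.
  move=> /eq_block_mx[_ + _ _].
  rewrite !(mulmx0, mul0mx, addr0, add0r, mulmx1) -{1}(vsubmxK W) mul_row_col.
  by rewrite !mul_scalar_mx => ->.
have h1 := h 1 0; have h2 := h 0 1; have h3 := h a 1.
rewrite !(scale1r, scale0r, addr0, add0r) in h1 h2 h3.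
by rewrite h1 h2 h3.
Qed.

(** The column (1, 1) intertwines X + v with the block matrix of X, v, X + v. *)
Lemma exp_cornerD n (X v : 'M[R]_n) :
  exp_corner X v (X + v) = expmx (X + v) - expmx X.
Proof.
have H : col_mx 1%:M 1%:M *m (X + v) = block_mx X v 0 (X + v) *m col_mx 1%:M 1%:M.
  by rewrite mul_block_col mul_col_mx !mul1mx !mulmx1 add0r.
have := expmx_intertwine H; rewrite expmx_block mul_block_col mul_col_mx.
rewrite !mul1mx !mulmx1 add0r => /eq_col_mx[-> _].
by rewrite addrAC subrr add0r.
Qed.

Lemma exp_corner_norm n (X v Y : 'M[R]_n) :
  `|exp_corner X v Y| <= expR ((n + n)%:R * (`|X| + `|v| + `|Y|)).
Proof.
rewrite (le_trans (ursubmx_norm _))// (le_trans (expmx_norm _))// ler_expR.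
by rewrite ler_wpM2l// (le_trans (block_mx_norm _ _ _ _))// normr0 addr0.
Qed.

(** The remainder is a difference of two corners, with lower right blocks X + v and
    X. Corners are linear in the upper right block, so a factor |v| comes out. The
    difference of exponentials that is left is itself a corner by [exp_cornerD], of
    twice the size and proportional to v, which gives a second factor |v|. The other
    factors are controlled by the crude bound [expmx_norm]. *)
Lemma expmx_is_diff n (X : 'M[R]_n) :
  is_diff X (@expmx n) (fun v => exp_corner X v X).
Proof.
have lin := exp_corner_linear.
have c0 p (A B : 'M[R]_p) : exp_corner A 0 B = 0.
  by have := lin _ _ A B (-1) 0 0; rewrite scaler0 addr0 scaleN1r addNr.
have cZ p (A B : 'M[R]_p) a v : exp_corner A (a *: v) B = a *: exp_corner A v B.
  by have := lin _ _ A B a v 0; rewrite c0 !addr0.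
apply/is_diffP; split.
  split; first exact: lin.
  exists (expR ((n + n)%:R * (`|X| + 1 + `|X|))); first exact: expR_gt0.
  move=> v; have [->|v0] := eqVneq v 0.
    by rewrite c0 !normr0 mulr0.
  have nv : `|v| != 0 by rewrite normr_eq0.
  have -> : v = `|v| *: (`|v|^-1 *: v) by rewrite scalerA mulfV ?scale1r.
  rewrite cZ !normrZ !normfV !normr_id mulVf// mulr1 mulrC ler_wpM2r//.
  rewrite (le_trans (exp_corner_norm _ _ _))// normrZ normfV normr_id mulVf//.
move=> e e0.
(* A bound for the exponential of the matrix of size 4 n below, whose blocks have
   norms at most 2 |X| + 1, 1 and 2 |X| + 2. *)
pose K := expR ((n + n + (n + n))%:R * (4 * `|X| + 5)).
have K0 : 0 < K by exact: expR_gt0.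
exists (Num.min 1 (e / K)); first by rewrite lt_min ltr01 divr_gt0.
move=> v; rewrite lt_min => /andP[v1 ve].
have [->|v0] := eqVneq v 0.
  by rewrite addr0 subrr sub0r c0 oppr0 !normr0 mulr0.
have nv : `|v| != 0 by rewrite normr_eq0.
pose s := `|v|; pose u := s^-1 *: v.
have vE : v = s *: u by rewrite /u scalerA mulfV ?scale1r.
have u1 : `|u| = 1 by rewrite normrZ normfV normr_id mulVf.
pose Z := block_mx X u 0 X; pose W' : 'M[R]_(n + n) := block_mx 0 0 0 u.
have ZW : Z + s *: W' = block_mx X u 0 (X + v).
  by rewrite /Z /W' scale_block_mx !scaler0 add_block_mx !addr0 -vE.
have -> : expmx (X + v) - expmx X - exp_corner X v X =
    (s * s) *: ursubmx (exp_corner Z W' (Z + s *: W')).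
  have E1 : s *: exp_corner Z W' (Z + s *: W') =
      expmx (block_mx X u 0 (X + v)) - expmx (block_mx X u 0 X).
    by rewrite -cZ exp_cornerD ZW.
  have urZ (M : 'M[R]_(n + n)) : s *: ursubmx M = ursubmx (s *: M).
    by apply/matrixP => i j; rewrite !mxE.
  have urB (M M' : 'M[R]_(n + n)) : ursubmx (M - M') = ursubmx M - ursubmx M'.
    by apply/matrixP => i j; rewrite !mxE.
  rewrite -scalerA urZ E1 urB -/(exp_corner X u (X + v)) -/(exp_corner X u X).
  by rewrite scalerBr -!cZ -vE exp_cornerD.
rewrite normrZ normrM normr_id -mulrA.
have H : `|ursubmx (exp_corner Z W' (Z + s *: W'))| <= K.
  rewrite (le_trans (ursubmx_norm _))// (le_trans (exp_corner_norm _ _ _))//.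
  rewrite ler_expR ler_wpM2l// ZW.
  have Z1 : `|Z| <= 2 * `|X| + 1.
    by rewrite (le_trans (block_mx_norm _ _ _ _))// normr0 u1; lra.
  have Z2 : `|W'| <= 1.
    by rewrite (le_trans (block_mx_norm _ _ _ _))// !normr0 u1; lra.
  have Z3 : `|block_mx X u 0 (X + v)| <= 2 * `|X| + 2.
    rewrite (le_trans (block_mx_norm _ _ _ _))// normr0 u1.
    by have := ler_normD X v; lra.
  by lra.
have sK : s * K <= e by move: ve; rewrite ltr_pdivlMr// => /ltW.
rewrite mulrC ler_wpM2r//; apply: le_trans sK.
by rewrite ler_wpM2l.
Qed.

Lemma block_diag_blin n : bounded_linear (fun X : 'M[R]_n => block_mx X 0 0 X).
Proof.
split=> [a X Y|].
  by rewrite scale_block_mx add_block_mx !scaler0 !addr0.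
exists 2 => // X; rewrite (le_trans (block_mx_norm _ _ _ _))// !normr0; lra.
Qed.

Lemma ursubmx_blin n : bounded_linear (@ursubmx R n n n n).
Proof.
split=> [a X Y|]; first by apply/matrixP => i j; rewrite !mxE.
by exists 1 => // X; rewrite mul1r ursubmx_norm.
Qed.

(** The derivative in the direction v is a corner of the exponential of a matrix that
    is affine in X and of twice the size: if the exponentials of all sizes are of
    class C^k, they are of class C^(k+1). *)
Lemma expmx_smooth n : smooth_on setT (@expmx n).
Proof.
rewrite /smooth_on => k; elim: k n => [|k IH] n.
  by move=> X _; apply: differentiable_continuous; exact: is_diff_ex (expmx_is_diff X).
apply: (CkS_is_diff (df := fun X v => exp_corner X v X)); first exact: openT.
  by move=> X _; exact: expmx_is_diff.
move=> v; apply: Ck_linl; [exact: openT|exact: ursubmx_blin|].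
apply: (Ck_ext (f := fun X : 'M[R]_n => expmx (block_mx 0 v 0 0 + block_mx X 0 0 X))).
- exact: openT.
- by move=> X _; rewrite add_block_mx !addr0 !add0r.
apply: (Ck_affr (B := setT)) => //; [exact: openT|exact: block_diag_blin].
Qed.

End MatrixExp.

(** * Algebra of univariate maps *)

Section UmapAlgebra.
Context {R : realType} {n : nat}.
Local Notation S := (Sym R n).
Implicit Types (f g : R -> R) (X Y : S).

Lemma umap_comp f g X : umap g (umap f X) = umap (g \o f) X.
Proof.
have [P [d [oP XE]]] := sym_eigen X; apply: val_inj => /=.
rewrite -[LHS]/(symval _) -[RHS]/(symval _).
rewrite (umapE _ oP XE) (umapE g oP (umapE f oP XE)).
by congr (_ *m diag_mx _ *m _); apply/rowP => i; rewrite !mxE.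
Qed.

Lemma umap_eq_SPD f g X : (forall x, 0 < x -> f x = g x) -> SPD R n X ->
  umap f X = umap g X.
Proof.
move=> fg; have [P [d [oP XE]]] := sym_eigen X => /(SPD_eig oP XE) d0.
apply: val_inj; rewrite -[LHS]/(symval _) -[RHS]/(symval _) !(umapE _ oP XE).
by congr (_ *m diag_mx _ *m _); apply/rowP => i; rewrite !mxE fg.
Qed.

Lemma umap_eq f g X : (forall x, f x = g x) -> umap f X = umap g X.
Proof.
by move=> fg; have -> : f = g by apply/funext.
Qed.

Lemma umap_id X : umap id X = X.
Proof.
have [P [d [oP XE]]] := sym_eigen X; apply: val_inj.
by rewrite -[LHS]/(symval _) (umapE _ oP XE) [RHS]XE map_mx_id.
Qed.

Lemma umap_SPD f X : (forall x, 0 < x -> 0 < f x) -> SPD R n X ->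
  SPD R n (umap f X).
Proof.
move=> f0; have [P [d [oP XE]]] := sym_eigen X => /(SPD_eig oP XE) d0.
by apply/(SPD_eig oP (umapE f oP XE)) => i; rewrite mxE f0.
Qed.

Lemma umap_gt0_SPD f X : (forall x, 0 < f x) -> SPD R n (umap f X).
Proof.
move=> f0; have [P [d [oP XE]]] := sym_eigen X.
by apply/(SPD_eig oP (umapE f oP XE)) => i; rewrite mxE f0.
Qed.

Lemma umap_mul f g X :
  umap f X *m umap g X = symval (umap (fun x => f x * g x) X).
Proof.
have [P [d [oP XE]]] := sym_eigen X; rewrite !(umapE _ oP XE).
rewrite !mulmxA -(mulmxA _ P^T P) oP mulmx1 -(mulmxA P) mulmx_diag.
by congr (_ *m diag_mx _ *m _); apply/rowP => i; rewrite !mxE.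
Qed.

Lemma umapD f g X :
  umap (fun x => f x + g x) X = umap f X + umap g X.
Proof.
have [P [d [oP XE]]] := sym_eigen X; apply: val_inj.
rewrite -[LHS]/(symval _) -[RHS]/(symval (umap f X) + symval (umap g X)).
rewrite !(umapE _ oP XE) -mulmxDl -mulmxDr; congr (_ *m _ *m _).
apply/matrixP => i j; rewrite !mxE.
by case: (i == j); rewrite ?mulr0n ?addr0 ?mulr1n.
Qed.

Lemma umapZ a f X : umap (fun x => a * f x) X = a *: umap f X.
Proof.
have [P [d [oP XE]]] := sym_eigen X; apply: val_inj.
rewrite -[LHS]/(symval _) -[RHS]/(a *: symval (umap f X)).
rewrite !(umapE _ oP XE) scalemxAl scalemxAr; congr (_ *m _ *m _).
by apply/matrixP => i j; rewrite !mxE mulrnAr.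
Qed.

Lemma tr_umap f X (P : 'M[R]_n) d : orthogonal_mx P ->
  symval X = P *m diag_mx d *m P^T -> \tr (umap f X) = \sum_i f (d 0 i).
Proof.
move=> oP XE; rewrite (umapE _ oP XE) -mulmxA mxtrace_mulC -mulmxA oP mulmx1.
by rewrite mxtrace_diag; apply: eq_bigr => i _; rewrite mxE.
Qed.

End UmapAlgebra.

(** * The logarithm and the powers are diffeomorphisms *)

Section UmapExp.
Context {R : realType}.

Lemma expmx1 (x : R) : expmx (x%:M : 'M[R]_1) = (expR x)%:M.
Proof.
apply/matrixP => i j; rewrite !ord1 [in RHS]mxE eqxx mulr1n mxE exp_partialE.
congr (limn (series _)); apply/funext => k; rewrite /exp_coeff mulrC.
congr (_ / _); elim: k => [|k IH]; first by rewrite !expr0 mxE.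
have -> : (x%:M : 'M[R]_1) ^+ k.+1 = x%:M *m (x%:M : 'M[R]_1) ^+ k by exact: exprS.
by rewrite mul_scalar_mx mxE IH exprS.
Qed.

(** By intertwining, the exponential of X acts on an eigenvector as the exponential
    of a 1 by 1 matrix. *)
Lemma umap_expR n (X : Sym R n) : symval (umap expR X) = expmx X.
Proof.
have [P [d [oP XE]]] := sym_eigen X; rewrite (umapE _ oP XE).
suff -> : P *m diag_mx (map_mx expR d) = expmx X *m P.
  by rewrite -mulmxA (orthogonal_mxV oP) mulmx1.
have XP : X *m P = P *m diag_mx d by rewrite XE -mulmxA oP mulmx1.
have cM (A B : 'M[R]_n) j : A *m col j B = col j (A *m B).
  by rewrite !colE mulmxA.
apply/matrixP => i j.
have H : col j P *m (d 0 j)%:M = X *m col j P.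
  rewrite cM XP; apply/matrixP => k l; rewrite mul_mx_scalar mul_mx_diag !mxE.
  exact: mulrC.
have := expmx_intertwine H; rewrite expmx1 mul_mx_scalar cM.
move=> /matrixP/(_ i 0); rewrite mul_mx_diag mxE [X in _ * X]mxE [RHS]mxE => <-.
by rewrite !mxE mulrC.
Qed.

Fact symmetrize_subproof n (M : 'M[R]_n) : 2^-1 *: (M + M^T) \in symm_pred.
Proof. by apply/eqP; rewrite linearZ linearD /= trmxK addrC. Qed.

Definition symmetrize n (M : 'M[R]_n) : Sym R n := MkSym (symmetrize_subproof M).

Lemma symmetrizeK n (X : Sym R n) : symmetrize (symval X) = X.
Proof.
by apply: val_inj => /=; rewrite symP; apply/matrixP => i j; rewrite !mxE; field.
Qed.

Lemma symmetrize_blin n : bounded_linear (@symmetrize n).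
Proof.
split.
  move=> a M M'; apply: val_inj.
  rewrite -[RHS]/(a *: symval (symmetrize M) + symval (symmetrize M')) /=.
  by apply/matrixP => i j; rewrite !mxE; ring.
exists ((n * n)%:R + 1); first by rewrite ltr_wpDl.
move=> M.
have E : symval (symmetrize M) = 1%:M *m (2^-1 *: (M + M^T)) *m 1%:M^T.
  by rewrite trmx1 mul1mx mulmx1.
rewrite (le_trans (sym_norm_le orth1 E))//.
apply: (@le_trans _ _ (\sum_(i < n) \sum_(j < n) `|M|)).
  apply: ler_sum => i _; apply: ler_sum => j _; rewrite !mxE normrM.
  have := (mx_coord_le M i j, mx_coord_le M j i) => -[h1 h2].
  have := ler_normD (M i j) (M j i); rewrite ger0_norm//; lra.
rewrite !sumr_const !card_ord -mulrnA -[leLHS]mulr_natl mulrDl mul1r.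
by rewrite lerDl.
Qed.

Lemma symval_blin n : bounded_linear (fun X : Sym R n => symval X).
Proof.
split=> [a X Y|]; first by rewrite symvalD symvalZ.
exists 1 => // X; rewrite mul1r; apply: mx_norm_le => // i j.
exact: sym_entry.
Qed.

Lemma umap_expR_smooth n : smooth_on setT (@umap R n expR).
Proof.
move=> k; apply: (Ck_ext (f := fun X : Sym R n => symmetrize (expmx (symval X)))).
- exact: openT.
- by move=> X _; rewrite -umap_expR symmetrizeK.
apply: Ck_linl; [exact: openT|exact: symmetrize_blin|].
apply: (Ck_linr (B := setT)); [exact: openT|exact: symval_blin|by []|].
exact: expmx_smooth.
Qed.

Lemma derivable_ln (x : R) : 0 < x -> derivable (@ln R) x 1.
Proof. by move=> x0; have [] := is_derive1_ln x0. Qed.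

(** The logarithm inverts the exponential, and [umap_is_diff] supplies the
    differentiability from which [smooth_inverse] starts. *)
Lemma umap_ln_smooth n : smooth_on (SPD R n) (umap (@ln R)).
Proof.
apply: (smooth_inverse sym_basis sym_basis (A := setT) (f := umap expR)) => //.
- exact: openT.
- exact: open_SPD.
- exact: umap_expR_smooth.
- move=> X pX; rewrite umap_comp -[RHS]umap_id.
  by apply: umap_eq_SPD => // x x0; rewrite /= lnK// posrE.
- move=> X pX; have [P [d [oP XE]]] := sym_eigen X.
  apply: is_diff_ex (umap_is_diff oP XE _) => i; apply: derivable_ln.
  exact: (SPD_eig oP XE).1.
Qed.

Lemma umap_powR_smooth n a : smooth_on (SPD R n) (umap (fun x : R => x `^ a)).
Proof.
move=> k; apply: (Ck_ext (f := fun X : Sym R n => umap expR (a *: umap (@ln R) X))).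
- exact: open_SPD.
- move=> X pX; rewrite -umapZ umap_comp; apply: umap_eq_SPD => // x x0 /=.
  by rewrite /powR gt_eqF.
apply: (Ck_comp sym_basis (B := setT) (f := fun X => a *: umap (@ln R) X)) => //.
- exact: open_SPD.
- exact: openT.
- apply: Ck_linl; [exact: open_SPD| |exact: umap_ln_smooth].
  exact: blin_scale.
exact: umap_expR_smooth.
Qed.

Lemma diffeo_of_inverse (V W : normedModType R) (A : set V) (B : set W) f g :
  open B -> smooth_on A f -> smooth_on B g ->
  (forall x, A x -> B (f x)) -> (forall y, B y -> A (g y)) ->
  (forall x, A x -> g (f x) = x) -> (forall y, B y -> f (g y) = y) ->
  diffeo_onto_image A f.
Proof.
move=> oB sf sg AB BA gf fg.
have fi : {in A &, injective f}.
  by move=> x y /set_mem Ax /set_mem Ay E; rewrite -(gf x Ax) E gf.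
have im : f @` A = B.
  rewrite eqEsubset; split=> [_ [x Ax <-]|y By]; first exact: AB.
  by exists (g y); [exact: BA|exact: fg].
split=> //; rewrite im // => k; apply: Ck_ext (sg k) => // y By.
by rewrite -[in RHS](fg y By) /inv_on pinvKV// mem_set//; exact: BA.
Qed.

Lemma ln_diffeo n : univariate_diffeo n (@ln R).
Proof.
apply: (diffeo_of_inverse (B := setT) (g := umap expR)) => //.
- exact: openT.
- exact: umap_ln_smooth.
- exact: umap_expR_smooth.
- by move=> X _; apply: umap_gt0_SPD => x; exact: expR_gt0.
- move=> X pX; rewrite umap_comp -[RHS]umap_id.
  by apply: umap_eq_SPD => // x x0; rewrite /= lnK// posrE.
- move=> X _; rewrite umap_comp -[RHS]umap_id; apply: umap_eq => x.
  by rewrite /= expRK.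
Qed.

Lemma powR_diffeo n a : a != 0 -> univariate_diffeo n (fun x : R => x `^ a).
Proof.
move=> a0; apply: (diffeo_of_inverse (B := SPD R n) (g := umap (fun x : R => x `^
  a^-1))).
- exact: open_SPD.
- exact: umap_powR_smooth.
- exact: umap_powR_smooth.
- by move=> X; apply: umap_SPD => x x0; exact: powR_gt0.
- by move=> X; apply: umap_SPD => x x0; exact: powR_gt0.
- move=> X pX; rewrite umap_comp -[RHS]umap_id.
  by apply: umap_eq_SPD => // x x0; rewrite /= -powRrM mulfV// powRr1// ltW.
- move=> X pX; rewrite umap_comp -[RHS]umap_id.
  by apply: umap_eq_SPD => // x x0; rewrite /= -powRrM mulVf// powRr1// ltW.
Qed.

Lemma Falpha_diffeo n a : univariate_diffeo n (Falpha a : R -> R).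
Proof.
by rewrite /Falpha; case: eqVneq => [_|a0]; [exact: ln_diffeo|exact: powR_diffeo].
Qed.

End UmapExp.

(** * Pullback of the flat connection by a diffeomorphism *)

Section DiffeoGeometry.
Context {R : realType}.
Variables (V W : normedModType R) (N : nat).
Hypotheses (bV : normed_basis V N) (bW : normed_basis W N).
Variables (A : set V) (f : V -> W).
Hypotheses (oA : open A) (df : diffeo_onto_image A f).
Local Notation g := (inv_on A f).

Lemma diffeo_smooth : smooth_on A f. Proof. by case: df. Qed.
Lemma diffeo_inv_smooth : smooth_on (f @` A) g. Proof. by case: df. Qed.
Lemma diffeo_open : open (f @` A). Proof. by case: df. Qed.

Lemma inv_onK x : A x -> g (f x) = x.
Proof. by case: df => fi _ _ _ Ax; rewrite /inv_on pinvKV// mem_set. Qed.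

Lemma inv_onKV y : (f @` A) y -> A (g y) /\ f (g y) = y.
Proof. by move=> [x Ax <-]; rewrite inv_onK. Qed.

Lemma diffeo_is_diff x : A x -> is_diff x f ('d f x).
Proof. by move=> Ax; exact: smooth_on_is_diff diffeo_smooth Ax. Qed.

Lemma diffeo_inv_is_diff x : A x -> is_diff (f x) g ('d g (f x)).
Proof.
by move=> Ax; apply: smooth_on_is_diff diffeo_inv_smooth _; exists x.
Qed.

Lemma diff_inv_onK x v : A x -> 'd g (f x) ('d f x v) = v.
Proof.
move=> Ax; have D := is_diff_compf (diffeo_is_diff Ax) (diffeo_inv_is_diff Ax).
have D1 := is_diff_ext oA Ax (fun y Ay => inv_onK Ay) D.
exact: (congr1 (@^~ v) (etrans (esym (is_diff_val D1)) (is_diff_val (is_diff_id x)))).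
Qed.

Lemma diff_inv_onKV x w : A x -> 'd f x ('d g (f x) w) = w.
Proof.
move=> Ax; have D : is_diff (g (f x)) f ('d f x).
  by rewrite inv_onK//; exact: diffeo_is_diff.
have D' := is_diff_compf (diffeo_inv_is_diff Ax) D.
have fA : (f @` A) (f x) by exists x.
have D1 := is_diff_ext diffeo_open fA (fun y Ay => (inv_onKV Ay).2) D'.
exact: (congr1 (@^~ w) (etrans (esym (is_diff_val D1)) (is_diff_val (is_diff_id (f
  x))))).
Qed.

(** The expression of X in the chart f, as a function on A and not on the image of f,
    so that it can be differentiated without the inverse of f. *)
Definition chart_field (X : vfield V) : V -> W := fun x => 'd f x (X x).

Lemma Ck_diff_apply k (U U' : normedModType R) M (b : normed_basis U M) (B : set V)
  (F : V -> U -> U')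
    (X : V -> U) : open B -> (forall x, B x -> linear (F x)) ->
  (forall u, Ck k B (fun x => F x u)) -> Ck k B X ->
  Ck k B (fun x => F x (X x)).
Proof.
move=> oB Fl CF CX.
apply: (Ck_ext (f := fun x => \sum_i nb_coord b i (X x) *: F x (nb_vec b i))) => //.
  move=> x Bx; have bl := nb_linear_blin b (Fl x Bx).
  rewrite [in RHS](nb_sum b (X x)) (blin_sum bl).
  by apply: eq_bigr => i _; rewrite (blinZ bl).
apply: Ck_sum => // i _; apply: Ck_scale => //.
by apply: Ck_linl => //; exact: nb_blin.
Qed.

Lemma chart_field_smooth X : smooth_on A X -> smooth_on A (chart_field X).
Proof.
move=> sX k; apply: (Ck_diff_apply (F := fun x => 'd f x) bV) => //.
- by move=> x _; exact: linearP.
- by move=> v; have [_] := diffeo_smooth k.+1; apply.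
Qed.

(** The pushforward is the chart expression composed with the inverse of f. *)
Lemma push_is_diff Y x : smooth_on A Y -> A x ->
  is_diff (f x) (Defs.pushforward A f Y)
    (fun w => 'd (chart_field Y) x ('d g (f x) w)).
Proof.
move=> sY Ax.
have D : is_diff (g (f x)) (chart_field Y) ('d (chart_field Y) x).
  by rewrite inv_onK//; exact: smooth_on_is_diff (chart_field_smooth sY) Ax.
exact: (is_diff_compf (diffeo_inv_is_diff Ax) D).
Qed.

Lemma pushforwardE X x : A x -> Defs.pushforward A f X (f x) = 'd f x (X x).
Proof. by move=> Ax; rewrite /Defs.pushforward inv_onK. Qed.

Lemma flat_pushforward X Y x : smooth_on A Y -> A x ->
  flat_connection (Defs.pushforward A f X) (Defs.pushforward A f Y) (f x) =
  'd (chart_field Y) x (X x).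
Proof.
move=> sY Ax; rewrite /flat_connection (is_diff_val (push_is_diff sY Ax)).
by rewrite pushforwardE// diff_inv_onK.
Qed.

Local Notation nabla := (pullback_connection A f (@flat_connection R W)).

Lemma pullback_flatE X Y x : smooth_on A Y -> A x ->
  nabla X Y x = 'd g (f x) ('d (chart_field Y) x (X x)).
Proof. by move=> sY Ax; rewrite /pullback_connection flat_pushforward. Qed.

(** Read in the chart, the pulled back connection differentiates chart expressions.
    Everything below about this connection goes through this identity. *)
Lemma diff_pullback_flat X Y x : smooth_on A Y -> A x ->
  'd f x (nabla X Y x) = 'd (chart_field Y) x (X x).
Proof. by move=> sY Ax; rewrite pullback_flatE// diff_inv_onKV. Qed.

Lemma smooth_add (U : normedModType R) (X Y : V -> U) :
  smooth_on A X -> smooth_on A Y -> smooth_on A (fun x => X x + Y x).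
Proof. by move=> sX sY k; apply: Ck_add. Qed.

Lemma smooth_scale (U : normedModType R) (h : V -> R^o) (Y : V -> U) :
  smooth_on A h -> smooth_on A Y -> smooth_on A (fun x => h x *: Y x).
Proof. by move=> sX sY k; apply: Ck_scale. Qed.

(** Each axiom becomes a differentiation rule for chart expressions. *)
Lemma pullback_affine_connection : affine_connection A nabla.
Proof.
split.
- move=> X X' Y Y' sX sX' sY sY' XX YY x /set_mem Ax.
  rewrite !pullback_flatE//; congr ('d g (f x) _).
  have E : forall y, A y -> chart_field Y' y = chart_field Y y.
    by move=> y Ay; rewrite /chart_field YY// mem_set.
  rewrite XX ?mem_set//.
  rewrite (diff_ext oA Ax E) //.
  exact: is_diff_ex (smooth_on_is_diff (chart_field_smooth sY') Ax).
- move=> X Y sX sY k.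
  apply: (Ck_ext (f := fun x => 'd g (f x) ('d (chart_field Y) x (X x)))) => //.
    by move=> x Ax; rewrite pullback_flatE.
  apply: (Ck_diff_apply (F := fun x => 'd g (f x)) bW) => //.
  + by move=> x _; exact: linearP.
  + move=> w; apply: (Ck_comp bW (B := f @` A) (g := fun y => 'd g y w)) => //.
    * exact: diffeo_open.
    * exact: (diffeo_smooth k).
    * by have [_] := diffeo_inv_smooth k.+1; apply.
  + apply: (Ck_diff_apply (F := fun x => 'd (chart_field Y) x) bV) => //.
    * by move=> x _; exact: linearP.
    * by move=> v; have [_] := chart_field_smooth sY k.+1; apply.
- move=> h X X' Y sh sX sX' sY x Ax.
  by rewrite !pullback_flatE// !linearP.
- move=> X Y Y' sX sY sY' x Ax.
  rewrite !pullback_flatE//; last exact: smooth_add.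
  rewrite -linearD; congr ('d g (f x) _).
  have D := is_diffDf (smooth_on_is_diff (chart_field_smooth sY) Ax)
     (smooth_on_is_diff (chart_field_smooth sY') Ax).
  have E : chart_field (fun y => Y y + Y' y) = (fun y => chart_field Y y +
    chart_field Y' y).
    by apply/funext => y; rewrite /chart_field linearD.
  by rewrite E (is_diff_val D).
- move=> h X Y sh sX sY x Ax.
  rewrite !pullback_flatE//; last exact: smooth_scale.
  have D := is_diff_bilin (bbilin_scale _) (smooth_on_is_diff sh Ax)
     (smooth_on_is_diff (chart_field_smooth sY) Ax).
  have E : chart_field (fun y => h y *: Y y) = (fun y => h y *: chart_field Y y).
    by apply/funext => y; rewrite /chart_field linearZ.
  rewrite E (is_diff_val D) addrC linearD !linearZ /=.
  by rewrite /chart_field diff_inv_onK.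
Qed.

End DiffeoGeometry.

(** * Affine charts of the pulled back connection *)

Section AffineCharts.
Context {R : realType}.
Variables (V W W' : normedModType R) (N : nat).
Hypotheses (bV : normed_basis V N) (bW : normed_basis W N).
Variables (A : set V) (f : V -> W) (L : W -> W') (L' : W' -> W).
Hypotheses (oA : open A) (df : diffeo_onto_image A f).
Hypotheses (bL : bounded_linear L) (bL' : bounded_linear L').
Hypotheses (LK : cancel L L') (L'K : cancel L' L).

Lemma diffeo_linear : diffeo_onto_image A (fun x => L (f x)).
Proof.
have oB : open [set z | (f @` A) (L' z)].
  rewrite -[X in open X]/(L' @^-1` (f @` A)); apply: open_comp; last exact: diffeo_open.
  by move=> z _; exact: blin_cont.
apply: (diffeo_of_inverse (B := [set z | (f @` A) (L' z)])
  (g := fun z => inv_on A f (L' z))) => //.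
- by move=> k; apply: Ck_linl => //; exact: diffeo_smooth.
- move=> k; apply: (Ck_linr (B := f @` A) (f := inv_on A f)) => //.
  exact: diffeo_inv_smooth.
- by move=> x Ax /=; rewrite LK; exists x.
- by move=> y /= /(inv_onKV df)[].
- by move=> x Ax; rewrite LK inv_onK.
- by move=> y /= /(inv_onKV df)[_ ->]; rewrite L'K.
Qed.

(** Linear isomorphisms preserve the flat connection. This allows coordinates to take
    values in R^N and to be rescaled. *)
Lemma affine_chart_linear :
  affine_chart A (pullback_connection A f (@flat_connection R W)) (fun x => L (f x)).
Proof.
split; first exact: diffeo_linear.
move=> X Y sX sY x Ax.
rewrite (flat_pushforward bV oA diffeo_linear _ sY Ax).
have dL y : A y -> 'd (fun x => L (f x)) y = (fun v => L ('d f y v)) :> (_ -> _).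
  by move=> Ay; exact: (is_diff_val (is_diff_linl bL (diffeo_is_diff df Ay))).
rewrite dL// (diff_pullback_flat bV) //.
have E y : A y -> L (chart_field f Y y) = chart_field (fun x => L (f x)) Y y.
  by move=> Ay; rewrite /chart_field dL.
have D := is_diff_linl bL (smooth_on_is_diff (chart_field_smooth bV oA df sY) Ax).
by rewrite (is_diff_val (is_diff_ext oA Ax E D)).
Qed.

End AffineCharts.

(** * Univariate diffeomorphisms on scalar matrices *)

Section ScalarPart.
Context {R : realType} {n : nat}.
Hypothesis n_gt0 : (0 < n)%N.
Local Notation S := (Sym R n).
Variables (u : R -> R).
Hypothesis du : univariate_diffeo n u.

Fact sym1_subproof : (1%:M : 'M[R]_n) \in symm_pred.
Proof. by apply/eqP; rewrite trmx1. Qed.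
Definition sym1 : S := MkSym sym1_subproof.

Let i0 : 'I_n := Ordinal n_gt0.

Lemma sym1_neq0 : sym1 != 0.
Proof.
apply/eqP => /(congr1 (fun X : S => symval X i0 i0)) E.
have : (1%:M : 'M[R]_n) i0 i0 = (0 : 'M[R]_n) i0 i0 := E.
by rewrite !mxE eqxx => /eqP; rewrite oner_eq0.
Qed.

Lemma scalar_symE t : symval (t *: sym1) = 1%:M *m diag_mx (const_mx t) *m 1%:M^T.
Proof. by rewrite trmx1 mul1mx mulmx1 diag_const_mx symvalZ /= scalemx1. Qed.

Lemma umap_scalar f t : umap f (t *: sym1) = f t *: sym1.
Proof.
apply: val_inj; rewrite -[LHS]/(symval _) -[RHS]/(symval _).
rewrite (umapE f orth1 (scalar_symE t)) scalar_symE.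
by congr (_ *m diag_mx _ *m _); apply/rowP => i; rewrite !mxE.
Qed.

Lemma SPD_scalar1 t : 0 < t -> SPD R n (t *: sym1).
Proof. by move=> t0; apply/(SPD_eig orth1 (scalar_symE t)) => i; rewrite mxE. Qed.

Lemma scaler_sym1_blin : bounded_linear (fun t : R^o => t *: sym1).
Proof. exact: blin_scaler (blin_id _). Qed.

Lemma sym_entry_blin i j : bounded_linear (fun X : S => X i j : R^o).
Proof.
split=> [a X Y|]; first by rewrite symvalD symvalZ !mxE.
by exists 1 => // X; rewrite mul1r sym_entry.
Qed.

(** On scalar matrices [umap u] is u, and so the regularity of u is inherited from
    that of [umap u]. *)
Lemma univariate_is_diff (t : R^o) : 0 < t ->
  is_diff t (fun s : R^o => u s *: sym1)
    (fun h : R^o => 'd (umap u) (t *: sym1) (h *: sym1)).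
Proof.
move=> t0.
have D := is_diff_compf (is_diff_blin t scaler_sym1_blin)
   (diffeo_is_diff du (SPD_scalar1 t0)).
by have -> : (fun s : R^o => u s *: sym1) = (fun s => umap u (s *: sym1));
  [apply/funext => s; rewrite umap_scalar|].
Qed.

Lemma univariate_derivable (t : R) : 0 < t -> derivable u t 1 /\
  derive1 u t = ('d (umap u) (t *: sym1) sym1) i0 i0.
Proof.
move=> t0; have D := is_diff_linl (sym_entry_blin i0 i0) (univariate_is_diff t0).
have D' : is_diff t (u : R^o -> R^o) (fun h : R^o =>
     ('d (umap u) (t *: sym1) (h *: sym1)) i0 i0).
  have E : (fun s : R^o => (u s *: sym1) i0 i0 : R^o) = (u : R^o -> R^o).
    by apply/funext => s; rewrite symvalZ mxE [sym1 _ _]mxE eqxx mulr1.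
  by move: D; rewrite E.
by have [? ->] := is_diff_derive D'; rewrite scale1r.
Qed.

(** Otherwise the identity matrix would be in the kernel of the differential of
    [umap u]. *)
Lemma univariate_derive_neq0 (t : R) : 0 < t -> derive1 u t != 0.
Proof.
move=> t0; have [du1 _] := univariate_derivable t0.
apply/eqP => u0.
have D := is_diff_linl scaler_sym1_blin (derivable_is_diff du1).
have /(congr1 (fun F => F 1)) := etrans (esym (is_diff_val (univariate_is_diff
  t0))) (is_diff_val D).
rewrite u0 mulr0 scale0r scale1r => /(congr1 ('d (inv_on (SPD R n) (umap u)) (umap
  u (t *: sym1)))).
rewrite linear0 (diff_inv_onK open_SPD du)//; last exact: SPD_scalar1.
by move/eqP; rewrite (negbTE sym1_neq0).
Qed.

Definition posreal : set R^o := [set t | 0 < t].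

Lemma open_posreal : open posreal.
Proof. exact: open_gt. Qed.

Lemma univariate_derive_cont (t : R) : 0 < t -> {for t, continuous (derive1 u)}.
Proof.
have : Ck 0 posreal (fun t : R^o => derive1 u t : R^o).
  apply: (Ck_ext (f := fun t : R^o => ('d (umap u) (t *: sym1) sym1) i0 i0 : R^o)).
  - exact: open_posreal.
  - by move=> s s0; have [_ ->] := univariate_derivable s0.
  apply: (Ck_linl (L := fun X : S => X i0 i0 : R^o)
    (f := fun t : R^o => 'd (umap u) (t *: sym1) sym1));
    [exact: open_posreal|exact: sym_entry_blin|].
  apply: (Ck_linr (B := SPD R n) (f := fun X => 'd (umap u) X sym1)).
  - exact: open_posreal.
  - exact: scaler_sym1_blin.
  - by move=> s; exact: SPD_scalar1.
  - by have [_] := diffeo_smooth du 1%N; apply.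
by move=> H t0; exact: H.
Qed.

Lemma continuous_within_itv (f : R -> R) a b :
  (forall t, 0 < t -> {for t, continuous f}) -> 0 < a ->
  {within `[a, b], continuous f}.
Proof.
move=> fc a0; apply: continuous_in_subspaceT => t; rewrite inE /= in_itv /= =>
  /andP[at0 _].
by apply: fc; exact: lt_le_trans at0.
Qed.

(** A continuous derivative without zero has constant sign. *)
Lemma univariate_derive_sign (x y : R) : 0 < x -> 0 < y -> 0 < derive1 u x *
  derive1 u y.
Proof.
wlog xy : x y / x <= y.
  by move=> H x0 y0; have [/H|/ltW/H] := leP x y; [|rewrite mulrC]; apply.
move=> x0 y0; have ux := univariate_derive_neq0 x0; have uy :=
  univariate_derive_neq0 y0.
rewrite lt_def mulf_neq0//= leNgt; apply/negP => neg.
have [c cxy uc] : exists2 c, c \in `[x, y] & derive1 u c = 0.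
  apply: (@IVT _ (derive1 u) x y 0) => //; first by apply: continuous_within_itv =>
    // t; exact: univariate_derive_cont.
  move: neg; move: (derive1 u x) (derive1 u y) => a b neg.
  rewrite ge_min le_max; have [a0|a0] := lerP a 0.
    have b0 : 0 <= b.
      by rewrite leNgt; apply/negP => b0; move: neg; rewrite nmulr_llt0// ltNge a0.
    by rewrite b0 orbT.
  by move: neg; rewrite pmulr_rlt0// => /ltW ->; rewrite orbT (ltW a0).
have c0 : 0 < c by move: cxy; rewrite in_itv /= => /andP[+ _]; exact: lt_le_trans.
by move: (univariate_derive_neq0 c0); rewrite uc eqxx.
Qed.

Lemma univariate_continuous (t : R) : 0 < t -> {for t, continuous u}.
Proof.
move=> /univariate_derivable[ut _]; apply: differentiable_continuous.
exact/derivable1_diffP.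
Qed.

(** A divided difference is a value of the derivative, by the mean value theorem. *)
Lemma div_diff_sign (x y z : R) : 0 < x -> 0 < y -> 0 < z -> 0 < div_diff u x y *
  derive1 u z.
Proof.
move=> x0 y0 z0; rewrite /div_diff; case: eqVneq => [_|xy].
  exact: univariate_derive_sign.
have H : forall a b, 0 < a -> a < b -> 0 < (u a - u b) / (a - b) * derive1 u z.
  move=> a b a0 ab.
  have [||c cab ucE] := @MVT _ u (derive1 u) a b ab.
  - move=> c; rewrite in_itv /= => /andP[ac _].
    have [uc _] := univariate_derivable (lt_trans a0 ac).
    by rewrite derive1E; exact/derivableP.
  - by apply: continuous_within_itv => // t; exact: univariate_continuous.
  have -> : (u a - u b) / (a - b) = derive1 u c.
    have ab0 : a - b != 0 by rewrite subr_eq0 lt_eqF.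
    by rewrite -opprB ucE; field.
  apply: univariate_derive_sign => //.
  by move: cab; rewrite in_itv /= => /andP[+ _]; exact: lt_trans.
have [/H|yx|/eqP] := ltgtP x y; [exact| |by rewrite (negbTE xy)].
by have := H _ _ y0 yx; rewrite -[u y - _]opprB -[y - x]opprB invrN mulrNN.
Qed.

End ScalarPart.

(** * The mixed-Euclidean metric and duality *)

Section Metric.
Context {R : realType} {n : nat}.
Hypothesis n_gt0 : (0 < n)%N.
Local Notation S := (Sym R n).
Local Notation A := (SPD R n).

Lemma frobdot_conj (X Y : S) (P M M' : 'M[R]_n) : orthogonal_mx P ->
  symval X = P *m M *m P^T -> symval Y = P *m M' *m P^T ->
  frobdot X Y = \sum_i \sum_j M i j * M' i j.
Proof.
have E (B C : 'M[R]_n) : \sum_i \sum_j B i j * C i j = \tr (B *m C^T).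
  by apply: eq_bigr => i _; rewrite mxE; apply: eq_bigr => j _; rewrite !mxE.
move=> oP XE YE; rewrite /frobdot !E XE YE !trmx_mul trmxK !mulmxA.
rewrite -(mulmxA _ P^T P) oP mulmx1 mxtrace_mulC !mulmxA oP mul1mx.
by [].
Qed.

Lemma diff_umapE (u : R -> R) (X : S) P d : univariate_diffeo n u -> A X ->
  orthogonal_mx P -> symval X = P *m diag_mx d *m P^T ->
  'd (umap u) X = loewner u P d :> (S -> S).
Proof.
move=> du pX oP XE; apply: is_diff_val; apply: (umap_is_diff oP XE) => i.
by have [] := univariate_derivable n_gt0 du ((SPD_eig oP XE).1 pX i).
Qed.

Section TwoMaps.
Variables (u v : R -> R).
Hypotheses (du : univariate_diffeo n u) (dv : univariate_diffeo n v).
Local Notation c := ((derive1 u 1 * derive1 v 1)^-1).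

(** By [umap_is_diff], the divided differences in the metric are those by which the
    differentials of [umap u] and [umap v] multiply entries in an eigenbasis. The
    formula obtained involves no eigenbasis. *)
Lemma metric_ME_frobdot (X Y Z : S) : A X ->
  metric_ME u v X Y Z = c * frobdot ('d (umap u) X Y) ('d (umap v) X Z).
Proof.
move=> pX; have [P [d [oP XE]]] := sym_eigen X.
rewrite (metric_MEE _ _ _ _ oP XE).
have E1 := congr1 (@^~ Y) (diff_umapE du pX oP XE).
have E2 := congr1 (@^~ Z) (diff_umapE dv pX oP XE).
rewrite (congr2 frobdot E1 E2).
congr (_ * _).
rewrite (frobdot_conj (M := loewner_mx u P d Y) (M' := loewner_mx v P d Z) oP)//.
apply: eq_bigr => i _; apply: eq_bigr => j _.
rewrite [X in _ = X * _]mxE [X in _ = _ * X]mxE; ring.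
Qed.

(** Apparent in an eigenbasis, but not in [metric_ME_frobdot], where the two arguments
    are mapped by different differentials. *)
Lemma metric_ME_sym (X Y Z : S) : A X ->
  metric_ME u v X Y Z = metric_ME u v X Z Y.
Proof.
move=> pX; have [P [d [oP XE]]] := sym_eigen X.
rewrite !(metric_MEE _ _ _ _ oP XE); congr (_ * _).
by apply: eq_bigr => i _; apply: eq_bigr => j _; congr (_ * _); exact: mulrC.
Qed.

(** In an eigenbasis the metric is diagonal, with weights that are positive by
    [div_diff_sign]. *)
Lemma metric_ME_gt0 (X Y : S) : A X -> Y != 0 -> 0 < metric_ME u v X Y Y.
Proof.
move=> pX Y0; have [P [d [oP XE]]] := sym_eigen X.
have d0 := (SPD_eig oP XE).1 pX.
rewrite (metric_MEE _ _ _ _ oP XE); set M := P^T *m Y *m P.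
have u1 := univariate_derive_neq0 n_gt0 du ltr01.
have v1 := univariate_derive_neq0 n_gt0 dv ltr01.
pose w i j := c * (div_diff u (d 0 i) (d 0 j) * div_diff v (d 0 i) (d 0 j)).
have w0 i j : 0 < w i j.
  have := div_diff_sign n_gt0 du (d0 i) (d0 j) ltr01.
  have := div_diff_sign n_gt0 dv (d0 i) (d0 j) ltr01.
  set a := div_diff u _ _; set b := div_diff v _ _ => b0 a0.
  have -> : w i j = (a * derive1 u 1) * (b * derive1 v 1) / (derive1 u 1 * derive1
    v 1) ^+ 2.
    by rewrite /w -/a -/b; field; rewrite u1 v1.
  apply: divr_gt0; first exact: mulr_gt0.
  by rewrite exprn_even_gt0//= mulf_neq0.
have -> : c * (\sum_i \sum_j div_diff u (d 0 i) (d 0 j) * div_diff v (d 0 i) (d 0 j) *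
    (M i j * M i j)) = \sum_i \sum_j w i j * M i j ^+ 2.
  rewrite mulr_sumr; apply: eq_bigr => i _; rewrite mulr_sumr; apply: eq_bigr => j _.
  by rewrite /w; ring.
have t0 i j : 0 <= w i j * M i j ^+ 2 by rewrite mulr_ge0 ?sqr_ge0// ltW.
have s0 i : 0 <= \sum_j w i j * M i j ^+ 2 by apply: sumr_ge0 => j _.
rewrite lt_def sumr_ge0 ?andbT//; apply: contra Y0 => /eqP H.
have M0 : M = 0.
  apply/matrixP => i j; rewrite [RHS]mxE.
  have /psumr_eq0P H1 := H; have H2 := H1 (fun i _ => s0 i) i isT.
  have /psumr_eq0P H3 := H2; have /eqP := H3 (fun j _ => t0 i j) j isT.
  by rewrite mulf_eq0 (gt_eqF (w0 i j)) sqrf_eq0 => /eqP.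
apply/eqP; apply: val_inj; rewrite raddf0 /=.
have -> : symval Y = P *m M *m P^T.
  by rewrite /M !mulmxA (orthogonal_mxV oP) mul1mx -mulmxA (orthogonal_mxV oP) mulmx1.
by rewrite M0 mulmx0 mul0mx.
Qed.

Lemma diffeo_diff_smooth (f : R -> R) (df : univariate_diffeo n f) (X : S) :
  smooth_on A (fun x => 'd (umap f) x X).
Proof. by move=> k; have [_] := diffeo_smooth df k.+1; apply. Qed.

Lemma metric_ME_riemannian : riemannian_metric A (metric_ME u v).
Proof.
split.
- move=> x Ax a X X' Y.
  rewrite (metric_ME_frobdot _ _ Ax) (metric_ME_frobdot X _ Ax) (metric_ME_frobdot
    X' _ Ax).
  have E : 'd (umap u) x (a *: X + X') = a *: 'd (umap u) x X + 'd (umap u) x X'.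
    exact: linearP.
  rewrite (congr2 frobdot E (erefl _)) frobdotDl frobdotZl; ring.
- by move=> x Ax X Y; exact: metric_ME_sym.
- by move=> x Ax X; exact: metric_ME_gt0.
- move=> X Y k.
  apply: (Ck_ext (f := fun x => (c : R^o) * frobdot ('d (umap u) x X) ('d (umap v)
    x Y) : R^o)).
  + exact: open_SPD.
  + by move=> x Ax; rewrite metric_ME_frobdot.
  apply: Ck_mul; [exact: open_SPD|apply: Ck_cst; exact: open_SPD|].
  apply: Ck_bilin; [exact: open_SPD|exact: frobdot_bbilin| |]; exact:
    diffeo_diff_smooth.
Qed.

(** With one field read in the chart u and the other in the chart v, the metric is a
    multiple of the Frobenius product, and duality is the Leibniz rule. *)
Lemma metric_ME_dual :
  dual_connections A (metric_ME u v) (pullback_flat u) (pullback_flat v).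
Proof.
move=> X Y Z sX sY sZ x Ax.
have DX := smooth_on_is_diff (chart_field_smooth sym_basis open_SPD du sX) Ax.
have DY := smooth_on_is_diff (chart_field_smooth sym_basis open_SPD dv sY) Ax.
have D := is_diff_bilin frobdot_bbilin DX DY.
have D1 := is_diff_bilin bbilin_mul (is_diff_cstf (c : R^o) x) D.
have E y : A y -> (c : R^o) * frobdot (chart_field (umap u) X y) (chart_field (umap
  v) Y y) =
    metric_ME u v y (X y) (Y y) by move=> Ay; rewrite metric_ME_frobdot.
have D2 := is_diff_ext open_SPD Ax E D1.
rewrite (is_diff_val D2) mul0r addr0 !metric_ME_frobdot// /pullback_flat.
have E1 := diff_pullback_flat sym_basis open_SPD du Z sX Ax.
have E2 := diff_pullback_flat sym_basis open_SPD dv Z sY Ax.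
rewrite (congr2 frobdot E1 (erefl _)) (congr2 frobdot (erefl _) E2).
by rewrite /chart_field; ring.
Qed.

Lemma pullback_flat_flat (f : R -> R) : univariate_diffeo n f ->
  flat A (pullback_flat f : connection S).
Proof.
move=> df; exists S, (umap f).
by apply: (affine_chart_linear sym_basis open_SPD df (L := id) (L' := id)) => //;
   exact: blin_id.
Qed.

Lemma ME_dually_flat :
  dually_flat A (metric_ME u v) (pullback_flat u) (pullback_flat v).
Proof.
split.
- split.
  + exact: open_SPD.
  + exact: metric_ME_riemannian.
  + exact: (pullback_affine_connection sym_basis sym_basis open_SPD du).
  + exact: (pullback_affine_connection sym_basis sym_basis open_SPD dv).
- exact: metric_ME_dual.
- exact: pullback_flat_flat.
- exact: pullback_flat_flat.
Qed.

End TwoMaps.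

(** The trace only sees the diagonal of the matrix given by [umap_is_diff], where
    divided differences are derivatives. *)
Lemma tr_umap_is_diff (h h' : R -> R) (X : S) : A X ->
  (forall t : R, 0 < t -> is_derive t 1 h (h' t)) ->
  is_diff X (fun Y : S => \tr (umap h Y) : R^o) (fun H => frobdot (umap h' X) H : R^o).
Proof.
move=> pX hd; have [P [d [oP XE]]] := sym_eigen X.
have d0 := (SPD_eig oP XE).1 pX.
have bt : bounded_linear (fun Y : S => \tr Y : R^o).
  apply: (nb_linear_blin sym_basis) => a Y Z.
  by rewrite symvalD symvalZ linearP.
have D := is_diff_linl bt (umap_is_diff oP XE (fun i => @ex_derive _ _ _ _ _ _ _
  (hd _ (d0 i)))).
apply: is_diff_eq D _; apply/funext => H.
have HE : symval H = P *m (P^T *m H *m P) *m P^T.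
  by rewrite !mulmxA (orthogonal_mxV oP) mul1mx -mulmxA (orthogonal_mxV oP) mulmx1.
have trc (M : 'M[R]_n) : \tr (P *m M *m P^T) = \tr M.
  by rewrite -mulmxA mxtrace_mulC -mulmxA oP mulmx1.
rewrite (frobdot_conj oP (umapE h' oP XE) HE) /= trc.
apply: eq_bigr => i _; rewrite (bigD1 i)//= big1 ?addr0.
  rewrite [LHS]mxE /div_diff eqxx [(diag_mx _) i i]mxE eqxx mulr1n [X in _ = X * _]mxE.
  by rewrite derive1E (@derive_val _ _ _ _ _ _ _ (hd _ (d0 i))).
by move=> j /negbTE ji; rewrite mxE eq_sym ji mulr0n mul0r.
Qed.

(** In an eigenbasis of X, a function of X is diagonal and again selects the
    derivatives among the divided differences. *)
Lemma frobdot_umap_diff (u u' w : R -> R) (X H : S) :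
  (forall t : R, 0 < t -> is_derive t 1 u (u' t)) -> A X ->
  frobdot (umap w X) ('d (umap u) X H) = frobdot (umap (fun t => w t * u' t) X) H.
Proof.
move=> ud pX; have [P [d [oP XE]]] := sym_eigen X.
have d0 := (SPD_eig oP XE).1 pX.
have HE : symval H = P *m (P^T *m H *m P) *m P^T.
  by rewrite !mulmxA (orthogonal_mxV oP) mul1mx -mulmxA (orthogonal_mxV oP) mulmx1.
have D := umap_is_diff oP XE (fun i => @ex_derive _ _ _ _ _ _ _ (ud _ (d0 i))).
rewrite (is_diff_val D).
rewrite (frobdot_conj (M' := loewner_mx u P d H) oP (umapE w oP XE))//.
rewrite (frobdot_conj oP (umapE _ oP XE) HE).
apply: eq_bigr => i _; rewrite !(bigD1 i (P := xpredT))//= !big1 ?addr0.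
- rewrite [X in _ * X]mxE /div_diff eqxx ![(diag_mx _) i i]mxE !eqxx !mulr1n.
  rewrite [X in X * _ = _]mxE [X in _ = X * _]mxE mulrA.
  by rewrite derive1E (@derive_val _ _ _ _ _ _ _ (ud _ (d0 i))).
- by move=> j /negbTE ji; rewrite mxE eq_sym ji mulr0n mul0r.
- by move=> j /negbTE ji; rewrite mxE eq_sym ji mulr0n mul0r.
Qed.

End Metric.

(** * Antiderivatives on the positive half-line *)

Section OrientedIntegral.
Context {R : realType}.
Implicit Types (f F G : R -> R).

Lemma is_derive_continuous F (x d : R) : is_derive x 1 F d -> {for x, continuous F}.
Proof.
move=> [dF _]; apply: differentiable_continuous; exact/derivable1_diffP.
Qed.

Lemma derive0_const F : (forall t : R, 0 < t -> is_derive t 1 F 0) ->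
  forall x, 0 < x -> F x = F 1.
Proof.
move=> F0; have H : forall a b, 0 < a -> a <= b -> F b = F a.
  move=> a b a0 ab; apply/subr0_eq.
  have [||c _ ->] := @MVT_segment _ F (fun=> 0) a b ab; last by rewrite mul0r.
  - move=> c; rewrite in_itv /= => /andP[ac _]; apply: F0; exact: lt_trans ac.
  - apply: continuous_within_itv => // t t0; exact: is_derive_continuous (F0 _ t0).
by move=> x x0; have [/H ->|/ltW/H ->] := leP 1 x.
Qed.

Lemma same_derive_on_pos F G f : (forall t : R, 0 < t -> is_derive t 1 F (f t)) ->
  (forall t : R, 0 < t -> is_derive t 1 G (f t)) ->
  forall x, 0 < x -> F x - F 1 = G x - G 1.
Proof.
move=> dF dG x x0.
have H : forall t : R, 0 < t -> is_derive t 1 (F - G) 0.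
  by move=> t t0; apply: is_derive_eq (is_deriveB (dF t t0) (dG t t0)) _; rewrite subrr.
have := derive0_const H x0; rewrite -![(F - G) _]/(F _ - G _); lra.
Qed.

Variable f : R -> R.
Hypothesis fc : forall t : R, 0 < t -> {for t, continuous f}.

Lemma pos_integrable a b : 0 < a ->
  lebesgue_measure.-integrable `[a, b] (EFin \o f).
Proof.
move=> a0; apply: continuous_compact_integrable; first exact: segment_compact.
exact: continuous_within_itv.
Qed.

Lemma Rintegral_split a b c : 0 < a -> a <= b -> b <= c ->
  Rintegral lebesgue_measure `[b, c] f =
  Rintegral lebesgue_measure `[a, c] f - Rintegral lebesgue_measure `[a, b] f.
Proof.
move=> a0 ab bc.
rewrite (Rintegral_itvB (a := BLeft a) (b := BRight c) (x := b)) ?bnd_simp//.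
  rewrite Rintegral_itv_obnd_cbnd//.
  apply: integrableS (pos_integrable c a0) => //.
  by apply: subset_itvr; rewrite bnd_simp.
exact: pos_integrable.
Qed.

Lemma oriented_integral1 : oriented_integral 1 1 f = 0.
Proof. by rewrite /oriented_integral lexx set_itv1 Rintegral_set1. Qed.

(** With a base point a below both 1 and x, the oriented integral up to y differs from
    the integral over [a, y] by a constant, on whichever side of 1 the point y lies. *)
Lemma oriented_integral_is_derive (x : R) : 0 < x ->
  is_derive x 1 (fun y => oriented_integral 1 y f) (f x).
Proof.
move=> x0; pose a := Num.min 1 x / 2.
have m0 : 0 < Num.min 1 x by rewrite lt_min ltr01 x0.
have a0 : 0 < a by rewrite divr_gt0.
have am : a < Num.min 1 x by rewrite /a; lra.
have [a1 ax] : a < 1 /\ a < x by move: am; rewrite lt_min => /andP[].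
pose G y := Rintegral lebesgue_measure `[a, y] f.
have [dG GE] : derivable G x 1 /\ derive1 G x = f x.
  apply: (@continuous_FTC1_closed _ _ _ _ (x + 1)) => //; last exact: fc.
    by rewrite ltrDl.
  exact: pos_integrable.
have D : is_derive x 1 (G - cst (G 1)) (f x).
  apply: is_derive_eq (is_deriveB (DeriveDef dG erefl) (is_derive_cst _ _ _)) _.
  by rewrite subr0 -derive1E GE.
apply: near_eq_is_derive D.
have := open_nbhs_nbhs (conj (@open_gt _ a) (ax : [set y | a < y] x)).
apply: filterS => y /= ay; rewrite -[LHS]/(G y - G 1) /G /oriented_integral.
have [y1|y1] := leP 1 y.
  by rewrite (@Rintegral_split a 1 y)// ltW.
by rewrite (@Rintegral_split a y 1)// ?opprB// ltW.
Qed.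

End OrientedIntegral.

(** * The canonical divergence *)

Section CanonicalDivergenceME.
Context {R : realType} {n : nat}.
Hypothesis n_gt0 : (0 < n)%N.
Local Notation S := (Sym R n).
Local Notation A := (SPD R n).
Local Notation N := (n * n.+1)./2.
Variables (u v : R -> R).
Hypotheses (du : univariate_diffeo n u) (dv : univariate_diffeo n v).
Local Notation c := ((derive1 u 1 * derive1 v 1)^-1).

Lemma univariate_is_derive (w : R -> R) (t : R) : univariate_diffeo n w -> 0 < t ->
  is_derive t 1 w (derive1 w t).
Proof.
move=> dw t0; have [wd _] := univariate_derivable n_gt0 dw t0.
by rewrite derive1E; exact/derivableP.
Qed.

Lemma Psi_is_derive (w z : R -> R) (t : R) : univariate_diffeo n w ->
  univariate_diffeo n z -> 0 < t ->
  is_derive t 1 (Psi w z) (z t * derive1 w t).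
Proof.
move=> dw dz t0; apply: oriented_integral_is_derive => // s s0.
apply: continuousM; first exact: (univariate_continuous n_gt0 dz).
exact: (univariate_derive_cont n_gt0 dw).
Qed.

Lemma Phi_is_derive (t : R) : 0 < t ->
  is_derive t 1 (Phi u v) (u t * derive1 v t).
Proof.
move=> t0; have D := is_deriveD (is_derive_cst (u 1 * v 1) t 1) (Psi_is_derive dv
  du t0).
by apply: is_derive_eq D _; rewrite add0r.
Qed.

(** Both sides have derivative v u' + u v', and they agree at 1 because of the
    constant in [Phi]. *)
Lemma PsiD_Phi (t : R) : 0 < t -> Psi u v t + Phi u v t = u t * v t.
Proof.
move=> t0.
have D1 : forall s : R, 0 < s -> is_derive s 1 (Psi u v + Phi u v)
    (v s * derive1 u s + u s * derive1 v s).
  by move=> s s0; apply: is_deriveD; [exact: Psi_is_derive|exact: Phi_is_derive].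
have D2 : forall s : R, 0 < s -> is_derive s 1 (u * v)
    (v s * derive1 u s + u s * derive1 v s).
  move=> s s0.
  apply: is_derive_eq (is_deriveM (univariate_is_derive du s0)
    (univariate_is_derive dv s0)) _.
  by rewrite addrC.
have := same_derive_on_pos D1 D2 t0.
rewrite -![(_ + _ : R -> R) _]/(Psi u v _ + Phi u v _) -![(u * v) _]/(u _ * v _).
have P1 : Psi u v 1 = 0 by exact: oriented_integral1.
have P2 : Phi u v 1 = u 1 * v 1 by rewrite /Phi oriented_integral1 addr0.
by rewrite P1 P2; lra.
Qed.

Lemma frobdot_tr (X Y : S) : frobdot X Y = \tr (X *m Y).
Proof.
rewrite /frobdot; apply: eq_bigr => i _; rewrite mxE; apply: eq_bigr => j _.
by rewrite (symE Y).
Qed.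

Lemma c_neq0 : c != 0.
Proof. by rewrite invr_neq0// mulf_neq0//; apply: (univariate_derive_neq0 n_gt0). Qed.

Lemma dotmxZ (a : R) (x y : 'rV[R]_N) : Defs.dotmx (a *: x) y = a * Defs.dotmx x y.
Proof. by rewrite mulr_sumr; apply: eq_bigr => i _; rewrite mxE mulrA. Qed.

Lemma dotmx_delta (i j : 'I_N) : Defs.dotmx (delta_mx 0 i : 'rV[R]_N) (delta_mx 0
  j) = (i == j)%:R.
Proof.
rewrite /Defs.dotmx (bigD1 i)//= big1 ?addr0.
  by rewrite !mxE !eqxx /= mul1r.
by move=> k /negbTE ki; rewrite !mxE ki andbF mul0r.
Qed.

(** The coordinates are u and v, written in orthonormal coordinates of Sym(n), with
    the factor 1 / (u'(1) v'(1)) placed on u. The metric is then the dot product of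
    the differentials of U and V, and the normalized traces of Psi and Phi are
    potentials by [tr_umap_is_diff] and [frobdot_umap_diff]. *)
Lemma ME_canonical_divergence :
  canonical_divergence N A (metric_ME u v) (pullback_flat u) (pullback_flat v)
    (uv_divergence u v).
Proof.
pose U (X : S) : 'rV[R]_N := c *: sym_row (umap u X).
pose V (X : S) : 'rV[R]_N := sym_row (umap v X).
have bL : bounded_linear (fun X : S => c *: sym_row X).
  exact: blin_comp sym_row_blin (blin_scale _ c).
have bL' : bounded_linear (fun z : 'rV[R]_N => row_sym (c^-1 *: z)).
  exact: blin_comp (blin_scale _ c^-1) row_sym_blin.
have LK : cancel (fun X : S => c *: sym_row X) (fun z => row_sym (c^-1 *: z)).
  by move=> X /=; rewrite scalerA mulVf ?c_neq0// scale1r sym_rowK.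
have L'K : cancel (fun z => row_sym (c^-1 *: z)) (fun X : S => c *: sym_row X).
  by move=> z /=; rewrite row_symK scalerA mulfV ?c_neq0// scale1r.
have chU : affine_chart A (pullback_flat u) U.
  exact: (affine_chart_linear sym_basis open_SPD du bL bL' LK L'K).
have chV : affine_chart A (pullback_flat v) V.
  exact: (affine_chart_linear sym_basis open_SPD dv sym_row_blin row_sym_blin
    sym_rowK row_symK).
have dU X : A X -> is_diff X U (fun H => c *: sym_row ('d (umap u) X H)).
  by move=> pX; exact: is_diff_linl bL (diffeo_is_diff du pX).
have dV X : A X -> is_diff X V (fun H => sym_row ('d (umap v) X H)).
  by move=> pX; exact: is_diff_linl sym_row_blin (diffeo_is_diff dv pX).
pose psi (X : S) := c * \tr (umap (Psi u v) X).
pose phi (X : S) := c * \tr (umap (Phi u v) X).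
exists U, V, psi, phi; split => //.
- move=> X pX i j; rewrite (metric_ME_frobdot n_gt0 du dv _ _ pX) -dotmx_sym_row
  -dotmxZ.
  have E1 : c *: sym_row ('d (umap u) X (coord_field A U i X)) = delta_mx 0 i.
    rewrite -[LHS]/((fun H => c *: sym_row ('d (umap u) X H)) _) -(is_diff_val (dU
      X pX)).
    exact: (diff_inv_onKV chU.1 _ pX).
  have E2 : sym_row ('d (umap v) X (coord_field A V j X)) = delta_mx 0 j.
    rewrite -[LHS]/((fun H => sym_row ('d (umap v) X H)) _) -(is_diff_val (dV X pX)).
    exact: (diff_inv_onKV chV.1 _ pX).
  by rewrite (congr2 (@Defs.dotmx R N) E1 E2) dotmx_delta.
- move=> X pX.
  have dpsi := is_diff_linl (blin_scale _ c) (tr_umap_is_diff pX (fun t =>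
    Psi_is_derive du dv)).
  have dphi := is_diff_linl (blin_scale _ c) (tr_umap_is_diff pX Phi_is_derive).
  split.
  + exact: is_diff_ex dpsi.
  + exact: is_diff_ex dphi.
  + move=> H; rewrite (is_diff_val dpsi) (is_diff_val (dU X pX)).
    have -> : Defs.dotmx (V X) (c *: sym_row ('d (umap u) X H)) =
        c * Defs.dotmx (V X) (sym_row ('d (umap u) X H)).
      by rewrite mulr_sumr; apply: eq_bigr => i _; rewrite [X in _ * X = _]mxE mulrCA.
    by rewrite dotmx_sym_row (frobdot_umap_diff _ _ (fun t => univariate_is_derive
      du) pX).
  + move=> H; rewrite (is_diff_val dphi) (is_diff_val (dV X pX)).
    by rewrite dotmxZ dotmx_sym_row (frobdot_umap_diff _ _ (fun t =>
      univariate_is_derive dv) pX).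
  + rewrite /psi /phi -mulrDr dotmxZ dotmx_sym_row frobdot_tr umap_mul.
    rewrite -mxtraceD -symvalD -umapD; congr (c * \tr (symval _)).
    by apply: umap_eq_SPD pX => t t0; exact: PsiD_Phi.
- move=> X Y pX pY; rewrite /uv_divergence /psi /phi dotmxZ dotmx_sym_row frobdot_tr.
  by rewrite raddfB /= mxtraceD; ring.
Qed.

End CanonicalDivergenceME.

(** * Potentials of the mixed-power-Euclidean metrics *)

Section Potentials.
Context {R : realType} {n : nat}.
Hypothesis n_gt0 : (0 < n)%N.
Local Notation S := (Sym R n).
Local Notation A := (SPD R n).
Implicit Types (a b t : R) (X Y : S).

(** Positive definite matrices form a convex set, and the mean value theorem applies
    on the segment from the identity. *)
Lemma zero_diff_const (F : S -> R^o) :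
  (forall X, A X -> is_diff X F (fun=> 0)) -> forall X, A X -> F X = F sym1.
Proof.
move=> F0 X pX; have pI : A sym1 by have := @SPD_scalar1 R n 1 ltr01; rewrite scale1r.
pose L (t : R^o) : S := sym1 + t *: (X - sym1).
have pL t : 0 <= t <= 1 -> A (L t) by move=> t01; exact: SPD_segment.
have D (t : R^o) : 0 <= t <= 1 -> is_derive t 1 (fun t => F (L t) : R) 0.
  move=> t01.
  have D1 := is_diffDf (is_diff_cstf sym1 t) (is_diff_blin t (blin_scaler (X -
    sym1) (@blin_id _ R^o))).
  have D2 := is_diff_compf D1 (F0 _ (pL t t01)).
  have [H1 H2] := @is_diff_derive R (fun t => F (L t)) t _ D2.
  by apply: (DeriveDef H1); rewrite -derive1E H2.
have [||c _ E] := @MVT_segment R (fun t => F (L t)) (fun=> 0) 0 1 ler01.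
- move=> t; rewrite in_itv /= => /andP[t0 t1]; apply: D.
  by rewrite !ltW.
- apply: continuous_in_subspaceT => t; rewrite inE /= in_itv /= => /D.
  exact: is_derive_continuous.
have L1 : L 1 = X by rewrite /L scale1r addrC subrK.
have L0 : L 0 = sym1 by rewrite /L scale0r addr0.
by move: E; rewrite mul0r L0 L1 => /subr0_eq.
Qed.

Definition coord_fun a t : R := if a == 0 then ln t else a^-1 * t `^ a.

Lemma coord_PE_umap a X : coord_PE a X = umap (coord_fun a) X.
Proof.
rewrite /coord_PE /coord_fun; case: eqVneq => _ //.
by rewrite umapZ.
Qed.

Lemma is_derive_ln t : 0 < t -> is_derive t 1 (@ln R) (t^-1).
Proof. exact: is_derive1_ln. Qed.

Lemma is_derive_pow a t : 0 < t -> is_derive t 1 (fun x : R => x `^ a) (a * t `^ (a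
  - 1)).
Proof. exact: is_derive1_powR. Qed.

Lemma is_deriveZl (f : R -> R) (k t d : R) : is_derive t 1 f d ->
  is_derive t 1 (fun x => k * f x) (k * d).
Proof. by move=> D; apply: is_deriveZ. Qed.

Lemma is_deriveDl (f g : R -> R) (t d e : R) : is_derive t 1 f d -> is_derive t 1 g e ->
  is_derive t 1 (fun x => f x + g x) (d + e).
Proof. by move=> D E; apply: is_deriveD. Qed.

Lemma is_deriveMl (f g : R -> R) (t d e : R) : is_derive t 1 f d -> is_derive t 1 g e ->
  is_derive t 1 (fun x => f x * g x) (f t * e + g t * d).
Proof. by move=> D E; apply: is_deriveM. Qed.

Lemma coord_fun_is_derive a t : 0 < t -> is_derive t 1 (coord_fun a) (t `^ (a - 1)).
Proof.
move=> t0; rewrite /coord_fun; case: eqVneq => [->|a0].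
  by apply: is_derive_eq (is_derive_ln t0) _; rewrite sub0r powRN powRr1// ltW.
apply: is_derive_eq (is_deriveZl a^-1 (is_derive_pow a t0)) _.
by rewrite mulrA mulVf// mul1r.
Qed.

Lemma coord_PE_is_diff a X : A X -> is_diff X (coord_PE a) ('d (umap (coord_fun a)) X).
Proof.
move=> pX; have [P [d [oP XE]]] := sym_eigen X.
have d0 := (SPD_eig oP XE).1 pX.
have D := umap_is_diff oP XE (fun i => @ex_derive _ _ _ _ _ _ _
  (coord_fun_is_derive a (d0 i))).
have -> : coord_PE a = umap (coord_fun a) :> (S -> S) by apply/funext => Y; exact:
  coord_PE_umap.
by apply: differentiableP; exact: is_diff_ex D.
Qed.

Lemma diff_coord_PE w a X H : A X ->
  frobdot (umap w X) ('d (coord_PE a) X H) = frobdot (umap (fun t => w t * t `^ (a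
    - 1)) X) H.
Proof.
move=> pX; rewrite (is_diff_val (coord_PE_is_diff a pX)).
exact: (frobdot_umap_diff _ _ (coord_fun_is_derive a) pX).
Qed.

(** Here h is an antiderivative of the coordinate function of b times the derivative
    of that of a, so that the trace of h has the required differential; phi is then
    determined by psi + phi = <U | V>. Uniqueness comes from [zero_diff_const]. *)
Lemma potential_MPE_tr a b (h : R -> R) (psi0 : S -> R) :
  (forall t, 0 < t -> is_derive t 1 h (coord_fun b t * t `^ (a - 1))) ->
  (forall X, A X -> psi0 X = \tr (umap h X)) ->
  potential_MPE_is a b psi0.
Proof.
move=> hd psiE psi.
have Dh X := fun pX : A X => tr_umap_is_diff pX hd.
have ipE X H : A X -> frobdot (coord_PE b X) ('d (coord_PE a) X H) =
    frobdot (umap (fun t => coord_fun b t * t `^ (a - 1)) X) H.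
  by move=> pX; rewrite coord_PE_umap diff_coord_PE.
split=> [[phi pot]|[k psiK]].
  exists (psi sym1 - \tr (umap h (sym1 : S))) => X pX; rewrite psiE//.
  suff : psi X - \tr (umap h X) = psi sym1 - \tr (umap h (sym1 : S)) by lra.
  apply: (zero_diff_const (F := fun Y => psi Y - \tr (umap h Y))) pX => Y pY.
  have [dpsi _ psiY _ _] := pot Y pY.
  have DN := is_diff_linl (blin_scale _ (-1)) (Dh Y pY).
  have D := is_diffDf (differentiableP dpsi) DN.
  have E : (fun y => (psi y : R^o) + (-1) *: (\tr (umap h y) : R^o)) =
      (fun y => psi y - \tr (umap h y) : R^o).
    by apply/funext => y; rewrite scaleN1r.
  rewrite E in D; apply: is_diff_eq D _; apply/funext => H.
  by rewrite psiY ipE// scaleN1r subrr.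
exists (fun X => frobdot (coord_PE a X) (coord_PE b X) - psi X) => X pX.
have Dpsi : is_diff X (psi : S -> R^o)
    (fun H => frobdot (umap (fun t => coord_fun b t * t `^ (a - 1)) X) H : R^o).
  have D := is_diffDf (Dh X pX) (is_diff_cstf (k : R^o) X).
  apply: (is_diff_ext open_SPD pX (f := fun Y => \tr (umap h Y) + k : R^o)).
    by move=> Y pY; rewrite psiK// psiE.
  by apply: is_diff_eq D _; apply/funext => H; rewrite addr0.
have Da := differentiableP (is_diff_ex (coord_PE_is_diff a pX)).
have Db := differentiableP (is_diff_ex (coord_PE_is_diff b pX)).
have Dip := is_diff_bilin frobdot_bbilin Da Db.
have DN := is_diff_linl (blin_scale _ (-1)) Dpsi.
have Dphi := is_diffDf Dip DN.
have E : (fun y => (frobdot (coord_PE a y) (coord_PE b y) : R^o) + (-1) *: (psi y :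
  R^o)) =
      (fun y => frobdot (coord_PE a y) (coord_PE b y) - psi y : R^o).
  by apply/funext => y; rewrite scaleN1r.
rewrite E in Dphi; split.
- exact: is_diff_ex Dpsi.
- exact: is_diff_ex Dphi.
- by move=> H; rewrite (is_diff_val Dpsi) ipE.
- move=> H; rewrite (is_diff_val Dphi) -(ipE _ _ pX) scaleN1r.
  by rewrite (frobdotC _ (coord_PE b X)) addrK.
- by rewrite addrC subrK.
Qed.

End Potentials.

(** * Closed forms for powers and logarithm *)

Section Formulas.
Context {R : realType} {n : nat}.
Hypothesis n_gt0 : (0 < n)%N.
Local Notation S := (Sym R n).
Local Notation A := (SPD R n).
Implicit Types (a b t k : R) (X Y : S).

Definition Falpha' a t : R := (if a == 0 then 1 else a) * t `^ (a - 1).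

Lemma Falpha_is_derive a t : 0 < t -> is_derive t 1 (Falpha a) (Falpha' a t).
Proof.
move=> t0; rewrite /Falpha /Falpha'; case: eqVneq => [->|a0]; last exact: is_derive_pow.
by apply: is_derive_eq (is_derive_ln t0) _; rewrite sub0r mul1r powRN powRr1// ltW.
Qed.

Lemma derive1_Falpha a t : 0 < t -> derive1 (Falpha a) t = Falpha' a t.
Proof. by move=> t0; rewrite derive1E (@derive_val _ _ _ _ _ _ _ (Falpha_is_derive
  a t0)). Qed.

Lemma derive1_Falpha1 a : derive1 (Falpha a) 1 = if a == 0 then 1 else a.
Proof. by rewrite derive1_Falpha// /Falpha' powR1 mulr1. Qed.

Lemma mxtraceB (M M' : 'M[R]_n) : \tr (M - M') = \tr M - \tr M'.
Proof. exact: raddfB. Qed.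

Lemma tr_umapD (f g : R -> R) X :
  \tr (umap (fun t => f t + g t) X) = \tr (umap f X) + \tr (umap g X).
Proof. by rewrite umapD symvalD mxtraceD. Qed.

Lemma tr_umapZ k (f : R -> R) X : \tr (umap (fun t => k * f t) X) = k * \tr (umap f X).
Proof. by rewrite umapZ symvalZ mxtraceZ. Qed.

Lemma tr_umap_cst k X : \tr (umap (fun=> k) X) = k * n%:R.
Proof.
have [P [d [oP XE]]] := sym_eigen X; rewrite (tr_umap _ oP XE).
by rewrite sumr_const card_ord mulr_natr.
Qed.

Lemma tr_umap_eq (f g : R -> R) X : A X -> (forall t, 0 < t -> f t = g t) ->
  \tr (umap f X) = \tr (umap g X).
Proof. by move=> pX fg; rewrite (umap_eq_SPD fg pX). Qed.

(** Psi and Phi may be replaced by other antiderivatives p and q whose constants of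
    integration cancel, which is the condition on p 1 + q 1. *)
Lemma ab_divergenceE a b (p q : R -> R) X Y :
  (forall t, 0 < t -> is_derive t 1 p (Falpha b t * Falpha' a t)) ->
  (forall t, 0 < t -> is_derive t 1 q (Falpha a t * Falpha' b t)) ->
  p 1 + q 1 = Falpha a 1 * Falpha b 1 -> A X -> A Y ->
  ab_divergence a b X Y =
    ((if a == 0 then 1 else a) * (if b == 0 then 1 else b))^-1 *
    (\tr (umap p X) + \tr (umap q Y) - \tr (umap (Falpha a) X *m umap (Falpha b) Y)).
Proof.
move=> pd qd pq pX pY; rewrite /ab_divergence /uv_divergence !derive1_Falpha1.
congr (_ * _); rewrite raddfB /= mxtraceD; congr (_ - _).
have H (a' b' : R) (r : R -> R) : (forall t, 0 < t -> is_derive t 1 r (Falpha b' t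
  * Falpha' a' t)) ->
    forall t, 0 < t -> Psi (Falpha a') (Falpha b') t = r t + - r 1.
  move=> rd t t0.
  have D1 : forall s : R, 0 < s -> is_derive s 1 (Psi (Falpha a') (Falpha b'))
    (Falpha b' s * Falpha' a' s).
    move=> s s0; rewrite -derive1_Falpha//.
    exact: (Psi_is_derive n_gt0 (Falpha_diffeo n a') (Falpha_diffeo n b') s0).
  have := same_derive_on_pos D1 rd t0.
  by rewrite [X in _ - X = _]oriented_integral1 subr0.
rewrite (tr_umap_eq pX (H _ _ _ pd)).
rewrite (tr_umap_eq (f := Phi (Falpha a) (Falpha b)) (g := fun t => (Falpha a 1 *
  Falpha b 1 - q 1) + q t) pY); last first.
  move=> t t0; rewrite -[LHS]/(Falpha a 1 * Falpha b 1 + Psi (Falpha b) (Falpha a)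
    t) (H _ _ _ qd)//.
  by rewrite -addrA; congr (_ + _); rewrite addrC.
rewrite (tr_umapD p (fun=> - p 1)) (tr_umapD (fun=> Falpha a 1 * Falpha b 1 - q 1) q).
rewrite (tr_umap_cst (- p 1)) (tr_umap_cst (Falpha a 1 * Falpha b 1 - q 1)) -pq; ring.
Qed.

Lemma frobnorm_sub2 X Y : frobnorm (X - Y) ^+ 2 =
  frobdot X X - 2 * frobdot X Y + frobdot Y Y.
Proof.
have := frobnorm2 (X - Y); rewrite Sym_normE => ->.
rewrite -scaleN1r frobdotDl !frobdotDr !frobdotZl !frobdotZr (frobdotC Y X); ring.
Qed.

Lemma powRD_pos a b t : 0 < t -> t `^ a * t `^ b = t `^ (a + b).
Proof. by move=> t0; rewrite powRD// (gt_eqF t0) implybT. Qed.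

Lemma FalphaE a : a != 0 -> Falpha a = (fun t => t `^ a).
Proof. by rewrite /Falpha => /negbTE ->. Qed.

Lemma Falpha0 : Falpha 0 = @ln R.
Proof. by rewrite /Falpha eqxx. Qed.

Lemma tr_logm_det X : A X -> \tr (logm X) = ln (\det X).
Proof.
move=> pX; have [P [d [oP XE]]] := sym_eigen X.
have d0 := (SPD_eig oP XE).1 pX.
rewrite (tr_umap _ oP XE) XE !det_mulmx det_diag mulrAC -det_mulmx.
rewrite (orthogonal_mxV oP) det1 mul1r.
have [-> _] : \sum_i ln (d 0 i) = ln (\prod_i d 0 i) /\ 0 < \prod_i d 0 i.
  elim/big_rec2: _ => [|i x y _ [-> x0]]; first by rewrite ln1.
  by split; [rewrite lnM ?posrE|rewrite mulr_gt0].
by [].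
Qed.

Lemma divergence_log X Y : A X -> A Y ->
  ab_divergence 0 0 X Y = 2^-1 * frobnorm (logm X - logm Y) ^+ 2.
Proof.
move=> pX pY.
have d (t : R) : 0 < t -> is_derive t 1 (fun x : R => 2^-1 * (ln x * ln x)) (Falpha
  0 t * Falpha' 0 t).
  move=> t0; apply: is_derive_eq (is_deriveZl 2^-1 (is_deriveMl (is_derive_ln t0)
    (is_derive_ln t0))) _.
  rewrite Falpha0 /Falpha' eqxx mul1r sub0r powRN powRr1 ?ltW//; field.
  by rewrite gt_eqF.
rewrite (ab_divergenceE d d _ pX pY); last by rewrite Falpha0 ln1; ring.
pose l2 t := ln t * ln t; rewrite (tr_umapZ 2^-1 l2 X) (tr_umapZ 2^-1 l2 Y).
rewrite eqxx mulr1 invr1 mul1r frobnorm_sub2 !frobdot_tr Falpha0 /logm.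
by rewrite (umap_mul (@ln R) (@ln R) X) (umap_mul (@ln R) (@ln R) Y) -/l2; field.
Qed.

Lemma divergence_diag a X Y : a != 0 -> A X -> A Y ->
  ab_divergence a a X Y = (2 * a ^+ 2)^-1 * frobnorm (powm a X - powm a Y) ^+ 2.
Proof.
move=> a0 pX pY.
have d (t : R) : 0 < t -> is_derive t 1 (fun x : R => 2^-1 * (x `^ a * x `^ a))
  (Falpha a t * Falpha' a t).
  move=> t0; apply: is_derive_eq (is_deriveZl 2^-1 (is_deriveMl (is_derive_pow a
    t0) (is_derive_pow a t0))) _.
  by rewrite FalphaE// /Falpha' (negbTE a0); field.
rewrite (ab_divergenceE d d _ pX pY); last by rewrite FalphaE// powR1; field.
pose p2 t := t `^ a * t `^ a; rewrite (tr_umapZ 2^-1 p2 X) (tr_umapZ 2^-1 p2 Y).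
rewrite (negbTE a0) frobnorm_sub2 !frobdot_tr FalphaE// /powm.
rewrite (umap_mul (fun t => t `^ a) (fun t => t `^ a) X).
by rewrite (umap_mul (fun t => t `^ a) (fun t => t `^ a) Y) -/p2; field.
Qed.

Lemma divergence_opp a X Y : a != 0 -> A X -> A Y ->
  ab_divergence a (- a) X Y =
        - (a ^+ 2)^-1 *
        \tr ((1%:M + a *: symval (logm X)) - a *: symval (logm Y)
             - powm a X *m powm (- a) Y).
Proof.
move=> a0 pX pY; have na0 : - a != 0 by rewrite oppr_eq0.
have d1 (t : R) : 0 < t -> is_derive t 1 (fun x : R => a * ln x) (Falpha (- a) t *
  Falpha' a t).
  move=> t0; apply: is_derive_eq (is_deriveZl a (is_derive_ln t0)) _.
  rewrite FalphaE// /Falpha' (negbTE a0) mulrCA powRD_pos//.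
  have -> : - a + (a - 1) = -1 by ring.
  by rewrite powRN powRr1// ltW.
have d2 (t : R) : 0 < t -> is_derive t 1 (fun x : R => 1 + - a * ln x) (Falpha a t
  * Falpha' (- a) t).
  move=> t0; apply: is_derive_eq (is_deriveDl (f := fun=> 1) (is_derive_cst _ _ _)
    (is_deriveZl (- a) (is_derive_ln t0))) _.
  rewrite FalphaE// /Falpha' (negbTE na0) mulrCA powRD_pos// add0r.
  have -> : a + (- a - 1) = -1 by ring.
  by rewrite powRN powRr1// ltW.
rewrite (ab_divergenceE d1 d2 _ pX pY); last by rewrite !FalphaE// !powR1 ln1; ring.
rewrite (tr_umapD (fun=> 1) (fun t => - a * ln t)) (tr_umap_cst 1).
rewrite (tr_umapZ a (@ln R)) (tr_umapZ (- a) (@ln R)).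
rewrite (negbTE a0) (negbTE na0) !FalphaE//.
rewrite !mxtraceB mxtraceD mxtrace1 !mxtraceZ /logm /powm.
by field.
Qed.

Lemma divergence_zero a X Y : a != 0 -> A X -> A Y ->
        ab_divergence a 0 X Y =
        a^-1 * \tr ((powm a X *m logm X - a^-1 *: symval (powm a X))
                    + a^-1 *: symval (powm a Y) - powm a X *m logm Y).
Proof.
move=> a0 pX pY.
have d1 (t : R) : 0 < t -> is_derive t 1 (fun x : R => x `^ a * ln x + - a^-1 * x `^ a)
    (Falpha 0 t * Falpha' a t).
  move=> t0; apply: is_derive_eq (is_deriveDl (is_deriveMl (is_derive_pow a t0)
    (is_derive_ln t0))
    (is_deriveZl (- a^-1) (is_derive_pow a t0))) _.
  have -> : t^-1 = t `^ (-1) by rewrite powRN powRr1// ltW.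
  rewrite powRD_pos// Falpha0 /Falpha' (negbTE a0); field.
  by [].
have d2 (t : R) : 0 < t -> is_derive t 1 (fun x : R => a^-1 * x `^ a) (Falpha a t *
  Falpha' 0 t).
  move=> t0; apply: is_derive_eq (is_deriveZl a^-1 (is_derive_pow a t0)) _.
  rewrite FalphaE// /Falpha' eqxx mul1r sub0r powRD_pos//.
  by rewrite mulrA mulVf// mul1r.
rewrite (ab_divergenceE d1 d2 _ pX pY); last by rewrite Falpha0 FalphaE// !powR1
  ln1; ring.
pose pa t := t `^ a.
rewrite (tr_umapD (fun t => pa t * ln t) (fun t => - a^-1 * pa t)).
rewrite (tr_umapZ (- a^-1) pa) (tr_umapZ a^-1 pa).
rewrite eqxx (negbTE a0) mulr1 Falpha0 FalphaE// -(umap_mul pa (@ln R) X).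
rewrite mxtraceB mxtraceD mxtraceB !mxtraceZ /powm /logm -/pa.
by congr (_ * _); ring.
Qed.

Lemma divergence_gen a b X Y : a != 0 -> b != 0 -> a + b != 0 -> A X -> A Y ->
        ab_divergence a b X Y =
        (a * b)^-1 * \tr ((a / (a + b)) *: symval (powm (a + b) X)
                          + (b / (a + b)) *: symval (powm (a + b) Y)
                          - powm a X *m powm b Y).
Proof.
move=> a0 b0 ab0 pX pY.
have d1 (t : R) : 0 < t -> is_derive t 1 (fun x : R => (a / (a + b)) * x `^ (a + b))
    (Falpha b t * Falpha' a t).
  move=> t0; apply: is_derive_eq (is_deriveZl _ (is_derive_pow (a + b) t0)) _.
  rewrite FalphaE// /Falpha' (negbTE a0) [RHS]mulrCA powRD_pos//.
  have -> : b + (a - 1) = a + b - 1 by ring.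
  by field.
have d2 (t : R) : 0 < t -> is_derive t 1 (fun x : R => (b / (a + b)) * x `^ (a + b))
    (Falpha a t * Falpha' b t).
  move=> t0; apply: is_derive_eq (is_deriveZl _ (is_derive_pow (a + b) t0)) _.
  rewrite FalphaE// /Falpha' (negbTE b0) [RHS]mulrCA powRD_pos//.
  have -> : a + (b - 1) = a + b - 1 by ring.
  by field.
rewrite (ab_divergenceE d1 d2 _ pX pY); last by rewrite !FalphaE// !powR1; field.
pose pab t := t `^ (a + b).
rewrite (tr_umapZ (a / (a + b)) pab) (tr_umapZ (b / (a + b)) pab).
rewrite (negbTE a0) (negbTE b0) !FalphaE//.
by rewrite mxtraceB mxtraceD !mxtraceZ /powm.
Qed.

Lemma potential_log :
  potential_MPE_is 0 0 (fun X : S => 2^-1 * \tr (logm X *m logm X)).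
Proof.
apply: (potential_MPE_tr (h := fun x : R => 2^-1 * (ln x * ln x))) => [t t0|X pX].
  apply: is_derive_eq (is_deriveZl 2^-1 (is_deriveMl (is_derive_ln t0)
    (is_derive_ln t0))) _.
  rewrite /coord_fun eqxx sub0r powRN powRr1 ?ltW//; field.
  by rewrite gt_eqF.
by rewrite (umap_mul (@ln R) (@ln R) X) (tr_umapZ 2^-1 (fun t => ln t * ln t)).
Qed.

Lemma potential_diag a : a != 0 ->
  potential_MPE_is a a (fun X : S => (2 * a ^+ 2)^-1 * \tr (powm (2 * a) X)).
Proof.
move=> a0.
apply: (potential_MPE_tr (h := fun x : R => (2 * a ^+ 2)^-1 * x `^ (2 * a))) => [t
  t0|X pX].
  apply: is_derive_eq (is_deriveZl _ (is_derive_pow (2 * a) t0)) _.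
  rewrite /coord_fun (negbTE a0) -[RHS]mulrA powRD_pos//.
  have -> : a + (a - 1) = 2 * a - 1 by ring.
  by field.
exact: esym (tr_umapZ _ (fun t => t `^ (2 * a)) X).
Qed.

Lemma potential_opp a : a != 0 ->
  potential_MPE_is a (- a) (fun X : S => - a^-1 * \tr (logm X)).
Proof.
move=> a0; have na0 : - a != 0 by rewrite oppr_eq0.
apply: (potential_MPE_tr (h := fun x : R => - a^-1 * ln x)) => [t t0|X pX].
  apply: is_derive_eq (is_deriveZl _ (is_derive_ln t0)) _.
  rewrite /coord_fun (negbTE na0) -[RHS]mulrA powRD_pos//.
  have -> : - a + (a - 1) = -1 by ring.
  by rewrite powRN powRr1 ?ltW// invrN.
exact: esym (tr_umapZ _ (@ln R) X).
Qed.

Lemma potential_zero a : a != 0 ->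
  potential_MPE_is a 0 (fun X : S =>
          a^-1 * \tr (powm a X *m logm X - a^-1 *: symval (powm a X))).
Proof.
move=> a0.
apply: (potential_MPE_tr (h := fun x : R => a^-1 * (x `^ a * ln x + - a^-1 * x `^
  a))) => [t t0|X pX].
  apply: is_derive_eq (is_deriveZl a^-1 (is_deriveDl (is_deriveMl (is_derive_pow a
    t0) (is_derive_ln t0))
    (is_deriveZl (- a^-1) (is_derive_pow a t0)))) _.
  have -> : t^-1 = t `^ (-1) by rewrite powRN powRr1// ltW.
  rewrite powRD_pos// /coord_fun eqxx; field.
  by [].
pose pa t := t `^ a.
rewrite (tr_umapZ a^-1 (fun t => pa t * ln t + - a^-1 * pa t)).
rewrite (tr_umapD (fun t => pa t * ln t) (fun t => - a^-1 * pa t)) (tr_umapZ (-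
  a^-1) pa).
by rewrite mxtraceB mxtraceZ mulNr -(umap_mul pa (@ln R) X).
Qed.

Lemma potential_gen a b : a != 0 -> b != 0 -> a + b != 0 ->
  potential_MPE_is a b (fun X : S => (b * (a + b))^-1 * \tr (powm (a + b) X)).
Proof.
move=> a0 b0 ab0.
apply: (potential_MPE_tr (h := fun x : R => (b * (a + b))^-1 * x `^ (a + b))) => [t
  t0|X pX].
  apply: is_derive_eq (is_deriveZl _ (is_derive_pow (a + b) t0)) _.
  rewrite /coord_fun (negbTE b0) -[RHS]mulrA powRD_pos//.
  have -> : b + (a - 1) = a + b - 1 by ring.
  by field; rewrite ab0 b0.
exact: esym (tr_umapZ _ (fun t => t `^ (a + b)) X).
Qed.

End Formulas.

Theorem corollary5p1 (R : realType) (n : nat) (n_gt0 : (0 < n)%N) :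
  let N := (n * n.+1)./2 in
  (forall u v : R -> R,
     univariate_diffeo n u -> (forall S, SPD R n S -> SPD R n (umap u S)) ->
     univariate_diffeo n v -> (forall S, SPD R n S -> SPD R n (umap v S)) ->
     dually_flat (SPD R n) (metric_ME u v) (pullback_flat u) (pullback_flat v) /\
     canonical_divergence N (SPD R n) (metric_ME u v)
       (pullback_flat u) (pullback_flat v) (uv_divergence u v)) /\
  (forall a b : R,
     dually_flat (SPD R n) (metric_MPE a b) (connection_PE a) (connection_PE b) /\
     canonical_divergence N (SPD R n) (metric_MPE a b)
       (connection_PE a) (connection_PE b) (ab_divergence a b)) /\
  ((forall S S' : Sym R n, SPD R n S -> SPD R n S' ->
      ab_divergence 0 0 S S' = 2^-1 * frobnorm (logm S - logm S') ^+ 2) /\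
   potential_MPE_is 0 0
     (fun S : Sym R n => 2^-1 * \tr (logm S *m logm S))) /\
  (forall a : R, a != 0 ->
     (forall S S' : Sym R n, SPD R n S -> SPD R n S' ->
        ab_divergence a a S S' =
        (2 * a ^+ 2)^-1 * frobnorm (powm a S - powm a S') ^+ 2) /\
     potential_MPE_is a a
       (fun S : Sym R n => (2 * a ^+ 2)^-1 * \tr (powm (2 * a) S))) /\
  (forall a : R, a != 0 ->
     (forall S S' : Sym R n, SPD R n S -> SPD R n S' ->
        ab_divergence a (- a) S S' =
        - (a ^+ 2)^-1 *
        \tr ((1%:M + a *: symval (logm S)) - a *: symval (logm S')
             - powm a S *m powm (- a) S')) /\
     potential_MPE_is a (- a) (fun S : Sym R n => - a^-1 * \tr (logm S)) /\
     (forall S : Sym R n, SPD R n S ->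
        - a^-1 * \tr (logm S) = - a^-1 * ln (\det S))) /\
  (forall a : R, a != 0 ->
     (forall S S' : Sym R n, SPD R n S -> SPD R n S' ->
        ab_divergence a 0 S S' =
        a^-1 * \tr ((powm a S *m logm S - a^-1 *: symval (powm a S))
                    + a^-1 *: symval (powm a S') - powm a S *m logm S')) /\
     potential_MPE_is a 0
       (fun S : Sym R n =>
          a^-1 * \tr (powm a S *m logm S - a^-1 *: symval (powm a S)))) /\
  (forall a b : R, a != 0 -> b != 0 -> a + b != 0 -> a - b != 0 ->
     (forall S S' : Sym R n, SPD R n S -> SPD R n S' ->
        ab_divergence a b S S' =
        (a * b)^-1 * \tr ((a / (a + b)) *: symval (powm (a + b) S)
                          + (b / (a + b)) *: symval (powm (a + b) S')
                          - powm a S *m powm b S')) /\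
     potential_MPE_is a b
       (fun S : Sym R n => (b * (a + b))^-1 * \tr (powm (a + b) S))).
Proof.
move=> N; split; first by move=> u v du _ dv _; split;
  [exact: ME_dually_flat|exact: ME_canonical_divergence].
split.
  move=> a b; have da := Falpha_diffeo (R := R) n a; have db := Falpha_diffeo (R := R) n b.
  by split; [exact: ME_dually_flat|exact: ME_canonical_divergence].
split; first by split; [exact: divergence_log|exact: potential_log].
split.
  move=> a a0; split; last exact: potential_diag.
  by move=> S S'; exact: divergence_diag.
split.
  move=> a a0; split; first by move=> S S'; exact: divergence_opp.
  split; first exact: potential_opp.
  by move=> S pS; rewrite tr_logm_det.
split.
  move=> a a0; split; last exact: potential_zero.
  by move=> S S'; exact: divergence_zero.
move=> a b a0 b0 ab0 _; split; last exact: potential_gen.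
by move=> S S'; exact: divergence_gen.
Qed.
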